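(* Let $G$ be a Lie group with Lie algebra $\mathfrak{g}$, and let $\otimes(\mathfrak{g})$ be the tensor algebra of $\mathfrak g$. Let $\tilde\ast,\tilde\Delta,\tilde\varepsilon,\tilde S,\tilde\partial$ be the smooth bundle maps on $G\times(\otimes(\mathfrak{g})\otimes\wedge(\mathfrak{g}^-))$ given by the formulas (M), (C), (U), (A), (B) of the context, which lift the corresponding bundle maps on the bundle $\mathcal{U}(G)\cong G\times (U(\mathfrak{g})\otimes\wedge(\mathfrak{g}^-))$ of currents on $G$ supported at a single point, along the natural quotient $\otimes(\mathfrak{g})\to U(\mathfrak{g})$. Then, applying $\Gamma^{finite}$ to these lifted maps, the space $\Gamma^{finite}(G\times(\otimes(\mathfrak{g})\otimes\wedge(\mathfrak{g}^-)))$ has the structure of a filtered and graded Hopf algebra. Moreover, the lift $\partial$ of the boundary, while in general not a differential, respects the filtration and grading (i.e. it lowers the grading by $1$ and raises the filtration by at most $1$), and it commutes with the co-algebra structure as a differential would: $\Delta\partial(x)=\partial x_{(1)}\otimes x_{(2)}+(-1)^{|x_{(1)}|}x_{(1)}\otimes\partial x_{(2)}$ for all $x$.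
   Context: Notation. $\mathfrak{g}^-$ is $\mathfrak{g}$ with the negative of its Lie bracket; as a graded vector space $\wedge(\mathfrak{g}^-)=\wedge(\mathfrak{g})$. $\otimes(\mathfrak{g})$ and $U(\mathfrak{g})$ are Hopf algebras in which elements of $\mathfrak{g}$ are primitive; $\otimes(\mathfrak{g})$ is filtered by tensor degree. $\wedge(\mathfrak{g}^-)$ is the graded Hopf algebra in which elements of $\mathfrak{g}$ are primitive of degree $1$; its antipode is $S(\alpha)=(-1)^k\alpha$ for $\alpha\in\wedge^k$. Sweedler notation is used for all co-products. $\mathrm{Ad}_p$ is extended to $\otimes(\mathfrak{g})$ and $\wedge(\mathfrak{g}^-)$ by algebra automorphisms. $[\cdot,\cdot]$ denotes the bracket of $\mathfrak{g}$ and also its extension $[v,\beta]$ to an action on $\wedge(\mathfrak{g}^-)$: each $x\in\mathfrak{g}$ acts as the degree-zero derivation extending $y\mapsto[x,y]$, and this extends to an algebra action of $U(\mathfrak{g})$, hence of $\otimes(\mathfrak{g})$ via the quotient $\otimes(\mathfrak{g})\to U(\mathfrak{g})$. $\Gamma^{finite}(E)=\bigoplus_{x}E_x$ is the space of (not necessarily continuous) finitely supported sections of a bundle $E$; thus $\Gamma^{finite}(G\times V)$, with $V=\otimes(\mathfrak{g})\otimes\wedge(\mathfrak{g}^-)$, consists of finite sums of elements $(p,x)$ with $p\in G$, $x\in V$, linear in $x$. A bundle map $\varphi:E\to F$ covering $f$ induces $\Gamma^{finite}(\varphi)(s)(y)=\sum_{f(x)=y}\varphi(s(x))$; in particular the fiberwise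 formulas below are extended linearly, with values of the co-product at $p$ regarded in $\Gamma^{finite}(G\times V)\otimes\Gamma^{finite}(G\times V)$ via the fiber at $p$, and values of the co-unit in $\mathbb{R}$ by summation over points. The formulas, for $p,q\in G$, $v,w\in\otimes(\mathfrak{g})$, $\alpha,\beta\in\wedge(\mathfrak{g}^-)$, with products in the left tensor factor taken in $\otimes(\mathfrak{g})$: (B) for $\alpha=\alpha_0\wedge\cdots\wedge\alpha_k$: $\partial(p,v\otimes\alpha)=\Big(p,\ \sum_{i=0}^k(-1)^i\,\mathrm{Ad}_p^{-1}(\alpha_i)\,v\otimes\alpha_0\wedge\cdots\hat{\alpha_i}\cdots\wedge\alpha_k+\sum_{i<j}(-1)^{i+j+1}v\otimes[\alpha_i,\alpha_j]\wedge\alpha_0\wedge\cdots\hat{\alpha_i}\cdots\hat{\alpha_j}\cdots\wedge\alpha_k\Big)$, and $\partial=0$ in degree $0$; (C) $\Delta(p,v\otimes\alpha)=(p,(v_{(1)}\otimes\alpha_{(1)})\otimes(v_{(2)}\otimes\alpha_{(2)}))$; (U) $\varepsilon(p,v\otimes\alpha)=(p,\varepsilon(v)\varepsilon(\alpha))$; (M) $(p,v\otimes\alpha)\ast(q,w\otimes\beta)=(pq,\ \mathrm{Ad}_q^{-1}(v_{(1)})\,w\otimes\alpha\wedge\mathrm{Ad}_p[v_{(2)},\beta])$; (A) $S(p,v\otimes\alpha)=(p^{-1},\ \mathrm{Ad}_p(S(v_{(1)}))\otimes[S(v_{(2)}),\mathrm{Ad}_p^{-1}S(\alpha)])$. The unit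 is $(e,1\otimes1)$. The grading is by the degree $k$ in $\wedge^k$; the filtration is by the filtration of $\otimes(\mathfrak{g})$. A filtered and graded Hopf algebra is a graded space $\mathcal{H}=\bigoplus_k\mathcal{H}_k$, $\mathcal{H}_k=\bigcup_r\mathcal{H}_k^r$, with a graded Hopf algebra structure (Koszul sign convention $(x\otimes y)(x'\otimes y')=(-1)^{|y||x'|}xx'\otimes yy'$ on $\mathcal{H}\otimes\mathcal{H}$) such that $\mathcal{H}_i^s\mathcal{H}_j^t\subseteq\mathcal{H}_{i+j}^{s+t}$, $\Delta(\mathcal{H}_k^r)\subseteq\bigoplus_{i+j=k}\sum_{s+t=r}\mathcal{H}_i^s\otimes\mathcal{H}_j^t$, $\varepsilon(\mathcal{H}_k)=0$ for $k>0$, and the antipode maps $\mathcal{H}_k^r$ to itself. *)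

(* Defs.v *)
(* MathComp + MathComp-Analysis; free modules and free monoids come from
   multinomials' monalg, whose notations clash with those of Analysis. *)
From HB Require Import structures.
From mathcomp Require monalg.
Import -(notations) monalg.
From mathcomp Require Import all_boot all_order all_algebra finmap.
From mathcomp Require Import all_classical all_reals all_analysis.
Import numFieldNormedType.Exports.

Set Implicit Arguments.
Unset Strict Implicit.
Unset Printing Implicit Defensive.

Import Order.TTheory GRing.Theory Num.Theory.

Local Open Scope classical_set_scope.
Local Open Scope ring_scope.

(* For V finite-dimensional (the only use), [Ck k D f] with D open is
   the usual "f is of class C^k on D": the directional derivatives along fixed
   vectors are required to be of class C^(k-1). *)
Fixpoint Ck (R : realType) (V W : normedModType R) (k : nat) (D : set V)
    (f : V -> W) : Prop :=
  match k with
  | 0 => forall x, D x -> {for x, continuous f}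
  | k'.+1 => (forall x, D x -> differentiable f x) /\
             (forall v, Ck k' D (fun x => 'd f x v))
  end.

Definition smooth_on (R : realType) (V W : normedModType R) (D : set V)
    (f : V -> W) : Prop :=
  forall k, Ck k D f.

(* The values of [cmap] outside [cdom], and of [cinv] outside
   [cmap @` cdom], are irrelevant. *)
Record chart (R : realType) (n : nat) (M : topologicalType) := Chart {
  cdom : set M;
  cmap : M -> 'rV[R]_n;
  cinv : 'rV[R]_n -> M;
  cdom_open : open cdom;
  cimg_open : open (cmap @` cdom);
  cmapK : forall p, cdom p -> cinv (cmap p) = p;
  cmap_cont : forall p, cdom p -> {for p, continuous cmap};
  cinv_cont : forall x, (cmap @` cdom) x -> {for x, continuous cinv}
}.

Definition smoothly_compatible (R : realType) (n : nat) (M : topologicalType)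
    (c d : chart R n M) : Prop :=
  smooth_on (cmap c @` (cdom c `&` cdom d)) (cmap d \o cinv c).

HB.structure Definition TopologicalGroupBase :=
  { G of Topological G & Group G }.
Notation topGroupBaseType := TopologicalGroupBase.type.

(* Second countability is not required. The atlas need not be maximal. *)
Record lieGroup (R : realType) (n : nat) := LieGroup {
  lie_sort :> topGroupBaseType;
  lie_atlas : set (chart R n lie_sort);
  lie_hausdorff : hausdorff_space lie_sort;
  lie_cover : forall p : lie_sort, exists2 c, lie_atlas c & cdom c p;
  lie_compatible : forall c d,
    lie_atlas c -> lie_atlas d -> smoothly_compatible c d;
  lie_mul_continuous :
    continuous (fun pq : lie_sort * lie_sort => (pq.1 * pq.2)%g);
  lie_inv_continuous : continuous (fun p : lie_sort => (p^-1)%g);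
  lie_mul_smooth : forall c1 c2 c3,
    lie_atlas c1 -> lie_atlas c2 -> lie_atlas c3 ->
    smooth_on
      [set xy : 'rV[R]_n * 'rV[R]_n |
        [/\ (cmap c1 @` cdom c1) xy.1, (cmap c2 @` cdom c2) xy.2 &
            cdom c3 (cinv c1 xy.1 * cinv c2 xy.2)%g]]
      (fun xy => cmap c3 (cinv c1 xy.1 * cinv c2 xy.2)%g);
  lie_inv_smooth : forall c1 c2, lie_atlas c1 -> lie_atlas c2 ->
    smooth_on
      [set x | (cmap c1 @` cdom c1) x /\ cdom c2 ((cinv c1 x)^-1)%g]
      (fun x => cmap c2 ((cinv c1 x)^-1)%g)
}.

(* A chart c around the unit identifies the tangent space T_e G, i.e. the Lie
   algebra, with 'rV[R]_n. *)
Section LieAlgebra.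
Variables (R : realType) (n : nat) (G : lieGroup R n) (c : chart R n G).

Definition Ad (p : G) (x : 'rV[R]_n) : 'rV[R]_n :=
  'd (fun y => cmap c (p * cinv c y * p^-1)%g) (cmap c 1%g) x.

(* Coordinate expression, at the point of coordinates z, of the left-invariant
   vector field whose value at the unit is x. *)
Definition left_invariant (x z : 'rV[R]_n) : 'rV[R]_n :=
  'd (fun y => cmap c (cinv c z * cinv c y)%g) (cmap c 1%g) x.

(* Value at the unit of the commutator [X, Y] = DY.X - DX.Y of the
   left-invariant vector fields X, Y extending x, y. *)
Definition lie_bracket (x y : 'rV[R]_n) : 'rV[R]_n :=
  'd (left_invariant y) (cmap c 1%g) x - 'd (left_invariant x) (cmap c 1%g) y.

End LieAlgebra.

(* [malg K R] is the free R-module on K, with [mcoeff k x] the coefficient of x at k.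
   The tensor product of the free modules on K and L is the free module on
   K * L. *)
Notation bvec k := (mkmalgU k 1).

Section FreeModule.
Variable R : realType.
Implicit Types K L : choiceType.

Definition lext K (M : lmodType R) (f : K -> M) (x : malg K R) : M :=
  \sum_(k <- msupp x) mcoeff k x *: f k.

Definition tens K L (x : malg K R) (y : malg L R) : malg (K * L)%type R :=
  lext (fun a => lext (fun b => bvec (a, b)) y) x.

(* The linear map induced on the tensor product by a bilinear F: for a
   coproduct D, [tlift F (D x)] is F(x_(1), x_(2)) in Sweedler notation. *)
Definition tlift K L (M : lmodType R) (F : malg K R -> malg L R -> M)
    (t : malg (K * L)%type R) : M :=
  lext (fun ab => F (bvec ab.1) (bvec ab.2)) t.

Definition tassoc K1 K2 K3 (t : malg ((K1 * K2) * K3)%type R) :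
    malg (K1 * (K2 * K3))%type R :=
  lext (fun abc => bvec (abc.1.1, (abc.1.2, abc.2))) t.

End FreeModule.

Notation "x ⊗ y" := (tens x y) (at level 40, left associativity).

Section FilteredGradedHopf.
Variables (R : realType) (K : choiceType).
(* [deg] is the degree of the elements of the basis K. *)
Variable deg : K -> nat.
Local Notation H := (malg K R).
Local Notation HH := (malg (K * K)%type R).

Definition homog (k : nat) : set H :=
  [set x | forall b, b \in msupp x -> deg b = k].

(* x |-> (-1)^|x| x *)
Definition gsign (x : H) : H := lext (fun b => (-1) ^+ deg b *: bvec b) x.

(* (x ⊗ y)(x' ⊗ y') = (-1)^(|y||x'|) xx' ⊗ yy' *)
Definition koszul_mul (m : H -> H -> H) (s t : HH) : HH :=
  lext (fun a => lext (fun b =>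
    (-1) ^+ (deg a.2 * deg b.1)%N *:
      (m (bvec a.1) (bvec b.1) ⊗ m (bvec a.2) (bvec b.2))) t) s.

(* The sum over i + j = k and s + t = r of the F i s ⊗ F j t. *)
Definition tensor_filtration (F : nat -> nat -> set H) (k r : nat) : set HH :=
  [set z | exists2 l : seq (H * H),
     (forall xy, xy \in l -> exists i j s t,
        [/\ (i + j = k)%N, (s + t = r)%N, F i s xy.1 & F j t xy.2]) &
     z = \sum_(xy <- l) xy.1 ⊗ xy.2].

Record filtered_graded_hopf (F : nat -> nat -> set H) (m : H -> H -> H)
    (one : H) (Delta : H -> HH) (eps : H -> R) (S : H -> H) : Prop :=
  FilteredGradedHopf {
  fgh_F0 : forall k r, F k r 0;
  fgh_Flin : forall k r a x y, F k r x -> F k r y -> F k r (a *: x + y);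
  fgh_Fmono : forall k r s, (r <= s)%N -> F k r `<=` F k s;
  fgh_Fexh : forall k, \bigcup_r F k r = homog k;
  fgh_mul_linl : forall y, linear (m^~ y);
  fgh_mul_linr : forall x, linear (m x);
  fgh_mulA : associative m;
  fgh_mul1l : left_id one m;
  fgh_mul1r : right_id one m;
  fgh_Delta_lin : linear Delta;
  fgh_eps_lin : scalar eps;
  fgh_coassoc : forall x,
    tassoc (tlift (fun x1 x2 => Delta x1 ⊗ x2) (Delta x)) =
    tlift (fun x1 x2 => x1 ⊗ Delta x2) (Delta x);
  fgh_counitl : forall x, tlift (fun x1 x2 => eps x1 *: x2) (Delta x) = x;
  fgh_counitr : forall x, tlift (fun x1 x2 => eps x2 *: x1) (Delta x) = x;
  fgh_DeltaM : forall x y,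
    Delta (m x y) = koszul_mul m (Delta x) (Delta y);
  fgh_Delta1 : Delta one = one ⊗ one;
  fgh_epsM : forall x y, eps (m x y) = eps x * eps y;
  fgh_eps1 : eps one = 1;
  fgh_S_lin : linear S;
  fgh_antipodel : forall x,
    tlift (fun x1 x2 => m (S x1) x2) (Delta x) = eps x *: one;
  fgh_antipoder : forall x,
    tlift (fun x1 x2 => m x1 (S x2)) (Delta x) = eps x *: one;
  fgh_one_deg : homog 0 one;
  fgh_mulF : forall i j s t x y,
    F i s x -> F j t y -> F (i + j)%N (s + t)%N (m x y);
  fgh_DeltaF : forall k r x, F k r x -> tensor_filtration F k r (Delta x);
  fgh_eps_deg : forall k x, (0 < k)%N -> homog k x -> eps x = 0;
  fgh_SF : forall k r x, F k r x -> F k r (S x)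
}.

End FilteredGradedHopf.

(* The tensor algebra is the free algebra on the canonical basis, i.e. the
   monoid algebra of the free monoid (words on 'I_n). *)
Notation tensor_alg R n := (malg (fmonom 'I_n) R).

(* The basis element A is the product of the canonical basis vectors of
   indices in A, in increasing order. *)
Notation exterior_alg R n := (malg {set 'I_n} R).

Section TensorExterior.
Variables (R : realType) (n : nat).
Local Notation g := 'rV[R]_n.
Local Notation T := (tensor_alg R n).
Local Notation E := (exterior_alg R n).

Definition e_ (i : 'I_n) : g := delta_mx 0 i.

Definition inT (x : g) : T := \sum_i x 0 i *: bvec (fmu i).

(* The coproduct is the algebra morphism to T ⊗ T (no signs: T is in degree 0)
   for which the generators are primitive. *)
Definition DeltaT (v : T) : malg (fmonom 'I_n * fmonom 'I_n)%type R :=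
  lext (fun w : fmonom 'I_n =>
    foldr (fun i => koszul_mul (fun=> 0%N) *%R
                      (inT (e_ i) ⊗ (1 : T) + (1 : T) ⊗ inT (e_ i)))
      ((1 : T) ⊗ (1 : T)) w) v.

Definition epsT (v : T) : R := mcoeff (FMonom [::]) v.

Definition antipodeT (v : T) : T :=
  lext (fun w : fmonom 'I_n => (-1) ^+ size w *: bvec (FMonom (rev w))) v.

(* The algebra endomorphism extending a linear f. *)
Definition mapT (f : g -> g) (v : T) : T :=
  lext (fun w : fmonom 'I_n => \prod_(i <- (w : seq 'I_n)) inT (f (e_ i))) v.

Definition inE (x : g) : E := \sum_i x 0 i *: bvec [set i]%SET.

Definition oneE : E := bvec finset.set0.

Definition wedge (x y : E) : E :=
  lext (fun A : {set 'I_n} => lext (fun B : {set 'I_n} =>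
    if [disjoint A & B] then
      (-1) ^+ #|[set ab : 'I_n * 'I_n |
                 [&& ab.1 \in A, ab.2 \in B & (ab.2 < ab.1)%N]]%SET| *:
        bvec (A :|: B)
    else 0) y) x.

(* alpha_0 ∧ ... ∧ alpha_k *)
Definition wedges (s : seq g) : E :=
  foldr (fun x => wedge (inE x)) oneE s.

Definition frame (A : {set 'I_n}) : seq g := [seq e_ i | i <- enum A].

(* The algebra morphism to the graded algebra E ⊗ E for which the generators
   are primitive. *)
Definition DeltaE (a : E) : malg ({set 'I_n} * {set 'I_n})%type R :=
  lext (fun A : {set 'I_n} =>
    foldr (fun x => koszul_mul (fun B : {set 'I_n} => #|B|) wedge
                      (inE x ⊗ oneE + oneE ⊗ inE x))
      (oneE ⊗ oneE) (frame A)) a.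

Definition epsE (a : E) : R := mcoeff (finset.set0 : {set 'I_n}) a.

Definition antipodeE (a : E) : E :=
  lext (fun A : {set 'I_n} => (-1) ^+ #|A| *: bvec A) a.

(* The algebra endomorphism extending a linear f. *)
Definition mapE (f : g -> g) (a : E) : E :=
  lext (fun A : {set 'I_n} => wedges (map f (frame A))) a.

(* The degree-zero derivation extending a linear f. *)
Definition derE (f : g -> g) (a : E) : E :=
  lext (fun A : {set 'I_n} => let s := frame A in
    \sum_(i < size s) wedges (set_nth 0 s i (f (nth 0 s i)))) a.

(* The algebra action of T on E for which x in g acts as the derivation
   extending y |-> [x, y]. *)
Definition actE (br : g -> g -> g) (v : T) (a : E) : E :=
  lext (fun w : fmonom 'I_n =>
    foldr (fun i => derE (br (e_ i))) a w) v.

End TensorExterior.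

Definition fibre_idx (n : nat) : choiceType :=
  (fmonom 'I_n * {set 'I_n})%type.
Definition cur_idx (R : realType) (n : nat) (G : lieGroup R n) : choiceType :=
  (G * fibre_idx n)%type.

(* Finitely supported sections of G × (T ⊗ E): the direct sum over p in G of
   copies of T ⊗ E. *)
Notation currents R G := (malg (@cur_idx R _ G) R).

Section Currents.
Variables (R : realType) (n : nat) (G : lieGroup R n) (c : chart R n G).
Local Notation g := 'rV[R]_n.
Local Notation T := (tensor_alg R n).
Local Notation E := (exterior_alg R n).
Local Notation br := (lie_bracket c).
Local Notation Ad := (Ad c).
Local Notation fibre_idx := (fibre_idx n).
Local Notation cur_idx := (cur_idx G).
Local Notation H := (currents R G).
Local Notation HH := (malg (cur_idx * cur_idx)%type R).

(* The section (p, x) supported at p. *)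
Definition at_pt (p : G) (x : malg fibre_idx R) : H :=
  lext (fun b => bvec (p, b)) x.

(* Linear extension of (p, v ⊗ alpha) |-> F p v alpha, F bilinear in
   (v, alpha). *)
Definition cur_ext (M : lmodType R) (F : G -> T -> E -> M) (x : H) : M :=
  lext (fun b : cur_idx => F b.1 (bvec b.2.1) (bvec b.2.2)) x.

Definition cur_deg (b : cur_idx) : nat := #|b.2.2|.

Definition cur_filtration (k r : nat) : set H :=
  [set x | forall b : cur_idx, b \in msupp x ->
     #|b.2.2| = k /\ (fdeg b.2.1 <= r)%N].

Definition cur_mul (x y : H) : H :=
  cur_ext (fun p v a => cur_ext (fun q w b =>
    tlift (fun v1 v2 : T =>
      at_pt (p * q)%g
        ((mapT (Ad q^-1%g) v1 * w) ⊗ wedge a (mapE (Ad p) (actE br v2 b))))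
    (DeltaT v)) y) x.

Definition cur_one : H := at_pt 1%g ((1 : T) ⊗ oneE R n).

Definition cur_Delta (x : H) : HH :=
  cur_ext (fun p v a =>
    tlift (fun v1 v2 : T => tlift (fun a1 a2 : E =>
      at_pt p (v1 ⊗ a1) ⊗ at_pt p (v2 ⊗ a2)) (DeltaE a)) (DeltaT v)) x.

Definition cur_eps (x : H) : R :=
  cur_ext (fun p v a => epsT v * epsE a : R^o) x.

Definition cur_antipode (x : H) : H :=
  cur_ext (fun p v a => tlift (fun v1 v2 : T =>
    at_pt p^-1%g
      (mapT (Ad p) (antipodeT v1) ⊗
       actE br (antipodeT v2) (mapE (Ad p^-1%g) (antipodeE a))))
    (DeltaT v)) x.

Definition omit (i : nat) (s : seq g) : seq g := take i s ++ drop i.+1 s.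

(* The boundary of (p, v ⊗ s_0 ∧ ... ∧ s_k); it is 0 for s = [::]. *)
Definition bd_formula (p : G) (v : T) (s : seq g) : H :=
  at_pt p
    (\sum_(i < size s)
       (-1) ^+ i *: ((inT (Ad p^-1%g (nth 0 s i)) * v) ⊗ wedges (omit i s))
   + \sum_(i < size s) \sum_(j < size s | (i < j)%N)
       (-1) ^+ (i + j + 1)%N *:
         (v ⊗ wedge (inE (br (nth 0 s i) (nth 0 s j)))
                    (wedges (omit i (omit j s))))).

Definition cur_bd (x : H) : H :=
  lext (fun b : cur_idx => bd_formula b.1 (bvec b.2.1) (frame R b.2.2)) x.

End Currents.

(* Main.v *)
(* The algebra of currents is generated by the points (p, 1 ⊗ 1) and the elements
   X = (e, x ⊗ 1) and V = (e, 1 ⊗ x), whose left multiplications are simple: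
   translation by p twisted by Ad_p, the map
   (q, w ⊗ b) |-> (q, Ad_q^-1(x) w ⊗ b + w ⊗ [x, b]), and x ∧ -. Since Ad is an
   action by automorphisms of the Lie algebra, associativity and the
   multiplicativity of the coproduct can be checked on these generators. The
   boundary satisfies bd (V u) = X u - V (bd u), from which the coderivation
   property follows by induction on the exterior degree.

   That Ad_p preserves brackets is obtained by differentiating twice, in a chart,
   the identity c_p(z y) = c_p(z) c_p(y) for the conjugation c_p; the second
   derivative of c_p is symmetric and cancels from the bracket.

   The boundary of R^2 does not square to zero because x and y commute in the
   enveloping algebra but not in the tensor algebra:
   bd (bd (x ∧ y)) = y x + [x, y] - x y. *)
Require Import Defs.
From HB Require Import structures.
From mathcomp Require monalg.
Import -(notations) monalg.
From mathcomp Require Import all_boot all_order all_algebra finmap.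
From mathcomp Require Import all_classical all_reals all_analysis.
From mathcomp Require Import ring.
Import numFieldNormedType.Exports.
Import Order.TTheory GRing.Theory Num.Theory.
Local Open Scope classical_set_scope.
Local Open Scope ring_scope.

Set Implicit Arguments.
Unset Strict Implicit.
Unset Printing Implicit Defensive.

(** * Linear maps between free modules *)

(** Induction on generators is not circular: the elements x with x(yz) = (xy)z for all y, z are
    closed under products before associativity is known. Multiplicativity of the coproduct is closed
    in the same way, by associativity of the product and of its Koszul square. The antipode axioms
    are instead computed in Sweedler notation, where cocommutativity of the tensor algebra lets the
    factors be regrouped.

    On the exterior algebra the obstacle is that multiplying an increasing basis product by a vector
    produces signs. They are dealt with once, in a universal property: operators c_x, linear in x,
    with c_x c_x = 0 determine a map carrying x ∧ - to c_x. Functoriality, the coproduct,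
    derivations and the boundary are all instances; for the last two, c_x acts on pairs (u, D u).

    In the calculus part, the symmetry of the second derivative is proved from twice
    differentiability at one point, a property stable under the compositions that express
    conjugation in charts. *)

Definition lin (R : realType) (U V : lmodType R) (f : U -> V) : Prop :=
  forall a x y, f (a *: x + y) = a *: f x + f y.

Lemma congrD (V : zmodType) (a a' b b' : V) : a = a' -> b = b' -> a + b = a' + b'.
Proof. by move=> -> ->. Qed.

Section Lin.
Variable R : realType.
Implicit Types U V W : lmodType R.

Lemma lin_id U : lin (fun x : U => x). Proof. by []. Qed.

Lemma lin_zero U V : lin (fun _ : U => 0 : V).
Proof. by move=> a x y; rewrite scaler0 addr0. Qed.

Lemma lin_comp U V W (f : V -> W) (g : U -> V) :
  lin f -> lin g -> lin (fun x => f (g x)).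
Proof. by move=> hf hg a x y; rewrite hg hf. Qed.

Lemma lin_add U V (f g : U -> V) : lin f -> lin g -> lin (fun x => f x + g x).
Proof. by move=> hf hg a x y; rewrite hf hg scalerDr addrACA. Qed.

Lemma lin_opp U V (f : U -> V) : lin f -> lin (fun x => - f x).
Proof. by move=> hf a x y; rewrite hf scalerN opprD. Qed.

Lemma lin_scale U V k (f : U -> V) : lin f -> lin (fun x => k *: f x).
Proof. by move=> hf a x y; rewrite hf scalerDr !scalerA mulrC. Qed.

Lemma lin_sum U V (I : Type) (r : seq I) (P : pred I) (f : I -> U -> V) :
  (forall i, lin (f i)) -> lin (fun x => \sum_(i <- r | P i) f i x).
Proof.
move=> hf a x y; rewrite scaler_sumr -big_split /=.
by apply: eq_bigr => i _; apply: hf.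
Qed.

Lemma lin0 U V (f : U -> V) : lin f -> f 0 = 0.
Proof.
by move=> hf; have := hf (-1) 0 0; rewrite scaleN1r oppr0 addr0 scaleN1r addNr.
Qed.

Lemma linD U V (f : U -> V) : lin f -> {morph f : x y / x + y}.
Proof. by move=> hf x y; have := hf 1 x y; rewrite !scale1r. Qed.

Lemma linZ U V (f : U -> V) : lin f -> forall a, {morph f : x / a *: x}.
Proof. by move=> hf a x; rewrite -[a *: x]addr0 hf lin0 // addr0. Qed.

Lemma linN U V (f : U -> V) : lin f -> {morph f : x / - x}.
Proof. by move=> hf x; rewrite -scaleN1r linZ // scaleN1r. Qed.

Lemma linB U V (f : U -> V) : lin f -> {morph f : x y / x - y}.
Proof. by move=> hf x y; rewrite linD // linN. Qed.

Lemma lin_bigsum U V (f : U -> V) (I : Type) (r : seq I) (P : pred I)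
    (F : I -> U) : lin f ->
  f (\sum_(i <- r | P i) F i) = \sum_(i <- r | P i) f (F i).
Proof. by move=> hf; apply: (big_morph f (linD hf) (lin0 hf)). Qed.

Lemma lin_scalel U V (f : U -> R^o) (v : V) :
  lin f -> lin (fun x => (f x : R) *: v).
Proof. by move=> hf a x y; rewrite hf scalerDl scalerA. Qed.

Lemma scale_eqN U (u : U) p q : p = - q -> p *: u = - (q *: u).
Proof. by move=> ->; rewrite scaleNr. Qed.

Lemma eqN_eq0 U (u : U) : u = - u -> u = 0.
Proof.
move=> /eqP; rewrite -subr_eq0 opprK -mulr2n -scaler_nat scaler_eq0.
by rewrite pnatr_eq0 => /eqP.
Qed.

End Lin.

Section FreeModule.
Variable R : realType.
Implicit Types (K L : choiceType) (M N U V : lmodType R).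

(** Enlarging the index set allows sums over different supports to be compared on a common one. *)
Lemma lextE K M (f : K -> M) (x : malg K R) (d : {fset K}) :
  (msupp x `<=` d)%fset -> lext f x = \sum_(k <- d) mcoeff k x *: f k.
Proof.
move=> sd; rewrite /lext (big_fset_incl _ sd) //.
by move=> k _ /mcoeff_outdom ->; rewrite scale0r.
Qed.

Lemma lin_lext K M (f : K -> M) : lin (lext f : malg K R -> M).
Proof.
move=> a x y.
pose d := (msupp (a *: x + y) `|` (msupp x `|` msupp y))%fset.
rewrite !(@lextE _ _ _ _ d); last first.
- by rewrite /d fsubsetUl.
- by rewrite /d fsubsetU // fsubsetUl orbT.
- by rewrite /d fsubsetU // fsubsetUr orbT.
rewrite scaler_sumr -big_split; apply: eq_bigr => k _ /=.
by rewrite mcoeffD mcoeffZ scalerDl scalerA.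
Qed.

Lemma lext_bvec K M (f : K -> M) k : lext f (bvec k : malg K R) = f k.
Proof. by rewrite /lext msuppU oner_eq0 big_seq_fset1 mcoeffUU scale1r. Qed.

Lemma eq_lext K M (f g : K -> M) (x : malg K R) :
  f =1 g -> lext f x = lext g x.
Proof. by move=> fg; apply: eq_bigr => k _; rewrite fg. Qed.

Lemma malg_expand K (x : malg K R) : x = \sum_(k <- msupp x) mcoeff k x *: bvec k.
Proof.
rewrite [LHS]monalgE; apply: eq_bigr => k _.
by apply/malgP => l; rewrite mcoeffZ !mcoeffU mulr_natr.
Qed.

Lemma lin_ext K M (f g : malg K R -> M) :
  lin f -> lin g -> (forall k, f (bvec k) = g (bvec k)) -> forall x, f x = g x.
Proof.
move=> hf hg fg x; rewrite [x]malg_expand !lin_bigsum //.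
by apply: eq_bigr => k _; rewrite !linZ // fg.
Qed.

Lemma lin_lextl K U M (f : U -> K -> M) (t : malg K R) :
  (forall k, lin (fun x : U => f x k)) -> lin (fun x => lext (f x) t).
Proof. by move=> hf; apply: lin_sum => k; apply: lin_scale. Qed.

Lemma lin_tensr K L (x : malg K R) : lin (fun y : malg L R => x ⊗ y).
Proof. by apply: lin_lextl => k; apply: lin_lext. Qed.

Lemma lin_tensl K L (y : malg L R) : lin (fun x : malg K R => x ⊗ y).
Proof. exact: lin_lext. Qed.

Lemma tens_bvec K L (k : K) (l : L) :
  bvec k ⊗ bvec l = bvec (k, l) :> malg (K * L)%type R.
Proof. by rewrite /tens !lext_bvec. Qed.

Lemma lin_tlift K L M (F : malg K R -> malg L R -> M) : lin (tlift F).
Proof. exact: lin_lext. Qed.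

Lemma lin_tliftl K L U M (F : U -> malg K R -> malg L R -> M) t :
  (forall k l, lin (fun x : U => F x k l)) -> lin (fun x => tlift (F x) t).
Proof. by move=> hF; apply: lin_lextl => kl; apply: hF. Qed.

Lemma tlift_bvec K L M (F : malg K R -> malg L R -> M) k l :
  tlift F (bvec (k, l)) = F (bvec k) (bvec l).
Proof. by rewrite /tlift lext_bvec. Qed.

Definition bilin U V M (F : U -> V -> M) : Prop :=
  (forall x, lin (F x)) /\ (forall y, lin (F^~ y)).

Lemma tlift_tens K L M (F : malg K R -> malg L R -> M) : bilin F ->
  forall x y, tlift F (x ⊗ y) = F x y.
Proof.
move=> [F1 F2] x y; move: x.
apply: lin_ext => [||k].
- by apply: (lin_comp (@lin_tlift _ _ _ F)); apply: lin_tensl.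
- exact: F2.
move: y; apply: lin_ext => [||l].
- by apply: (lin_comp (@lin_tlift _ _ _ F)); apply: lin_tensr.
- exact: F1.
by rewrite tens_bvec tlift_bvec.
Qed.

Lemma eq_tlift K L M (F G : malg K R -> malg L R -> M) t :
  (forall k l, F (bvec k) (bvec l) = G (bvec k) (bvec l)) ->
  tlift F t = tlift G t.
Proof. by move=> FG; apply: eq_lext => -[k l]; apply: FG. Qed.

Lemma eq_tlift' K L M (F G : malg K R -> malg L R -> M) t :
  (forall k l, F k l = G k l) -> tlift F t = tlift G t.
Proof. by move=> FG; apply: eq_tlift. Qed.

Lemma lin_ext2 K L M (f g : malg (K * L)%type R -> M) :
  lin f -> lin g ->
  (forall k l, f (bvec k ⊗ bvec l) = g (bvec k ⊗ bvec l)) ->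
  forall x, f x = g x.
Proof.
by move=> hf hg fg; apply: lin_ext => // -[k l]; rewrite -tens_bvec fg.
Qed.

Lemma lin_tlift_comp K L M N (h : M -> N) (F : malg K R -> malg L R -> M) t :
  lin h -> h (tlift F t) = tlift (fun x y => h (F x y)) t.
Proof.
by move=> hh; rewrite /tlift /lext lin_bigsum //; apply: eq_bigr => k _; rewrite linZ.
Qed.

Lemma tlift_id K L (t : malg (K * L)%type R) : tlift (fun x y => x ⊗ y) t = t.
Proof.
move: t; apply: lin_ext2 => [||k l].
- exact: lin_tlift.
- exact: lin_id.
by rewrite tens_bvec tlift_bvec tens_bvec.
Qed.

Lemma lin_tassoc K1 K2 K3 : lin (@tassoc R K1 K2 K3).
Proof. exact: lin_lext. Qed.

Lemma tensDl K L (x x' : malg K R) (y : malg L R) :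
  (x + x') ⊗ y = x ⊗ y + x' ⊗ y.
Proof. exact: (linD (lin_tensl y)). Qed.

Lemma tensDr K L (x : malg K R) (y y' : malg L R) :
  x ⊗ (y + y') = x ⊗ y + x ⊗ y'.
Proof. exact: (linD (lin_tensr x)). Qed.

Lemma tensZl K L a (x : malg K R) (y : malg L R) : (a *: x) ⊗ y = a *: (x ⊗ y).
Proof. exact: (linZ (lin_tensl y)). Qed.

Lemma tens0l K L (y : malg L R) : (0 : malg K R) ⊗ y = 0.
Proof. exact: (lin0 (lin_tensl y)). Qed.

Lemma tens0r K L (x : malg K R) : x ⊗ (0 : malg L R) = 0.
Proof. exact: (lin0 (lin_tensr x)). Qed.

Lemma tensNl K L (x : malg K R) (y : malg L R) : (- x) ⊗ y = - (x ⊗ y).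
Proof. exact: (linN (lin_tensl y)). Qed.

Lemma tensNr K L (x : malg K R) (y : malg L R) : x ⊗ (- y) = - (x ⊗ y).
Proof. exact: (linN (lin_tensr x)). Qed.

Lemma tliftD K L M (F : malg K R -> malg L R -> M) s t :
  tlift F (s + t) = tlift F s + tlift F t.
Proof. exact: (linD (lin_tlift F)). Qed.

Lemma rV_ext n M (f g : 'rV[R]_n -> M) : lin f -> lin g ->
  (forall i, f (e_ R i) = g (e_ R i)) -> forall x, f x = g x.
Proof.
move=> hf hg fg x; rewrite [x]row_sum_delta !lin_bigsum //.
by apply: eq_bigr => k _; rewrite !linZ // fg.
Qed.

End FreeModule.

(** * Elements supported on a subset of the basis *)

Section Support.
Variable R : realType.
Implicit Types (K L : choiceType) (M : lmodType R).

(** Both [homog] and [cur_filtration] unfold to conditions of this form, so one set of closure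
    lemmas serves the grading and the filtration. *)
Definition supp_in K (P : K -> Prop) (x : malg K R) : Prop :=
  forall k, k \in msupp x -> P k.

Lemma supp_in0 K (P : K -> Prop) : supp_in P (0 : malg K R).
Proof. by move=> k; rewrite msupp0 in_fset0. Qed.

Lemma supp_in_lin K (P : K -> Prop) a (x y : malg K R) :
  supp_in P x -> supp_in P y -> supp_in P (a *: x + y).
Proof.
move=> Px Py k /(fsubsetP (msuppD_le _ _)); rewrite in_fsetU => /orP[|/Py//].
by move=> /(fsubsetP (msuppZ_le _ _)) /Px.
Qed.

Lemma supp_inZ K (P : K -> Prop) a (x : malg K R) :
  supp_in P x -> supp_in P (a *: x).
Proof.
by move=> Px; rewrite -[_ *: _]addr0; apply: supp_in_lin => //; apply: supp_in0.
Qed.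

Lemma supp_inD K (P : K -> Prop) (x y : malg K R) :
  supp_in P x -> supp_in P y -> supp_in P (x + y).
Proof. by move=> Px Py; rewrite -[x]scale1r; apply: supp_in_lin. Qed.

Lemma supp_in_sum K (P : K -> Prop) (I : Type) (r : seq I) (Q : pred I)
    (F : I -> malg K R) :
  (forall i, Q i -> supp_in P (F i)) -> supp_in P (\sum_(i <- r | Q i) F i).
Proof.
move=> PF; elim/big_ind: _ => // [|x y]; first exact: supp_in0.
exact: supp_inD.
Qed.

Lemma supp_in_bvec K (P : K -> Prop) k : P k -> supp_in P (bvec k : malg K R).
Proof. by move=> Pk l; rewrite msuppU oner_eq0 in_fset1 => /eqP ->. Qed.

Lemma supp_in_lext K L (P : K -> Prop) (Q : L -> Prop) (f : K -> malg L R) x :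
  (forall k, P k -> supp_in Q (f k)) -> supp_in P x -> supp_in Q (lext f x).
Proof.
move=> PQ Px; rewrite /lext big_seq; apply: supp_in_sum => k /Px Pk.
by apply: supp_inZ; apply: PQ.
Qed.

Lemma supp_in_tens K L (P : K -> Prop) (Q : L -> Prop) (x : malg K R)
    (y : malg L R) :
  supp_in P x -> supp_in Q y -> supp_in (fun kl => P kl.1 /\ Q kl.2) (x ⊗ y).
Proof.
move=> Px Qy; apply: (supp_in_lext (P := P)) => // k Pk.
apply: (supp_in_lext (P := Q)) => // l Ql; exact: supp_in_bvec.
Qed.

Lemma sub_supp_in K (P Q : K -> Prop) (x : malg K R) :
  (forall k, P k -> Q k) -> supp_in P x -> supp_in Q x.
Proof. by move=> PQ Px k /Px /PQ. Qed.

Lemma lin_ext_supp K M (P : K -> Prop) (f g : malg K R -> M) :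
  lin f -> lin g -> (forall k, P k -> f (bvec k) = g (bvec k)) ->
  forall x, supp_in P x -> f x = g x.
Proof.
move=> hf hg fg x Px; rewrite [x]malg_expand !lin_bigsum //.
by apply: eq_big_seq => k /Px Pk; rewrite !linZ // fg.
Qed.

End Support.

(** * Automatic proofs of linearity *)

Ltac lin_head := fail.

(** A head that is a local variable is linear by an assumption of the context, in whichever argument
    is being varied. *)
Ltac lin_var :=
  let by_hyp h := (is_var h; match goal with H : _ |- _ => exact: H end) in
  match goal with
  | |- lin ?h => by_hyp h
  | |- lin (?h _) => by_hyp h
  | |- lin (?h _ _) => by_hyp h
  | |- lin (?h _ _ _) => by_hyp h
  | |- lin (fun y => ?h y _) => by_hyp h
  | |- lin (fun y => ?h y _ _) => by_hyp h
  | |- lin (fun y => ?h _ y _) => by_hyp h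
  | |- lin (fun y => ?h y _ _ _) => by_hyp h
  | |- lin (fun y => ?h _ y _ _) => by_hyp h
  | |- lin (fun y => ?h _ _ y _) => by_hyp h
  end.

(* Recursion on the expression; lin_head, extended as operations are introduced,
   knows the linear heads. *)
Ltac lin :=
  cbv beta;
  lazymatch goal with
  | |- lin (fun x => x) => exact: lin_id
  | |- lin (fun x => 0) => exact: lin_zero
  | |- lin (fun x => @?f x + @?g x) => apply: (@lin_add _ _ _ f g); lin
  | |- lin (fun x => - @?f x) => apply: (@lin_opp _ _ _ f); lin
  | |- lin (fun x => _ *: _) =>
    first [apply: lin_scale; lin | apply: lin_scalel; lin]
  | |- lin (fun x => \sum_(i <- _ | _) _) => apply: lin_sum => ?; lin
  | |- lin _ =>
    first
    [ lin_head
    | lin_var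
    | lazymatch goal with
      | |- lin (fun x => tlift (@?F x) ?t) => apply: (@lin_tliftl _ _ _ _ _ F) => ? ?; lin
      | |- lin (fun x => lext (@?F x) ?t) => apply: (@lin_lextl _ _ _ _ F) => ?; lin
      end
    | match goal with
      | |- lin (fun x => ?h (@?e x)) =>
          apply: (@lin_comp _ _ _ _ (h) e); [lin | lin]
      | |- lin (fun x => ?h (@?e x) ?b) =>
          apply: (@lin_comp _ _ _ _ (fun y => h y b) e); [lin | lin]
      | |- lin (fun x => ?h (@?e x) ?b ?c) =>
          apply: (@lin_comp _ _ _ _ (fun y => h y b c) e); [lin | lin]
      | |- lin (fun x => ?h (@?e x) ?b ?c ?d) =>
          apply: (@lin_comp _ _ _ _ (fun y => h y b c d) e); [lin | lin]
      end ]
  end.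

Ltac bilin := split => ?; lin.

Ltac lin_free :=
  lazymatch goal with
  | |- lin (lext _) => exact: lin_lext
  | |- lin (tlift _) => exact: lin_tlift
  | |- lin (tens _) => exact: lin_tensr
  | |- lin (fun y => tens y _) => exact: lin_tensl
  | |- lin (@tassoc _ _ _ _) => exact: lin_tassoc
  | |- lin (fun y => _ *: y) => apply: lin_scale; exact: lin_id
  | |- lin (GRing.scale _) => apply: lin_scale; exact: lin_id
  end.

Ltac lin_head ::= lin_free.

Section KoszulLinear.
Variables (R : realType) (K : choiceType) (deg : K -> nat).
Variable m : malg K R -> malg K R -> malg K R.

Lemma lin_koszulr s : lin (koszul_mul deg m s).
Proof. by rewrite /koszul_mul; lin. Qed.

Lemma lin_koszull t : lin (fun s => koszul_mul deg m s t).
Proof. by rewrite /koszul_mul; lin. Qed.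

End KoszulLinear.

Section MonoidAlgebra.
Variables (R : realType) (K : monalg.MonomialDef.type).
Local Notation A := (malg K R).

Lemma scale_monom b c (k : K) : b *: mkmalgU k c = mkmalgU k (b * c) :> A.
Proof. by apply/malgP => l; rewrite mcoeffZ !mcoeffU mulrnAr. Qed.

(** The scalar crosses the left factor one pair of monomials at a time, where it is absorbed in the
    coefficient of the right one. *)
Lemma lin_malgMr (v : A) : lin (fun w : A => v * w).
Proof.
move=> a x y; rewrite mulrDr; congr (_ + _).
suff key k : bvec k * (a *: x) = a *: (bvec k * x).
  rewrite [v]malg_expand !mulr_suml scaler_sumr; apply: eq_bigr => k _.
  by rewrite -!scalerAl key !scalerA mulrC.
rewrite [x]monalgE; elim/big_rec: _ => [|l z _ IH].
  by rewrite scaler0 mulr0 scaler0.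
rewrite scalerDr !mulrDr scalerDr IH scale_monom !malgM_def !fgmulUU !mul1r.
by congr (_ + _); rewrite scale_monom.
Qed.

Lemma lin_malgMl (w : A) : lin (fun v : A => v * w).
Proof. by move=> a x y; rewrite mulrDl scalerAl. Qed.

Lemma malgM_bvec (u w : K) : bvec u * bvec w = bvec (mmul u w) :> A.
Proof. by rewrite malgM_def fgmulUU mulr1. Qed.

End MonoidAlgebra.

(** * Linearity of the operations on tensors and forms *)

Section LinearOperations.
Variables (R : realType) (n : nat).
Local Notation g := 'rV[R]_n.
Local Notation T := (tensor_alg R n).
Local Notation E := (exterior_alg R n).
Implicit Types br : g -> g -> g.

Lemma lin_mapT (f : g -> g) : lin (@mapT R n f).
Proof. exact: lin_lext. Qed.

Lemma lin_DeltaT : lin (@DeltaT R n).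
Proof. exact: lin_lext. Qed.

Lemma lin_epsT : lin (@epsT R n : T -> R^o).
Proof. by move=> a x y; rewrite /epsT mcoeffD mcoeffZ. Qed.

Lemma lin_antipodeT : lin (@antipodeT R n).
Proof. exact: lin_lext. Qed.

Lemma lin_inT : lin (@inT R n).
Proof.
move=> a x y; rewrite /inT scaler_sumr -big_split; apply: eq_bigr => i _ /=.
by rewrite !mxE scalerDl scalerA.
Qed.

Lemma lin_wedgel (b : E) : lin (fun a => wedge a b).
Proof. exact: lin_lext. Qed.

Lemma lin_wedger (a : E) : lin (wedge a).
Proof. by apply: lin_lextl => A; apply: lin_lext. Qed.

Lemma lin_inE : lin (@Defs.inE R n).
Proof.
move=> k x y; rewrite /Defs.inE scaler_sumr -big_split; apply: eq_bigr => i _ /=.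
by rewrite !mxE scalerDl scalerA.
Qed.

Lemma lin_mapE (f : g -> g) : lin (@mapE R n f).
Proof. exact: lin_lext. Qed.

Lemma lin_derE (f : g -> g) : lin (@derE R n f).
Proof. exact: lin_lext. Qed.

Lemma lin_DeltaE : lin (@DeltaE R n).
Proof. exact: lin_lext. Qed.

Lemma lin_epsE : lin (@epsE R n : E -> R^o).
Proof. by move=> k x y; rewrite /epsE mcoeffD mcoeffZ. Qed.

Lemma lin_antipodeE : lin (@antipodeE R n).
Proof. exact: lin_lext. Qed.

Lemma lin_actl br (a : E) : lin (fun v => actE br v a).
Proof. exact: lin_lext. Qed.

Lemma lin_actr br (v : T) : lin (actE br v).
Proof.
apply: lin_lextl => -[w]; elim: w => [|i w IH] /=; first exact: lin_id.
exact: (lin_comp (lin_derE _) IH).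
Qed.

Section Sweedler.
Variable M : lmodType R.

(** F(v_(1), v_(2)) in Sweedler notation. With the coproduct kept inside, identities between such
    sums can be proved by induction on v for all F at once. *)
Definition sw2 (F : T -> T -> M) (v : T) : M := tlift F (DeltaT v).

Lemma lin_sw2 (F : T -> T -> M) : lin (sw2 F).
Proof. exact: (lin_comp (lin_tlift F) lin_DeltaT). Qed.

Lemma lin_sw2l (U : lmodType R) (F : U -> T -> T -> M) v :
  (forall k l, lin (fun x => F x k l)) -> lin (fun x => sw2 (F x) v).
Proof. by move=> hF; unfold sw2; lin. Qed.

Definition swE (F : E -> E -> M) (a : E) : M := tlift F (DeltaE a).

Lemma lin_swE (F : E -> E -> M) : lin (swE F).
Proof. exact: (lin_comp (lin_tlift F) lin_DeltaE). Qed.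

Lemma lin_swEl (U : lmodType R) (F : U -> E -> E -> M) (a : E) :
  (forall k l, lin (fun u : U => F u k l)) -> lin (fun u : U => swE (F u) a).
Proof. by move=> hF; unfold swE; lin. Qed.

End Sweedler.

End LinearOperations.

Ltac lin_op :=
  first [ lin_free | lazymatch goal with
  | |- lin (koszul_mul _ _ _) => exact: lin_koszulr
  | |- lin (fun y => koszul_mul _ _ y _) => exact: lin_koszull
  | |- lin (GRing.mul _) => exact: lin_malgMr
  | |- lin (fun y => GRing.mul y _) => exact: lin_malgMl
  | |- lin (mapT _) => exact: lin_mapT
  | |- lin (@DeltaT _ _) => exact: lin_DeltaT
  | |- lin (@epsT _ _) => exact: lin_epsT
  | |- lin (@antipodeT _ _) => exact: lin_antipodeT
  | |- lin (@inT _ _) => exact: lin_inT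
  | |- lin (sw2 ?F) => exact: (lin_sw2 F)
  | |- lin (fun x => sw2 (@?F x) ?v) => apply: lin_sw2l => ? ?; lin
  | |- lin (wedge _) => exact: lin_wedger
  | |- lin (fun y => wedge y _) => exact: lin_wedgel
  | |- lin (@Defs.inE _ _) => exact: lin_inE
  | |- lin (mapE _) => exact: lin_mapE
  | |- lin (derE _) => exact: lin_derE
  | |- lin (@DeltaE _ _) => exact: lin_DeltaE
  | |- lin (@epsE _ _) => exact: lin_epsE
  | |- lin (@antipodeE _ _) => exact: lin_antipodeE
  | |- lin (swE ?F) => exact: (lin_swE F)
  | |- lin (fun x => swE (@?F x) ?v) => apply: lin_swEl => ? ?; lin
  | |- lin (actE _ _) => exact: lin_actr
  | |- lin (fun y => actE _ y _) => exact: lin_actl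
  end ].

Ltac lin_head ::= lin_op.

(** * The Koszul product on a tensor square *)

Section Koszul.
Variables (R : realType) (K : choiceType) (deg : K -> nat).
Local Notation H := (malg K R).
Variable m : H -> H -> H.
Hypothesis m_bilin : bilin m.

Let ml y : lin (fun x => m x y). Proof. exact: (proj2 m_bilin). Qed.
Let mr x : lin (m x). Proof. exact: (proj1 m_bilin). Qed.

Lemma koszulZl k s t : koszul_mul deg m (k *: s) t = k *: koszul_mul deg m s t.
Proof. exact: (linZ (@lin_koszull _ _ deg m t)). Qed.

Lemma koszulZr k s t : koszul_mul deg m s (k *: t) = k *: koszul_mul deg m s t.
Proof. exact: (linZ (@lin_koszulr _ _ deg m s)). Qed.

Lemma koszulDl s s' t :
  koszul_mul deg m (s + s') t = koszul_mul deg m s t + koszul_mul deg m s' t.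
Proof. exact: (linD (@lin_koszull _ _ deg m t)). Qed.

Lemma koszul_bvec a b c d :
  koszul_mul deg m (bvec a ⊗ bvec b) (bvec c ⊗ bvec d) =
  (-1) ^+ (deg b * deg c) *: (m (bvec a) (bvec c) ⊗ m (bvec b) (bvec d)).
Proof. by rewrite !tens_bvec /koszul_mul !lext_bvec. Qed.

(* Products of free modules make conversion unfold these definitions without
   end; they are sealed once their characteristic equations are proved. *)
#[global] Opaque lext tens tlift koszul_mul mkmalgU.

(** The sign comes from exchanging the two inner factors, so the outer ones may be arbitrary. *)
Lemma koszul_tens i j x y x' y' : homog deg i y -> homog deg j x' ->
  koszul_mul deg m (x ⊗ y) (x' ⊗ y') = (-1) ^+ (i * j) *: (m x x' ⊗ m y y').
Proof.
move=> hy hx'; move: x; apply: lin_ext => [||a]; [lin|lin|].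
move: y' ; apply: lin_ext => [||d]; [lin|lin|].
move: y hy; apply: (lin_ext_supp (P := fun b => deg b = i)) => [||b bi]; [lin|lin|].
move: x' hx'; apply: (lin_ext_supp (P := fun b => deg b = j)) => [||c cj]; [lin|lin|].
by rewrite koszul_bvec bi cj.
Qed.

Lemma homog_bvec b : homog deg (deg b) (bvec b : H).
Proof. exact: supp_in_bvec. Qed.

(** Both bracketings of (a ⊗ b)(c ⊗ d)(e ⊗ f) carry the exponent |b||c| + |b||e| + |d||e|, because
    degrees add under [m]. *)
Lemma koszulA : associative m ->
  (forall i j x y, homog deg i x -> homog deg j y -> homog deg (i + j)%N (m x y)) ->
  associative (koszul_mul deg m).
Proof.
move=> mA mh; move=> s t u; move: s; apply: lin_ext2 => [||a b]; [lin|lin|].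
move: t; apply: lin_ext2 => [||c d]; [lin|lin|].
move: u; apply: lin_ext2 => [||e f]; [lin|lin|].
have hb := homog_bvec.
have E1 := koszul_tens (bvec a) (m (bvec d) (bvec f)) (hb b)
  (mh _ _ _ _ (hb c) (hb e)).
have E2 := koszul_tens (m (bvec a) (bvec c)) (bvec f)
  (mh _ _ _ _ (hb b) (hb d)) (hb e).
rewrite -> koszul_bvec, koszul_bvec, koszulZr, koszulZl, E1, E2.
rewrite !scalerA !mA -!exprD; congr (_ ^+ _ *: _).
by rewrite mulnDr mulnDl addnC addnA.
Qed.

End Koszul.

(** * The tensor algebra *)

Section TensorAlgebra.
Variables (R : realType) (n : nat).
Local Notation g := 'rV[R]_n.
Local Notation T := (tensor_alg R n).

Lemma T1E : bvec (FMonom [::]) = 1 :> T.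
Proof. by rewrite -fmoneE. Qed.

Lemma inT_e i : inT (e_ R i) = bvec (fmu i) :> T.
Proof.
rewrite /inT (bigD1 i) //= big1 ?addr0; last first.
  by move=> j /negPf ji; rewrite mxE ji andbF scale0r.
by rewrite mxE !eqxx scale1r.
Qed.

Lemma bvec_cons i s : bvec (FMonom (i :: s)) = inT (e_ R i) * bvec (FMonom s) :> T.
Proof. by rewrite inT_e malgM_bvec; congr mkmalgU; rewrite /mmul /= fmmulE fmuE. Qed.

(** With x the bracket of e_i and e_j this is the squared boundary of e_i ∧ e_j. The coefficient of
    the word (j, i) detects it: it is 1 in the first product, 0 in the linear term and 0 in the
    other product. *)
Lemma inT_comm_neq0 (i j : 'I_n) (x : g) : i != j ->
  inT (e_ R j) * inT (e_ R i) + inT x - inT (e_ R i) * inT (e_ R j) <> 0.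
Proof.
move=> ij.
have e k l : inT (e_ R k) * inT (e_ R l) = bvec (FMonom [:: k; l]) :> T.
  apply: esym; apply: etrans (bvec_cons _ _) _; apply: (congr1 (fun z => _ * z)).
  apply: etrans (bvec_cons _ _) _; apply: etrans (congr1 (fun z => _ * z) T1E) _.
  exact: mulr1.
pose w := FMonom [:: j; i] : fmonom 'I_n.
have cx : mcoeff w (inT x) = 0.
  rewrite /inT raddf_sum big1 => [//|k _].
  rewrite /= mcoeffZ mcoeffU; case: eqP => [e'|_]; last by rewrite mulr0n mulr0.
  by have := congr1 (size \o @fmonom_val _) e'; rewrite /= fmuE.
have cw : mcoeff w (inT (e_ R j) * inT (e_ R i)) = 1.
  apply: etrans (congr1 (mcoeff w) (e _ _)) _; apply: etrans (mcoeffU _ _ _) _.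
  by rewrite eqxx.
have cw' : mcoeff w (inT (e_ R i) * inT (e_ R j)) = 0.
  apply: etrans (congr1 (mcoeff w) (e _ _)) _; apply: etrans (mcoeffU _ _ _) _.
  suff -> : (FMonom [:: i; j] == w) = false by [].
  by apply/negP => /eqP [] /eqP; rewrite (negPf ij).
move=> /(congr1 (mcoeff w)) h.
have := etrans (esym (etrans (mcoeffB _ _ _) (congr2 (fun s t => s - t)
  (etrans (mcoeffD _ _ _) (congrD cw cx)) cw'))) (etrans h (mcoeff0 _)).
rewrite addr0 subr0 => /eqP; exact/negP/oner_neq0.
Qed.

Lemma T_ext (M : lmodType R) (f h : T -> M) : lin f -> lin h ->
  f 1 = h 1 ->
  (forall i v, f v = h v -> f (inT (e_ R i) * v) = h (inT (e_ R i) * v)) ->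
  forall v, f v = h v.
Proof.
move=> hf hh f1 fS; apply: lin_ext => // -[w]; elim: w => [|i w IH].
  by rewrite T1E.
by rewrite bvec_cons fS.
Qed.

Lemma Tmul_bilin : bilin (fun v w : T => v * w).
Proof. by bilin. Qed.

Lemma koszulT (x y x' y' : T) :
  koszul_mul (fun=> 0%N) *%R (x ⊗ y) (x' ⊗ y') = (x * x') ⊗ (y * y').
Proof. by rewrite (koszul_tens Tmul_bilin (i := 0) (j := 0)) // scale1r. Qed.

Lemma DeltaT1 : DeltaT (1 : T) = 1 ⊗ 1.
Proof. by rewrite -T1E /DeltaT lext_bvec /= T1E. Qed.

Lemma DeltaT_cons x (v : T) : DeltaT (inT x * v) =
  koszul_mul (fun=> 0%N) *%R (inT x ⊗ 1 + 1 ⊗ inT x) (DeltaT v).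
Proof.
move: x; apply: rV_ext => [||i]; [lin|lin|].
move: v; apply: lin_ext => [||[s]]; [lin|lin|].
by rewrite -bvec_cons /DeltaT !lext_bvec.
Qed.

Section Sweedler.
Variable M : lmodType R.
Implicit Types F : T -> T -> M.

Lemma eq_sw2 F F' v : (forall a b, F a b = F' a b) -> sw2 F v = sw2 F' v.
Proof. exact: eq_tlift'. Qed.

Lemma sw2_1 F : bilin F -> sw2 F 1 = F 1 1.
Proof. by move=> hF; rewrite /sw2 DeltaT1 tlift_tens. Qed.

(** Primitivity of x, in the form that drives every induction on words below. *)
Lemma sw2_cons F x v : bilin F -> sw2 F (inT x * v) =
  sw2 (fun a b => F (inT x * a) b + F a (inT x * b)) v.
Proof.
move=> hF; have [hF1 hF2] := hF; rewrite /sw2 DeltaT_cons.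
move: (DeltaT v); apply: lin_ext2 => [||a b]; [lin|lin|].
rewrite -> koszulDl, !koszulT, tliftD, !tlift_tens by bilin.
by rewrite !mul1r.
Qed.

Lemma sw2_eq0 F v : (forall a b, F a b = 0) -> sw2 F v = 0.
Proof.
move=> F0; rewrite /sw2; move: (DeltaT v); apply: lin_ext => [||[a b]]; [lin|lin|].
by rewrite -> tlift_bvec.
Qed.

Lemma sw2D F F' v : sw2 (fun a b => F a b + F' a b) v = sw2 F v + sw2 F' v.
Proof.
rewrite /sw2; move: (DeltaT v); apply: lin_ext => [||[a b]]; [lin|lin|].
by rewrite -> !tlift_bvec.
Qed.

End Sweedler.

Lemma sw2_lin (M N : lmodType R) (h : M -> N) (F : T -> T -> M) v :
  lin h -> h (sw2 F v) = sw2 (fun a b => h (F a b)) v.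
Proof. exact: lin_tlift_comp. Qed.

#[global] Opaque sw2 DeltaT inT.

(** Unlike [T_ext], this leaves the induction on the word to the caller, whose hypothesis can then
    be generalised over the map [F] that changes at each letter. *)
Lemma word_ext (M : lmodType R) (f h : T -> M) : lin f -> lin h ->
  (forall s, f (bvec (FMonom s)) = h (bvec (FMonom s))) -> forall v, f v = h v.
Proof. by move=> hf hh fh; apply: lin_ext => // -[w]. Qed.

Definition trilin (U V W M : lmodType R) (F : U -> V -> W -> M) : Prop :=
  [/\ forall b c, lin (fun a => F a b c), forall a c, lin (fun b => F a b c) &
      forall a b, lin (F a b)].

Lemma sw2_mul (M : lmodType R) (F : T -> T -> M) v w : bilin F ->
  sw2 F (v * w) = sw2 (fun a b => sw2 (fun c d => F (a * c) (b * d)) w) v.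
Proof.
move=> hF; have [F1 F2] := hF.
move: v; apply: word_ext => [||s]; [lin|lin|].
elim: s F hF F1 F2 => [|i s IH] F hF F1 F2.
  rewrite T1E mul1r; rewrite -> sw2_1 by bilin.
  by apply: eq_sw2 => a b; rewrite !mul1r.
rewrite bvec_cons -mulrA; set x := e_ R i.
rewrite -> sw2_cons by bilin.
rewrite -> IH; [|by bilin|by move=> ?; lin|by move=> ?; lin].
rewrite -> (sw2_cons (F := fun a b => sw2 _ _)) by bilin.
apply: eq_sw2 => a b; rewrite <- sw2D; apply: eq_sw2 => c d.
rewrite -> !mulrA; reflexivity.
Qed.

Lemma sw2_coassoc (M : lmodType R) (F : T -> T -> T -> M) v : trilin F ->
  sw2 (fun a b => sw2 (fun a1 a2 => F a1 a2 b) a) v =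
  sw2 (fun a b => sw2 (F a) b) v.
Proof.
case=> F1 F2 F3; move: v; apply: word_ext => [||s]; [lin|lin|].
elim: s F F1 F2 F3 => [|i s IH] F F1 F2 F3.
  by rewrite T1E; rewrite -> !sw2_1 by bilin.
rewrite bvec_cons; set x := e_ R i.
rewrite -> (sw2_cons (F := fun a b => sw2 _ a)) by bilin.
rewrite -> (sw2_cons (F := fun a b => sw2 _ b)) by bilin.
(* On either side a primitive letter lands once in each of the three factors; [F'] is that sum, and
   the induction hypothesis is applied to it. *)
pose F' a b c := F (inT x * a) b c + F a (inT x * b) c + F a b (inT x * c).
transitivity (sw2 (fun a b => sw2 (fun a1 a2 => F' a1 a2 b) a) (bvec (FMonom s))).
  apply: eq_sw2 => a b; rewrite -> sw2_cons by bilin.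
  by rewrite <- sw2D.
rewrite -> IH; rewrite /F'; [|by move=> *; lin|by move=> *; lin|by move=> *; lin].
apply: eq_sw2 => a b; rewrite -> (sw2_cons (F := F a)) by bilin.
by rewrite <- sw2D; apply: eq_sw2 => c d; rewrite addrA.
Qed.

(** The coproduct of a letter is symmetric, hence so is that of a word. Both antipode axioms for
    currents rest on this. *)
Lemma sw2C (M : lmodType R) (F : T -> T -> M) v : bilin F ->
  sw2 F v = sw2 (fun a b => F b a) v.
Proof.
move=> [F1 F2]; move: v; apply: word_ext => [||s]; [lin|lin|].
elim: s F F1 F2 => [|i s IH] F F1 F2.
  by rewrite T1E; rewrite -> !sw2_1 by bilin.
rewrite bvec_cons; rewrite -> (sw2_cons (F := F)) by bilin.
rewrite -> IH; [|by move=> *; lin|by move=> *; lin].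
rewrite -> (sw2_cons (F := fun a b => F b a)) by bilin.
by apply: eq_sw2 => a b; rewrite addrC.
Qed.

Lemma epsT1 : epsT (1 : T) = 1.
Proof. by rewrite -T1E /epsT mcoeffUU. Qed.

Lemma epsT_cons x (v : T) : epsT (inT x * v) = 0.
Proof.
move: x; apply: (rV_ext (M := R^o)) => [||i]; [lin|lin|].
move: v; apply: (word_ext (M := R^o)) => [||s]; [lin|lin|].
by rewrite -bvec_cons /epsT mcoeffU; case: eqP.
Qed.

Lemma epsTM (v w : T) : epsT (v * w) = epsT v * epsT w.
Proof.
move: v; apply: (T_ext (M := R^o)) => [||| i v IH]; [lin| |by rewrite epsT1 !mul1r|].
  by move=> a x y; rewrite (@lin_epsT R n a x y) mulrDl; congr (_ + _); exact: esym (mulrA _ _ _).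
by rewrite <- mulrA; rewrite -> !epsT_cons; rewrite mul0r.
Qed.

Lemma sw2_counitl (M : lmodType R) (F : T -> M) v : lin F ->
  sw2 (fun a b => epsT a *: F b) v = F v.
Proof.
move=> hF; have hE b : lin (fun a : T => epsT a *: F b).
  by move=> a x y; rewrite (@lin_epsT R n a x y) scalerDl scalerA.
move: v; apply: word_ext => [||s]; [lin|lin|].
elim: s F hF hE => [|i s IH] F hF hE.
  by rewrite T1E; rewrite -> sw2_1 by bilin; rewrite epsT1 scale1r.
rewrite bvec_cons; rewrite -> sw2_cons by bilin.
rewrite -[RHS](IH (fun v => F (inT (e_ R i) * v))); [|by lin|by move=> ?; lin].
by apply: eq_sw2 => a b; rewrite epsT_cons scale0r add0r.
Qed.

Lemma sw2_counitr (M : lmodType R) (F : T -> M) v : lin F ->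
  sw2 (fun a b => epsT b *: F a) v = F v.
Proof.
move=> hF; have hE b : lin (fun a : T => epsT a *: F b).
  by move=> a x y; rewrite (@lin_epsT R n a x y) scalerDl scalerA.
by rewrite -> sw2C by bilin; apply: sw2_counitl.
Qed.

Lemma antipodeT1 : antipodeT (1 : T) = 1.
Proof. by rewrite -T1E /antipodeT lext_bvec expr0 scale1r. Qed.

Lemma antipodeT_cons x (v : T) :
  antipodeT (inT x * v) = - (antipodeT v * inT x).
Proof.
move: x; apply: rV_ext => [||i]; [lin|lin|].
move: v; apply: word_ext => [||s]; [lin|lin|].
rewrite -bvec_cons /antipodeT !lext_bvec /= exprS -scalerA scaleN1r.
rewrite -scalerAl inT_e malgM_bvec; congr (- (_ *: _)); congr mkmalgU.
by rewrite /mmul /= fmmulE fmuE rev_cons cats1.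
Qed.

Lemma sw2_inT (M : lmodType R) (F : T -> T -> M) x : bilin F ->
  sw2 F (inT x) = F (inT x) 1 + F 1 (inT x).
Proof.
move=> hF; have [F1 F2] := hF; rewrite -{1}[inT x]mulr1.
rewrite -> sw2_cons by bilin; rewrite -> sw2_1 by bilin.
by rewrite !mulr1.
Qed.

(** An antipode reverses the coproduct in general; here the factors may keep their order because the
    coproduct is cocommutative. *)
Lemma sw2_antipode (M : lmodType R) (F : T -> T -> M) v : bilin F ->
  sw2 F (antipodeT v) = sw2 (fun a b => F (antipodeT a) (antipodeT b)) v.
Proof.
move=> [F1 F2]; move: v; apply: word_ext => [||s]; [lin|lin|].
elim: s F F1 F2 => [|i s IH] F F1 F2.
  rewrite T1E antipodeT1; rewrite -> !sw2_1 by bilin.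
  by rewrite antipodeT1.
rewrite bvec_cons antipodeT_cons; set x := e_ R i.
rewrite -> (linN (lin_sw2 F)).
rewrite -> sw2_mul by bilin.
rewrite -> (sw2_cons (F := fun a b => F (antipodeT a) (antipodeT b))) by bilin.
transitivity (- sw2 (fun a b => F (a * inT x) b + F a (b * inT x)) (antipodeT (bvec (FMonom s)))).
  congr (- _); apply: eq_sw2 => a b; rewrite -> sw2_inT by bilin.
  by rewrite !mulr1.
rewrite -> IH; [|by move=> ?; lin|by move=> ?; lin].
rewrite [LHS](sw2_lin (h := fun y => - y)); last by lin.
have NF1 a b : F a (- b) = - F a b by apply: (linN (F1 a)).
have NF2 a b : F (- a) b = - F a b by apply: (linN (F2 b)).
apply: eq_sw2 => a b; rewrite -> !antipodeT_cons; rewrite opprD.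
by congr (_ + _); [exact: esym (NF2 _ _) | exact: esym (NF1 _ _)].
Qed.

(** A first letter x contributes S(x a) b + S(a) x b, which cancels term by term. *)
Lemma antipodeT_l v : sw2 (fun a b => antipodeT a * b) v = epsT v *: (1 : T).
Proof.
move: v; apply: T_ext => [|||i v _]; [lin|lin| |].
  by rewrite -> sw2_1 by bilin; rewrite antipodeT1 mul1r epsT1 scale1r.
rewrite -> sw2_cons by bilin; rewrite epsT_cons scale0r.
apply: sw2_eq0 => a b; rewrite -> antipodeT_cons.
rewrite mulNr; rewrite -> mulrA; exact: addNr.
Qed.

(** Here a first letter x does not cancel term by term: it produces the commutator of x with the sum
    for v, which is a scalar by induction. *)
Lemma antipodeT_r v : sw2 (fun a b => a * antipodeT b) v = epsT v *: (1 : T).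
Proof.
move: v; apply: T_ext => [|||i v IH]; [lin|lin| |].
  by rewrite -> sw2_1 by bilin; rewrite antipodeT1 mul1r epsT1 scale1r.
rewrite -> sw2_cons by bilin; rewrite epsT_cons scale0r.
set x := e_ R i.
transitivity (inT x * sw2 (fun a b => a * antipodeT b) v -
              sw2 (fun a b => a * antipodeT b) v * inT x).
  rewrite (sw2_lin (h := fun y => inT x * y)); last by lin.
  rewrite [- _](sw2_lin (h := fun y => - (y * inT x))); last by lin.
  apply: etrans (sw2D _ _ _); apply: eq_sw2 => a b; rewrite -> antipodeT_cons.
  by rewrite mulrN; rewrite -> !mulrA.
by rewrite IH -scalerAl (linZ (lin_malgMr (inT x))) mulr1 mul1r subrr.
Qed.

Section MapT.
Variable f : g -> g.
Hypothesis hf : lin f.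

Lemma mapT1 : mapT f 1 = 1.
Proof. by rewrite -{1}T1E /mapT lext_bvec big_nil. Qed.

Lemma mapT_cons x v : mapT f (inT x * v) = inT (f x) * mapT f v.
Proof.
move: x; apply: rV_ext => [||i]; [lin|lin|].
move: v; apply: word_ext => [||s]; [lin|lin|].
by rewrite -bvec_cons /mapT !lext_bvec big_cons.
Qed.

Lemma mapTM v w : mapT f (v * w) = mapT f v * mapT f w.
Proof.
move: v; apply: T_ext => [|||i v IH]; [lin|lin| |].
  by rewrite mapT1 !mul1r.
by rewrite <- mulrA; rewrite -> !mapT_cons; rewrite -> IH; exact: mulrA.
Qed.

Lemma mapT_inT x : mapT f (inT x) = inT (f x).
Proof. by rewrite -[inT x]mulr1 mapT_cons mapT1 mulr1. Qed.

Lemma sw2_mapT (M : lmodType R) (F : T -> T -> M) v : bilin F ->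
  sw2 F (mapT f v) = sw2 (fun a b => F (mapT f a) (mapT f b)) v.
Proof.
move=> [F1 F2]; move: v; apply: word_ext => [||s]; [lin|lin|].
elim: s F F1 F2 => [|i s IH] F F1 F2.
  rewrite T1E mapT1; rewrite -> !sw2_1 by bilin.
  by rewrite mapT1.
rewrite bvec_cons; rewrite -> mapT_cons; set x := e_ R i.
rewrite -> (sw2_cons (F := F)) by bilin.
rewrite -> (sw2_cons (F := fun a b => F (mapT f a) (mapT f b))) by bilin.
rewrite -> IH; [|by move=> ?; lin|by move=> ?; lin].
by apply: eq_sw2 => a b; rewrite -> !mapT_cons.
Qed.

Lemma epsT_map v : epsT (mapT f v) = epsT v.
Proof.
move: v; apply: (T_ext (M := R^o)) => [|||i v IH]; [lin|lin| |].
  by rewrite mapT1.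
by rewrite -> mapT_cons, !epsT_cons.
Qed.

End MapT.

Lemma mapT_comp (f h : g -> g) v : lin f -> lin h ->
  mapT f (mapT h v) = mapT (f \o h) v.
Proof.
move=> hf hh; have hfh : lin (f \o h) by apply: lin_comp.
move: v; apply: T_ext => [|||i v IH]; [lin|lin| |].
  by rewrite !mapT1.
by rewrite -> !mapT_cons, IH.
Qed.

Lemma mapT_id (f : g -> g) v : f =1 id -> mapT f v = v.
Proof.
move=> f1; have hf : lin f by move=> a x y; rewrite !f1.
move: v; apply: T_ext => [|||i v IH]; [lin|lin| |].
  by rewrite mapT1.
by rewrite -> mapT_cons, IH, f1.
Qed.

End TensorAlgebra.

(** * The exterior algebra *)

Section OrdinalSets.
Variable n : nat.
Implicit Types (A B C : {set 'I_n}) (a i : 'I_n).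

Lemma enum_sorted A : sorted (fun i j : 'I_n => (i < j)%N) (enum A).
Proof.
rewrite /enum_mem; apply: sorted_filter; first by move=> j i k; apply: ltn_trans.
rewrite -(sorted_map (f := val) (e' := ltn)) -enumT val_enum_ord.
exact: iota_ltn_sorted.
Qed.

Definition below a A := forall i, i \in A -> (a < i)%N.

Lemma enum_setU1_below a A : below a A -> enum (a |: A)%SET = a :: enum A.
Proof.
move=> aA; apply: (@irr_sorted_eq _ (fun i j : 'I_n => (i < j)%N)).
- by move=> j i k; apply: ltn_trans.
- by move=> i; apply: ltnn.
- exact: enum_sorted.
- rewrite /= path_min_sorted ?enum_sorted //.
  by apply/allP => i; rewrite mem_enum => /aA.
- by move=> i; rewrite inE !mem_enum !inE.
Qed.

Lemma below_notin a A : below a A -> a \notin A.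
Proof. by move=> aA; apply/negP => /aA; rewrite ltnn. Qed.

(** Removing the least element a writes the basis vector of A as e_a ∧ (the rest) without a sign,
    see [bvec_below]. *)
Lemma set_min_ind (P : {set 'I_n} -> Prop) : P finset.set0 ->
  (forall a A, below a A -> P A -> P (a |: A)%SET) -> forall A, P A.
Proof.
move=> P0 PS A; have [m] := ubnP #|A|; elim: m A => // m IH A Am.
have [->//|/set0Pn [i0 i0A]] := eqVneq A finset.set0.
pose a := [arg min_(i < i0 in A) (i : nat)].
have [aA amin] : a \in A /\ forall i, i \in A -> (a <= i)%N.
  by rewrite /a; case: arg_minnP.
rewrite -(finset.setD1K aA); apply: PS => [i|].
  rewrite !inE => /andP [ia /amin]; rewrite leq_eqVlt => /orP [|//].
  by move=> /eqP e; case/eqP: ia; apply/val_inj.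
by apply: IH; rewrite (cardsD1 a) aA in Am.
Qed.

(** The exponent of the sign in [wedge]: the number of transpositions that sort A followed by B. *)
Definition inversions A B :=
  #|[set ab : 'I_n * 'I_n | [&& ab.1 \in A, ab.2 \in B & (ab.2 < ab.1)%N]]%SET|.

Lemma inversionsUl A B C : [disjoint A & B]%B ->
  inversions (A :|: B)%SET C = (inversions A C + inversions B C)%N.
Proof.
move=> dAB; rewrite /inversions -cardsUI [X in (_ + X)%N]eq_card0 ?addn0.
  by apply: eq_card => -[i j]; rewrite !inE /= andb_orl.
move=> [i j]; rewrite !inE /=; case iA: (i \in A) => //=.
by rewrite (disjointFr dAB iA) andbF.
Qed.

Lemma inversionsUr A B C : [disjoint B & C]%B ->
  inversions A (B :|: C)%SET = (inversions A B + inversions A C)%N.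
Proof.
move=> dBC; rewrite /inversions -cardsUI [X in (_ + X)%N]eq_card0 ?addn0.
  by apply: eq_card => -[i j]; rewrite !inE /= andb_orl andb_orr.
move=> [i j]; rewrite !inE /=; case jB: (j \in B) => //=; last by rewrite andbF.
by rewrite (disjointFr dBC jB) /= !andbF.
Qed.

Lemma inversions_below a A : below a A -> inversions [set a]%SET A = 0%N.
Proof.
move=> aA; apply: eq_card0 => -[i j]; rewrite !inE /=.
case: eqP => //= ->; case jA: (j \in A) => //=.
by apply/negbTE; rewrite -leqNgt ltnW ?aA.
Qed.

Lemma inversions_set1 a i : inversions [set a]%SET [set i]%SET = (i < a)%N.
Proof.
rewrite /inversions; case: ltnP => ia.
  rewrite (eq_card (B := pred1 (a, i))) ?card1 // => -[j k]; rewrite !inE /= xpair_eqE.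
  by case: eqP => //= ->; case: eqP => //= ->.
apply: eq_card0 => -[j k]; rewrite !inE /=.
by case: eqP => //= ->; case: eqP => //= ->; rewrite ltnNge ia.
Qed.

End OrdinalSets.

Section ExteriorAlgebra.
Variables (R : realType) (n : nat).
Local Notation g := 'rV[R]_n.
Local Notation E := (exterior_alg R n).
Local Notation one := (oneE R n).
Implicit Types (A B C : {set 'I_n}) (a b c : E).

Lemma wedge_bvec A B : wedge (bvec A) (bvec B) =
  if [disjoint A & B]%B then (-1) ^+ inversions A B *: bvec (A :|: B)%SET else 0 :> E.
Proof. by rewrite /wedge !lext_bvec. Qed.

Lemma inE_e i : Defs.inE (e_ R i) = bvec [set i]%SET :> E.
Proof.
rewrite /Defs.inE (bigD1 i) //= big1 ?addr0; last first.
  by move=> j /negPf ji; rewrite mxE ji andbF scale0r.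
by rewrite mxE !eqxx scale1r.
Qed.

#[global] Opaque wedge Defs.inE.

Lemma wedgeZl k a b : wedge (k *: a) b = k *: wedge a b.
Proof. exact: (linZ (lin_wedgel b)). Qed.

Lemma wedgeZr k a b : wedge a (k *: b) = k *: wedge a b.
Proof. exact: (linZ (lin_wedger a)). Qed.

Lemma wedge0l b : wedge 0 b = 0.
Proof. exact: (lin0 (lin_wedgel b)). Qed.

Lemma wedge0r a : wedge a 0 = 0.
Proof. exact: (lin0 (lin_wedger a)). Qed.

Lemma wedgeDl a a' b : wedge (a + a') b = wedge a b + wedge a' b.
Proof. exact: (linD (lin_wedgel b)). Qed.

Lemma wedgeDr a b b' : wedge a (b + b') = wedge a b + wedge a b'.
Proof. exact: (linD (lin_wedger a)). Qed.

Lemma wedgeNl a b : wedge (- a) b = - wedge a b.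
Proof. exact: (linN (lin_wedgel b)). Qed.

Lemma wedgeNr a b : wedge a (- b) = - wedge a b.
Proof. exact: (linN (lin_wedger a)). Qed.

Lemma disjointUl A B C :
  [disjoint (A :|: B)%SET & C]%B = [disjoint A & C]%B && [disjoint B & C]%B.
Proof. by rewrite -!finset.setI_eq0 finset.setIUl finset.setU_eq0. Qed.

Lemma disjointUr A B C :
  [disjoint A & (B :|: C)%SET]%B = [disjoint A & B]%B && [disjoint A & C]%B.
Proof. by rewrite -!finset.setI_eq0 finset.setIUr finset.setU_eq0. Qed.

(** Inversions are additive over disjoint unions in each argument, so both signs count those of the
    pairs (A, B), (A, C) and (B, C). *)
Lemma wedgeA : associative (@wedge R n).
Proof.
move=> a b c; move: a; apply: lin_ext => [||A]; [lin|lin|].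
move: b; apply: lin_ext => [||B]; [lin|lin|].
move: c; apply: lin_ext => [||C]; [lin|lin|].
rewrite -> !wedge_bvec.
case dBC: [disjoint B & C]%B; case dAB: [disjoint A & B]%B; last first.
- by rewrite -> wedge0l, wedge0r.
- rewrite -> wedgeZl, wedge0r, wedge_bvec.
  by rewrite disjointUl dBC andbF scaler0.
- rewrite -> wedgeZr, wedge0l, wedge_bvec.
  by rewrite disjointUr dAB scaler0.
rewrite -> wedgeZl, wedgeZr, !wedge_bvec.
rewrite disjointUl disjointUr dAB dBC andbT /=.
case: [disjoint A & C]%B; last by rewrite !scaler0.
rewrite -> !scalerA; rewrite <- !exprD; rewrite -> finset.setUA.
suff -> : (inversions B C + inversions A (B :|: C)%SET =
           inversions A B + inversions (A :|: B)%SET C)%N by [].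
rewrite inversionsUl // inversionsUr //.
by rewrite addnC addnA.
Qed.

Lemma wedge1l : left_id one (@wedge R n).
Proof.
apply: lin_ext => [||A]; [lin|lin|].
rewrite /oneE; rewrite -> wedge_bvec; rewrite finset.set0U -finset.setI_eq0 finset.set0I eqxx.
rewrite /inversions eq_card0 ?scale1r // => -[i j].
by rewrite !inE.
Qed.

Lemma wedge1r : right_id one (@wedge R n).
Proof.
apply: lin_ext => [||A]; [lin|lin|].
rewrite /oneE; rewrite -> wedge_bvec; rewrite finset.setU0 -finset.setI_eq0 finset.setI0 eqxx.
rewrite /inversions eq_card0 ?scale1r // => -[i j].
by rewrite !inE andbF.
Qed.

Lemma bvec_below i A : below i A ->
  bvec (i |: A)%SET = wedge (Defs.inE (e_ R i)) (bvec A) :> E.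
Proof.
move=> iA; rewrite inE_e; rewrite -> wedge_bvec; rewrite inversions_below // scale1r.
by rewrite -finset.setI_eq0 finset.setI_eq0 finset.disjoints1 below_notin.
Qed.

Lemma wedge_inE_anti (x y : g) :
  wedge (Defs.inE x) (Defs.inE y) = - wedge (Defs.inE y) (Defs.inE x).
Proof.
move: x; apply: rV_ext => [||i]; [lin|lin|].
move: y; apply: rV_ext => [||j]; [lin|lin|].
rewrite !inE_e; rewrite -> !wedge_bvec; rewrite !finset.disjoints1 !finset.in_set1 !inversions_set1.
have [->|ij] := eqVneq i j; first by rewrite oppr0.
rewrite /= finset.setUC; apply: scale_eqN.
have [ij'|ji|/val_inj e] := ltngtP i j; last by rewrite e eqxx in ij.
  by rewrite expr0 expr1 opprK.
by rewrite expr0 expr1.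
Qed.

Lemma wedge_inE_sq (x : g) : wedge (Defs.inE x) (Defs.inE x) = 0.
Proof.
apply: eqN_eq0; exact: wedge_inE_anti.
Qed.

Lemma wedge_inE_sqA (x : g) a : wedge (Defs.inE x) (wedge (Defs.inE x) a) = 0.
Proof. by rewrite -> wedgeA, wedge_inE_sq, wedge0l. Qed.

Lemma wedge_inE_antiA (x y : g) a : wedge (Defs.inE x) (wedge (Defs.inE y) a) =
  - wedge (Defs.inE y) (wedge (Defs.inE x) a).
Proof.
apply: etrans (wedgeA _ _ _) _.
apply: etrans (congr1 (fun b => wedge b a) (wedge_inE_anti x y)) _.
apply: etrans (wedgeNl _ _) _.
by rewrite -> wedgeA.
Qed.

Lemma E_ext (M : lmodType R) (f h : E -> M) : lin f -> lin h ->
  f one = h one ->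
  (forall i a, f a = h a -> f (wedge (Defs.inE (e_ R i)) a) = h (wedge (Defs.inE (e_ R i)) a)) ->
  forall a, f a = h a.
Proof.
move=> hf hh f1 fS; apply: lin_ext hf hh _; apply: set_min_ind; first exact: f1.
by move=> i A iA IH; rewrite -> bvec_below; [apply: fS|].
Qed.

Section Universal.
Variables (M : lmodType R) (c : g -> M -> M) (m0 : M).
Hypothesis c_linl : forall m, lin (fun x => c x m).
Hypothesis c_linr : forall x, lin (c x).
Hypothesis c_sq : forall x m, c x (c x m) = 0.

(** Polarisation of c_(x+y) c_(x+y) = 0. *)
Lemma sq0_anti x y m : c x (c y m) = - c y (c x m).
Proof.
have := c_sq (x + y) m.
rewrite (linD (c_linl m)) (linD (c_linr _)) !(linD (c_linl _)) !c_sq add0r addr0.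
by move=> /eqP; rewrite addr_eq0 => /eqP ->; rewrite opprK.
Qed.

(* The universal property of the exterior algebra: operators c x on M with
   c x \o c x = 0 extend to left multiplication by the algebra. *)
Definition ext_map : E -> M := lext (fun A => foldr c m0 (frame R A)).

Lemma lin_ext_map : lin ext_map.
Proof. exact: lin_lext. Qed.

Lemma ext_map1 : ext_map one = m0.
Proof.
rewrite /ext_map /oneE; rewrite -> lext_bvec.
by rewrite /frame finset.enum_set0.
Qed.

Let ext_map_below i A : below i A ->
  ext_map (wedge (Defs.inE (e_ R i)) (bvec A)) = c (e_ R i) (ext_map (bvec A)).
Proof.
move=> iA; rewrite <- bvec_below; last by [].
by rewrite /ext_map; rewrite -> !lext_bvec; rewrite /frame enum_setU1_below.
Qed.

(** Immediate from the definition when x = e_i with i below A. Otherwise compare i with the least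
    element a of A: if i = a both sides vanish; if i > a then e_i anticommutes past e_a in the
    exterior algebra, and c_i past c_a in M, which reduces to the smaller set. *)
Lemma ext_map_wedge x a : ext_map (wedge (Defs.inE x) a) = c x (ext_map a).
Proof.
have el := lin_ext_map.
move: x; apply: rV_ext => [||i].
- exact: (lin_comp el (lin_comp (lin_wedgel a) (@lin_inE R n))).
- exact: c_linl.
move: a; apply: lin_ext => [||A].
- exact: (lin_comp el (lin_wedger _)).
- exact: (lin_comp (c_linr _) el).
move: A i; apply: set_min_ind => [|a A aA IH] i.
  by apply: ext_map_below => j; rewrite inE.
have [ia|ai|/val_inj ->] := ltngtP i a.
- apply: ext_map_below => j; rewrite !inE => /orP[/eqP -> //|/aA].
  exact: ltn_trans.
- rewrite -> bvec_below; last by [].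
  have e := wedge_inE_antiA (e_ R i) (e_ R a) (bvec A).
  apply: etrans (congr1 ext_map e) _.
  apply: etrans (linN el _) _.
  have e2 : ext_map (wedge (Defs.inE (e_ R a)) (wedge (Defs.inE (e_ R i)) (bvec A))) =
      c (e_ R a) (c (e_ R i) (ext_map (bvec A))).
    apply: etrans _ (congr1 (c (e_ R a)) (IH i)).
    rewrite [Defs.inE (e_ R i)]inE_e.
    (* Since e_i ∧ e_A is zero or a signed basis vector whose indices are all above a, the case
       already known applies to its product with e_a. *)
    have := wedge_bvec [set i]%SET A; case: ifP => _ ew;
      apply: etrans (congr1 (fun z => ext_map (wedge _ z)) ew) _;
      apply: etrans _ (congr1 (fun z => c _ (ext_map z)) (esym ew)); last first.
      apply: etrans (congr1 ext_map (wedge0r _)) _.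
      apply: etrans (lin0 el) _.
      exact: esym (etrans (congr1 (c _) (lin0 el)) (lin0 (c_linr _))).
    apply: etrans (congr1 ext_map (wedgeZr _ _ _)) _.
    apply: etrans (linZ el _ _) _.
    apply: etrans _ (congr1 (c (e_ R a)) (esym (linZ el _ _))).
    apply: etrans _ (esym (linZ (c_linr _) _ _)).
    congr (_ *: _); apply: ext_map_below => j; rewrite !inE.
    by move=> /orP[/eqP -> //|/aA].
  apply: etrans (congr1 (fun y => - y) e2) _.
  apply: etrans _ (congr1 (c (e_ R i)) (esym (ext_map_below aA))).
  exact: esym (sq0_anti _ _ _).
- rewrite -> bvec_below; last by [].
  apply: etrans (congr1 ext_map (wedge_inE_sqA _ _)) _.
  apply: etrans (lin0 el) _.
  apply: etrans _ (congr1 (c (e_ R a)) (esym (ext_map_below aA))).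
  exact: esym (c_sq _ _).
Qed.

End Universal.

End ExteriorAlgebra.

Section ExteriorMaps.
Variables (R : realType) (n : nat).
Local Notation g := 'rV[R]_n.
Local Notation E := (exterior_alg R n).
Local Notation EE := (malg ({set 'I_n} * {set 'I_n})%type R).
Local Notation one := (oneE R n).
Local Notation vE := (@Defs.inE R n).
Implicit Types (A B C : {set 'I_n}) (a b c : E) (x y : g).

Section MapE.
Variable f : g -> g.
Hypothesis hf : lin f.

Let mapE_ext : mapE f = ext_map (fun x => wedge (vE (f x))) one.
Proof.
apply/funext => a; rewrite /mapE /ext_map; apply: eq_lext => A.
exact: foldr_map.
Qed.

Lemma mapE1 : mapE f one = one.
Proof. rewrite mapE_ext; exact: ext_map1. Qed.

Lemma mapE_cons x a : mapE f (wedge (vE x) a) = wedge (vE (f x)) (mapE f a).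
Proof.
rewrite mapE_ext; apply: ext_map_wedge => [b|y|y b].
- by lin.
- by lin.
- exact: wedge_inE_sqA.
Qed.

Lemma mapEM a b : mapE f (wedge a b) = wedge (mapE f a) (mapE f b).
Proof.
move: a; apply: E_ext => [|||i a IH]; [lin|lin| |].
  by rewrite -> mapE1, !wedge1l.
apply: etrans (congr1 (mapE f) (esym (wedgeA _ _ _))) _.
rewrite -> !mapE_cons.
apply: etrans (congr1 (wedge _) IH) _.
exact: wedgeA.
Qed.

End MapE.

Lemma mapE_comp (f h : g -> g) a : lin f -> lin h ->
  mapE f (mapE h a) = mapE (f \o h) a.
Proof.
move=> hf hh; have hfh : lin (f \o h) by apply: lin_comp.
move: a; apply: E_ext => [|||i a IH]; [lin|lin| |].
  by rewrite -> !mapE1.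
rewrite -> (mapE_cons hh), (mapE_cons hf), (mapE_cons hfh).
exact: (congr1 (wedge (vE (f (h (e_ R i))))) IH).
Qed.

Lemma mapE_id (f : g -> g) a : f =1 id -> mapE f a = a.
Proof.
move=> f1; have hf : lin f by move=> k x y; rewrite !f1.
move: a; apply: E_ext => [|||i a IH]; [lin|lin| |].
  by rewrite -> mapE1.
rewrite -> (mapE_cons hf); rewrite f1.
exact: (congr1 (wedge (vE (e_ R i))) IH).
Qed.

Lemma wedges_cons x s : wedges (x :: s) = wedge (vE x) (wedges s).
Proof. by []. Qed.

Section DerE.
Variable f : g -> g.
Hypothesis hf : lin f.

Let der_list (s : seq g) : E :=
  \sum_(i < size s) wedges (set_nth 0 s i (f (nth 0 s i))).

Let der_list_cons x s : der_list (x :: s) =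
  wedge (vE (f x)) (wedges s) + wedge (vE x) (der_list s).
Proof.
rewrite /der_list /= big_ord_recl; congr (_ + _).
by rewrite (lin_bigsum _ _ _ (lin_wedger _)).
Qed.

(** Left multiplication by x on the pairs (a, D a), where D is the derivation extending f: D(x ∧ a)
    = f(x) ∧ a + x ∧ D a. Its square is zero, so the universal property yields the Leibniz rule for
    arbitrary x and a. *)
Let cpair (x : g) (m : E * E) : E * E :=
  (wedge (vE x) m.1, wedge (vE (f x)) m.1 + wedge (vE x) m.2).

Let foldr_cpair s : foldr cpair (one, 0) s = (wedges s, der_list s).
Proof.
elim: s => [|x s IH] /=; first by rewrite /der_list big_ord0.
by rewrite IH /cpair der_list_cons.
Qed.

Let fst_ext_map a : (ext_map (M := (E * E)%type) cpair (one, 0) a).1 = a.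
Proof.
have hl := @lin_ext_map R n (E * E)%type cpair (one, 0).
move: a; apply: lin_ext => [k u v||A]; [by rewrite hl|by lin|].
rewrite /ext_map; rewrite -> lext_bvec; rewrite foldr_cpair /=.
move: A; apply: set_min_ind => [|a A aA IH].
  by rewrite /frame finset.enum_set0.
apply: etrans _ (esym (bvec_below _ aA)).
rewrite /frame (enum_setU1_below aA).
exact: (congr1 (wedge (vE (e_ R a))) IH).
Qed.

Let snd_ext_map a : (ext_map (M := (E * E)%type) cpair (one, 0) a).2 = derE f a.
Proof.
have hl := @lin_ext_map R n (E * E)%type cpair (one, 0).
move: a; apply: lin_ext => [k u v||A]; [by rewrite hl|by lin|].
rewrite /ext_map /derE; rewrite -> !lext_bvec; rewrite foldr_cpair.
by [].
Qed.

Let cpair_linl m : lin (fun x => cpair x m).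
Proof.
move=> k x y; congr (_, _); rewrite /= ?hf.
  by apply: (lin_comp (lin_wedgel m.1) (@lin_inE R n)).
have h : lin (fun x => wedge (vE (f x)) m.1 + wedge (vE x) m.2) by lin.
by rewrite -h /= hf.
Qed.

Let cpair_linr x : lin (cpair x).
Proof.
move=> k m m'; congr (_, _); rewrite /=.
  exact: lin_wedger.
apply: etrans (congr2 +%R (lin_wedger _ _ _ _) (lin_wedger _ _ _ _)) _.
by rewrite scalerDr addrACA.
Qed.

Let cpair_sq x m : cpair x (cpair x m) = 0.
Proof.
rewrite /cpair /=; congr (_, _); first exact: wedge_inE_sqA.
apply: etrans (congr1 (fun z => _ + z) (wedgeDr _ _ _)) _.
apply: etrans (congr1 (fun z => _ + (_ + z)) (wedge_inE_sqA _ _)) _.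
apply: etrans (congr1 (fun z => _ + z) (addr0 _)) _.
apply: etrans (congr1 (fun z => z + _) (wedge_inE_antiA _ _ _)) _.
exact: addNr.
Qed.

Lemma derE1 : derE f one = 0.
Proof.
by apply: etrans (esym (snd_ext_map _)) _; apply: etrans (congr1 snd (ext_map1 _ _)) _.
Qed.

Lemma derE_cons x a :
  derE f (wedge (vE x) a) = wedge (vE (f x)) a + wedge (vE x) (derE f a).
Proof.
apply: etrans (esym (snd_ext_map _)) _.
apply: etrans (congr1 snd (ext_map_wedge _ cpair_linl cpair_linr cpair_sq _ _)) _.
exact: (congr2 (fun u v => wedge (vE (f x)) u + wedge (vE x) v)
         (fst_ext_map a) (snd_ext_map a)).
Qed.

Lemma derEM a b :
  derE f (wedge a b) = wedge (derE f a) b + wedge a (derE f b).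
Proof.
move: a; apply: E_ext => [|||i a IH]; [lin|lin| |].
  by rewrite -> derE1, !wedge1l, wedge0l; rewrite add0r.
apply: etrans (congr1 (derE f) (esym (wedgeA _ _ _))) _.
rewrite -> !derE_cons, wedgeDl.
apply: etrans (congr1 (fun z => _ + wedge _ z) IH) _.
apply: etrans (addrA _ _ _).
apply: congrD (wedgeA _ _ _) _.
exact: etrans (wedgeDr _ _ _) (congrD (wedgeA _ _ _) (wedgeA _ _ _)).
Qed.

Lemma derE_wedges (s : seq g) : derE f (wedges s) =
  \sum_(i < size s) wedges (set_nth 0 s i (f (nth 0 s i))).
Proof.
elim: s => [|x s IH]; first by rewrite big_ord0; apply: derE1.
rewrite wedges_cons; rewrite -> derE_cons; rewrite -[RHS]/(der_list (x :: s)) der_list_cons.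
exact: (congr1 (fun z => _ + wedge _ z) IH).
Qed.

End DerE.
#[global] Opaque mapE derE.

Local Notation ksE := (koszul_mul (fun B : {set 'I_n} => #|B|) (@wedge R n)).
Local Notation homE k := (homog (fun B : {set 'I_n} => #|B|) k).

Lemma homE_bvec A : homE #|A| (bvec A : E).
Proof. exact: (supp_in_bvec (P := fun B : {set 'I_n} => #|B| = #|A|)). Qed.

Lemma homog_wedge i j a b : homE i a -> homE j b -> homE (i + j)%N (wedge a b).
Proof.
move=> ha hb.
have -> : wedge a b = lext (fun A => lext (fun B => wedge (bvec A) (bvec B)) b) a.
  move: a {ha}; apply: lin_ext => [||A]; [by lin|by apply: lin_lext|].
  rewrite -> lext_bvec; move: b {hb}; apply: lin_ext => [||B]; [by lin|by apply: lin_lext|].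
  by rewrite -> lext_bvec.
apply: (supp_in_lext (P := fun A : {set 'I_n} => #|A| = i)) => [A <-|]; last exact: ha.
apply: (supp_in_lext (P := fun A : {set 'I_n} => #|A| = j)) => [B <-|]; last exact: hb.
rewrite -> wedge_bvec; case: ifP => dAB; last exact: supp_in0.
apply: supp_inZ; apply: supp_in_bvec.
by rewrite finset.cardsU disjoint_setI0 // cards0 subn0.
Qed.

Lemma homog_vE x : homE 1 (vE x).
Proof.
apply: supp_in_sum => i _; apply: supp_inZ; apply: supp_in_bvec.
exact: cards1.
Qed.

Lemma homog_one : homE 0 one.
Proof. by apply: supp_in_bvec; rewrite cards0. Qed.

Lemma antipodeE_homog k a : homE k a -> antipodeE a = (-1) ^+ k *: a.
Proof.
apply: lin_ext_supp => [||A <-]; [by lin|by lin|].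
by rewrite /antipodeE; rewrite -> lext_bvec.
Qed.

Lemma antipodeE1 : antipodeE one = one.
Proof. by rewrite (antipodeE_homog (@homog_one)) expr0 scale1r. Qed.

Lemma antipodeE_cons x a : antipodeE (wedge (vE x) a) = - wedge (vE x) (antipodeE a).
Proof.
move: a; apply: lin_ext => [||A]; [by lin|by lin|].
have hA := @homE_bvec A.
apply: etrans (antipodeE_homog (homog_wedge (@homog_vE x) hA)) _.
apply: etrans _ (congr1 (fun z => - wedge _ z) (esym (antipodeE_homog hA))).
apply: etrans _ (congr1 (fun z => - z) (esym (wedgeZr _ _ _))).
by apply: scale_eqN; rewrite add1n exprS mulN1r.
Qed.

Lemma antipodeEK a : antipodeE (antipodeE a) = a.
Proof.
move: a; apply: E_ext => [|||i a IH]; [by lin|by lin| |].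
  by rewrite -> !antipodeE1.
apply: etrans (congr1 (@antipodeE R n) (antipodeE_cons _ _)) _.
apply: etrans (linN (@lin_antipodeE R n) _) _.
apply: etrans (congr1 (fun z => - z) (antipodeE_cons _ _)) _.
apply: etrans (opprK _) _; exact: (congr1 (wedge (vE (e_ R i))) IH).
Qed.

(** The antipode multiplies by (-1)^|a|, the cost of moving x across a. Koszul signs are written
    through it from here on, so that no degree has to be mentioned. *)
Lemma wedge_vEr a x : wedge a (vE x) = wedge (vE x) (antipodeE a).
Proof.
move: a; apply: E_ext => [|||i a IH]; [by lin|by lin| |].
  by rewrite -> antipodeE1, wedge1l, wedge1r.
apply: etrans (esym (wedgeA _ _ _)) _.
apply: etrans (congr1 (wedge _) IH) _.
apply: etrans (wedge_inE_antiA _ _ _) _.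
apply: etrans (esym (wedgeNr _ _)) _.
exact: (congr1 (wedge (vE x)) (esym (antipodeE_cons _ _))).
Qed.

Lemma mapE_antipodeE f a : lin f ->
  mapE f (antipodeE a) = antipodeE (mapE f a).
Proof.
move=> hf; move: a; apply: E_ext => [|||i a IH]; [by lin|by lin| |].
  by rewrite -> antipodeE1, mapE1, antipodeE1.
rewrite -> antipodeE_cons, (mapE_cons hf), antipodeE_cons.
apply: etrans (linN (lin_mapE f) _) _.
rewrite -> (mapE_cons hf).
exact: (congr1 (fun z => - wedge (vE (f (e_ R i))) z) IH).
Qed.

Lemma derE_antipodeE f a : lin f ->
  derE f (antipodeE a) = antipodeE (derE f a).
Proof.
move=> hf; move: a; apply: E_ext => [|||i a IH]; [by lin|by lin| |].
  rewrite -> antipodeE1, derE1.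
  exact: esym (lin0 (@lin_antipodeE R n)).
rewrite -> antipodeE_cons, (derE_cons hf).
apply: etrans (linN (lin_derE f) _) _.
rewrite -> (derE_cons hf).
apply: etrans _ (esym (linD (@lin_antipodeE R n) _ _)).
rewrite -> !antipodeE_cons.
apply: etrans (opprD _ _) _.
exact: (congrD erefl (congr1 (fun z => - wedge (vE (e_ R i)) z) IH)).
Qed.

Lemma epsE1 : epsE one = 1.
Proof. by rewrite /epsE /oneE mcoeffUU. Qed.

Lemma epsE_supp k a : (0 < k)%N -> homE k a -> epsE a = 0.
Proof.
move=> k0 ha; apply: mcoeff_outdom; apply/negP => /ha.
by rewrite cards0 => e; rewrite -e in k0.
Qed.

Lemma epsE_cons x a : epsE (wedge (vE x) a) = 0.
Proof.
move: a; apply: (lin_ext (M := R^o)) => [||A]; [by lin|by lin|].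
apply: (epsE_supp (k := (1 + #|A|)%N)) => //; exact: (homog_wedge (@homog_vE x) (@homE_bvec A)).
Qed.

Lemma DeltaE1 : DeltaE one = one ⊗ one.
Proof. rewrite /DeltaE; exact: ext_map1. Qed.

Let cD x (t : EE) : EE := ksE (vE x ⊗ one + one ⊗ vE x) t.

Let wb : bilin (@wedge R n).
Proof. by bilin. Qed.

Let ks_vl x b c : ksE (vE x ⊗ one) (b ⊗ c) = wedge (vE x) b ⊗ c.
Proof.
move: b; apply: lin_ext => [||B]; [by lin|by lin|].
have hB := @homE_bvec B.
apply: etrans (koszul_tens wb _ _ (@homog_one) hB) _.
by rewrite mul0n scale1r; rewrite -> wedge1l.
Qed.

Let ks_vr x b c : ksE (one ⊗ vE x) (b ⊗ c) = antipodeE b ⊗ wedge (vE x) c.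
Proof.
move: b; apply: lin_ext => [||B]; [by lin|by lin|].
have hB := @homE_bvec B.
apply: etrans (koszul_tens wb _ _ (@homog_vE x) hB) _.
rewrite mul1n; rewrite -> wedge1l.
apply: etrans _ (congr1 (fun z => z ⊗ _) (esym (antipodeE_homog hB))).
exact: esym (tensZl _ _ _).
Qed.

Let cDE x b c : cD x (b ⊗ c) = wedge (vE x) b ⊗ c + antipodeE b ⊗ wedge (vE x) c.
Proof.
apply: etrans (koszulDl _ _ _ _ _) _.
exact: congrD (ks_vl _ _ _) (ks_vr _ _ _).
Qed.

Let cD_linr x : lin (cD x).
Proof. by apply: lin_koszulr. Qed.

Let cD_linl t : lin (fun x => cD x t).
Proof. by rewrite /cD; lin. Qed.

(** The cross terms S(x ∧ b) ⊗ x ∧ c and x ∧ S(b) ⊗ x ∧ c are opposite because x is odd; the other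
    two contain x ∧ x. *)
Let cD_sq x t : cD x (cD x t) = 0.
Proof.
move: t; apply: lin_ext2 => [||b c].
- exact: (lin_comp (cD_linr x) (cD_linr x)).
- exact: lin_zero.
apply: etrans (congr1 (cD x) (cDE _ _ _)) _.
apply: etrans (linD (cD_linr x) _ _) _.
apply: etrans (congrD (cDE _ _ _) (cDE _ _ _)) _.
rewrite -> !wedge_inE_sqA, antipodeE_cons.
rewrite -> tens0l, tens0r, tensNl.
rewrite add0r addr0; exact: addNr.
Qed.

Lemma DeltaE_cons x a : DeltaE (wedge (vE x) a) =
  ksE (vE x ⊗ one + one ⊗ vE x) (DeltaE a).
Proof. exact: (ext_map_wedge _ cD_linl cD_linr cD_sq). Qed.

Section Sweedler.
Variable M : lmodType R.
Implicit Types F : E -> E -> M.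

Lemma eq_swE F F' a : (forall b c, F b c = F' b c) -> swE F a = swE F' a.
Proof. exact: eq_tlift'. Qed.

Lemma swE1 F : bilin F -> swE F one = F one one.
Proof. by move=> hF; rewrite /swE; rewrite -> DeltaE1; rewrite -> tlift_tens by done. Qed.

Lemma swE_cons F x a : bilin F -> swE F (wedge (vE x) a) =
  swE (fun b c => F (wedge (vE x) b) c + F (antipodeE b) (wedge (vE x) c)) a.
Proof.
move=> hF; have [hF1 hF2] := hF; rewrite /swE; rewrite -> DeltaE_cons.
move: (DeltaE a); apply: lin_ext2 => [||b c]; [by lin|by lin|].
apply: etrans (congr1 (tlift F) (cDE _ _ _)) _.
apply: etrans (tliftD _ _ _) _.
apply: etrans (congrD (tlift_tens hF _ _) (tlift_tens hF _ _)) _.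
by symmetry; rewrite -> tlift_tens by bilin.
Qed.

Lemma swED F F' a : swE (fun b c => F b c + F' b c) a = swE F a + swE F' a.
Proof.
rewrite /swE; move: (DeltaE a); apply: lin_ext => [||[b c]]; [by lin|by lin|].
by rewrite -> !tlift_bvec.
Qed.

Lemma swEN F a : swE (fun b c => - F b c) a = - swE F a.
Proof.
rewrite /swE; move: (DeltaE a); apply: lin_ext => [||[b c]]; [by lin|by lin|].
by rewrite -> !tlift_bvec.
Qed.

Lemma swE_eq0 F a : (forall b c, F b c = 0) -> swE F a = 0.
Proof.
move=> F0; rewrite /swE; move: (DeltaE a); apply: lin_ext => [||[b c]]; [by lin|by lin|].
by rewrite -> tlift_bvec.
Qed.

End Sweedler.

Lemma swE_lin (M N : lmodType R) (h : M -> N) (F : E -> E -> M) a :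
  lin h -> h (swE F a) = swE (fun b c => h (F b c)) a.
Proof. exact: lin_tlift_comp. Qed.

End ExteriorMaps.
#[global] Opaque antipodeE epsE DeltaE swE.

(** * Coproduct of the exterior algebra and action of the tensor algebra *)

Lemma addr_shuffle6 (V : zmodType) (u1 u2 u3 u4 u5 u6 : V) :
  u1 + u2 + (u3 + u4 + (u5 + u6)) = u1 + u3 + u5 + (u4 + (u2 + u6)).
Proof.
rewrite -!addrA; congr (_ + _); rewrite [LHS]addrCA; congr (_ + _).
by rewrite [LHS]addrCA [u2 + (_ + _)]addrCA [RHS]addrCA.
Qed.

Section ExteriorBialgebra.
Variables (R : realType) (n : nat).
Local Notation g := 'rV[R]_n.
Local Notation T := (tensor_alg R n).
Local Notation E := (exterior_alg R n).
Local Notation one := (oneE R n).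
Local Notation vE := (@Defs.inE R n).
Local Notation gs := (@antipodeE R n).
Implicit Types (A B C : {set 'I_n}) (a b c : E).

Lemma swE_antipodeE (M : lmodType R) (F : E -> E -> M) a : bilin F ->
  swE F (gs a) = swE (fun b c => F (gs b) (gs c)) a.
Proof.
move=> [F1 F2]; move: a; apply: lin_ext => [||A]; [by lin|by lin|].
move: A F F1 F2; apply: set_min_ind => [|j A jA IH] F F1 F2.
  rewrite -/(oneE R n); rewrite -> antipodeE1, !swE1 by bilin.
  by rewrite -> antipodeE1.
have NF1 x y : F x (- y) = - F x y by apply: (linN (F1 x)).
have NF2 x y : F (- x) y = - F x y by apply: (linN (F2 y)).
apply: etrans (congr1 (fun z => swE F (gs z)) (bvec_below R jA)) _.
apply: etrans _ (congr1 (swE (fun b c => F (gs b) (gs c))) (esym (bvec_below R jA))).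
apply: etrans (congr1 (swE F) (antipodeE_cons _ _)) _.
apply: etrans (linN (lin_swE F) _) _.
rewrite -> !swE_cons by bilin.
set x := e_ R j.
apply: etrans (congr1 (fun z => - z) (IH _ _ _)) _; [by move=> ?; lin|by move=> ?; lin|].
rewrite <- swEN; apply: eq_swE => b c.
rewrite -> !antipodeE_cons; apply: etrans (opprD _ _) _.
by apply: congrD; symmetry; [apply: NF2|apply: NF1].
Qed.

Lemma swE_coassoc (M : lmodType R) (F : E -> E -> E -> M) a : trilin F ->
  swE (fun b c => swE (fun b1 b2 => F b1 b2 c) b) a =
  swE (fun b c => swE (F b) c) a.
Proof.
case=> F1 F2 F3; move: a; apply: lin_ext => [||A]; [by lin|by lin|].
move: A F F1 F2 F3; apply: set_min_ind => [|j A jA IH] F F1 F2 F3.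
  by rewrite -/(oneE R n); rewrite -> !swE1 by bilin.
set x := e_ R j.
apply: etrans (congr1 (swE _) (bvec_below R jA)) _.
apply: etrans _ (congr1 (swE _) (esym (bvec_below R jA))).
rewrite -> (swE_cons (F := fun b c => swE _ b)) by bilin.
rewrite -> (swE_cons (F := fun b c => swE _ c)) by bilin.
(* As for words, x lands once in each factor, now with the sign of crossing the factors to its
   left. *)
pose F' b c d := F (wedge (vE x) b) c d + (F (gs b) (wedge (vE x) c) d
  + F (gs b) (gs c) (wedge (vE x) d)).
transitivity (swE (fun b c => swE (fun b1 b2 => F' b1 b2 c) b) (bvec A)).
  apply: eq_swE => b c; rewrite -> swE_cons by bilin.
  rewrite -> swE_antipodeE by bilin.
  apply: etrans (esym (swED _ _ _)) _; apply: eq_swE => b1 b2.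
  exact: esym (addrA _ _ _).
apply: etrans (IH _ _ _ _) _; rewrite /F'; [by move=> *; lin|by move=> *; lin|by move=> *; lin|].
apply: eq_swE => b c; apply: etrans (swED _ _ _) _; apply: congrD => //.
by apply: esym; apply: swE_cons; bilin.
Qed.

Lemma epsE_antipodeE a : epsE (gs a) = epsE a.
Proof.
move: a; apply: (E_ext (M := R^o)) => [|||i a IH]; [by lin|by lin| |].
  by rewrite -> antipodeE1.
rewrite -> antipodeE_cons, epsE_cons.
apply: etrans (linN (@lin_epsE R n) _) _.
apply: etrans (congr1 (fun z : R => - z) (epsE_cons _ _)) _; exact: oppr0.
Qed.

Lemma swE_counitl (M : lmodType R) (F : E -> M) a : lin F ->
  swE (fun b c => epsE b *: F c) a = F a.
Proof.
move=> F1; move: a; apply: lin_ext => [||A]; [by lin|by lin|].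
move: A F F1; apply: set_min_ind => [|j A jA IH] F F1.
  by rewrite -/(oneE R n); rewrite -> swE1, epsE1 by bilin; rewrite scale1r.
apply: etrans (congr1 (swE _) (bvec_below R jA)) _.
rewrite -> swE_cons by bilin.
apply: etrans _ (congr1 F (esym (bvec_below R jA))).
apply: etrans _ (IH (fun a => F (wedge (vE (e_ R j)) a)) _); last by lin.
apply: eq_swE => b c; rewrite -> epsE_cons, epsE_antipodeE.
by rewrite scale0r add0r.
Qed.

Lemma swE_counitr (M : lmodType R) (F : E -> M) a : lin F ->
  swE (fun b c => epsE c *: F b) a = F a.
Proof.
move=> F1; move: a; apply: lin_ext => [||A]; [by lin|by lin|].
move: A F F1; apply: set_min_ind => [|j A jA IH] F F1.
  by rewrite -/(oneE R n); rewrite -> swE1, epsE1 by bilin; rewrite scale1r.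
apply: etrans (congr1 (swE _) (bvec_below R jA)) _.
rewrite -> swE_cons by bilin.
apply: etrans _ (congr1 F (esym (bvec_below R jA))).
apply: etrans _ (IH (fun a => F (wedge (vE (e_ R j)) a)) _); last by lin.
apply: eq_swE => b c; rewrite -> epsE_cons.
by rewrite scale0r addr0.
Qed.

(** A first factor x contributes S(x ∧ b) ∧ c + b ∧ x ∧ c, and b ∧ x = x ∧ S(b), so the sum vanishes
    term by term. The other axiom is similar. *)
Lemma antipodeE_l a : swE (fun b c => wedge (gs b) c) a = epsE a *: one.
Proof.
move: a; apply: E_ext => [|||i a _]; [by lin|by lin| |].
  by rewrite -> swE1, epsE1, antipodeE1, wedge1l by bilin; rewrite scale1r.
rewrite -> swE_cons, epsE_cons by bilin; rewrite scale0r.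
apply: swE_eq0 => b c; rewrite -> antipodeE_cons, antipodeEK, wedgeNl.
apply: etrans (congr1 (fun z => _ + z) (wedgeA _ _ _)) _.
apply: etrans (congr1 (fun z => _ + wedge z _) (wedge_vEr _ _)) _.
exact: addNr.
Qed.

Lemma antipodeE_r a : swE (fun b c => wedge b (gs c)) a = epsE a *: one.
Proof.
move: a; apply: E_ext => [|||i a _]; [by lin|by lin| |].
  by rewrite -> swE1, epsE1, antipodeE1, wedge1l by bilin; rewrite scale1r.
rewrite -> swE_cons, epsE_cons by bilin; rewrite scale0r.
apply: swE_eq0 => b c; rewrite -> antipodeE_cons, wedgeNr.
apply: etrans (congr1 (fun z => _ - z) (wedgeA _ _ _)) _.
apply: etrans (congr1 (fun z => _ - wedge z _) (wedge_vEr _ _)) _.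
rewrite -> antipodeEK; exact: subrr.
Qed.

Lemma swE_mapE (f : g -> g) (M : lmodType R) (F : E -> E -> M) a :
  lin f -> bilin F ->
  swE F (mapE f a) = swE (fun b c => F (mapE f b) (mapE f c)) a.
Proof.
move=> hf [F1 F2]; move: a; apply: lin_ext => [||A]; [by lin|by lin|].
move: A F F1 F2; apply: set_min_ind => [|j A jA IH] F F1 F2.
  rewrite -/(oneE R n); rewrite -> mapE1, !swE1 by bilin.
  by rewrite -> mapE1.
apply: etrans (congr1 (fun z => swE F (mapE f z)) (bvec_below R jA)) _.
apply: etrans _ (congr1 (swE _) (esym (bvec_below R jA))).
rewrite -> (mapE_cons hf), !swE_cons by bilin.
apply: etrans (IH _ _ _) _; [by move=> ?; lin|by move=> ?; lin|].
apply: eq_swE => b c; rewrite -> !(mapE_cons hf).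
rewrite -> mapE_antipodeE; [reflexivity|exact: hf].
Qed.

Lemma swE_derE (f : g -> g) (M : lmodType R) (F : E -> E -> M) a :
  lin f -> bilin F ->
  swE F (derE f a) = swE (fun b c => F (derE f b) c + F b (derE f c)) a.
Proof.
move=> hf [F1 F2]; move: a; apply: lin_ext => [||A]; [by lin|by lin|].
move: A F F1 F2; apply: set_min_ind => [|j A jA IH] F F1 F2.
  rewrite -/(oneE R n); rewrite -> derE1, !swE1 by bilin.
  rewrite -> derE1; rewrite (lin0 (F1 _)) (lin0 (F2 _)) addr0.
  exact: (lin0 (lin_swE F)).
have DF1 x y z : F x (y + z) = F x y + F x z by apply: (linD (F1 x)).
have DF2 x y z : F (x + y) z = F x z + F y z by apply: (linD (F2 z)).
apply: etrans (congr1 (fun z => swE F (derE f z)) (bvec_below R jA)) _.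
apply: etrans _ (congr1 (swE _) (esym (bvec_below R jA))).
set x := e_ R j.
apply: etrans (congr1 (swE F) (derE_cons hf _ _)) _.
apply: etrans (linD (lin_swE F) _ _) _.
rewrite -> !swE_cons by bilin.
apply: etrans (congr1 (fun z => _ + z) (IH _ _ _)) _; [by move=> ?; lin|by move=> ?; lin|].
rewrite <- swED; apply: eq_swE => b c.
rewrite -> !(derE_cons hf), derE_antipodeE; last exact: hf.
apply: etrans _ (esym (congrD (congrD (DF2 _ _ _) erefl) (congrD erefl (DF1 _ _ _)))).
exact: addr_shuffle6.
Qed.

Lemma epsE_derE (f : g -> g) a : lin f -> epsE (derE f a) = 0.
Proof.
move=> hf; move: a; apply: (E_ext (M := R^o)) => [|||i a IH]; [by lin|by apply: lin_zero| |].
  by rewrite -> derE1; exact: (lin0 (@lin_epsE R n)).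
rewrite -> (derE_cons hf).
apply: etrans (linD (@lin_epsE R n) _ _) _.
apply: etrans (congrD (epsE_cons _ _) (epsE_cons _ _)) _.
exact: addr0.
Qed.

Lemma epsE_mapE (f : g -> g) a : lin f -> epsE (mapE f a) = epsE a.
Proof.
move=> hf; move: a; apply: (E_ext (M := R^o)) => [|||i a IH]; [by lin|by lin| |].
  by rewrite -> mapE1.
by rewrite -> (mapE_cons hf), !epsE_cons.
Qed.

Lemma epsE_wedge a b : epsE (wedge a b) = epsE a * epsE b.
Proof.
move: a; apply: (E_ext (M := R^o)) => [|||i a IH].
- by lin.
- by move=> k u v; rewrite (@lin_epsE R n k u v) mulrDl; congr (_ + _); exact: esym (mulrA _ _ _).
- by rewrite -> wedge1l, epsE1; rewrite mul1r.
apply: etrans (congr1 (@epsE R n) (esym (wedgeA _ _ _))) _.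
apply: etrans (epsE_cons _ _) _; apply: esym.
apply: etrans (congr1 (fun z => z * _) (epsE_cons _ _)) _.
exact: mul0r.
Qed.

Lemma mapE_derE (h f f' : g -> g) a : lin h -> lin f -> lin f' ->
  (forall x, h (f x) = f' (h x)) -> mapE h (derE f a) = derE f' (mapE h a).
Proof.
move=> hh hf hf' e; move: a; apply: E_ext => [|||i a IH]; [by lin|by lin| |].
  apply: etrans (congr1 (mapE h) (derE1 f)) _.
  apply: etrans (lin0 (lin_mapE h)) _; apply: esym.
  exact: etrans (congr1 (derE f') (mapE1 h)) (derE1 f').
apply: etrans (congr1 (mapE h) (derE_cons hf _ _)) _.
apply: etrans (linD (lin_mapE h) _ _) _.
apply: etrans (congrD (mapE_cons hh _ _) (mapE_cons hh _ _)) _; apply: esym.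
apply: etrans (congr1 (derE f') (mapE_cons hh _ _)) _.
apply: etrans (derE_cons hf' _ _) _; rewrite e.
exact: esym (congr1 (fun z => _ + wedge _ z) IH).
Qed.

Section Action.
Variable br : g -> g -> g.
Hypothesis br_l : forall y, lin (fun x => br x y).
Hypothesis br_r : forall x, lin (br x).
Local Notation act := (actE br).

Lemma lin_derE_br a : lin (fun x => derE (br x) a).
Proof.
move=> k x y; move: a; apply: E_ext => [|||i a IH]; [by lin|by lin| |].
  by rewrite -> !derE1; rewrite scaler0 addr0.
rewrite -> !(derE_cons (br_r _)).
apply: etrans (congrD (congr1 (fun z => wedge (vE z) a) (br_l _ _ _ _)) (congr1 (wedge _) IH)) _.
have h1 : lin (fun x => wedge (vE x) a) by lin.
apply: etrans (congrD (h1 _ _ _) (lin_wedger _ _ _ _)) _.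
by apply: etrans (addrACA _ _ _ _) _; rewrite scalerDr.
Qed.

Lemma act1 a : act 1 a = a.
Proof. by rewrite -T1E /actE; rewrite -> lext_bvec. Qed.

Lemma act_cons x v a : act (inT x * v) a = derE (br x) (act v a).
Proof.
have la := lin_actl br a.
move: x; apply: rV_ext => [||i].
- exact: (lin_comp la (lin_comp (lin_malgMl v) (@lin_inT R n))).
- exact: lin_derE_br.
move: v; apply: word_ext => [||s].
- exact: (lin_comp la (lin_malgMr _)).
- exact: (lin_comp (lin_derE _) la).
apply: etrans (congr1 (fun v => act v a) (esym (bvec_cons _ _ _))) _.
by rewrite /actE; rewrite -> !lext_bvec.
Qed.

End Action.
#[global] Opaque actE.

Section Action.
Variable br : g -> g -> g.
Hypothesis br_l : forall y, lin (fun x => br x y).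
Hypothesis br_r : forall x, lin (br x).
Local Notation act := (actE br).
Let ac := act_cons br_l br_r.

Lemma actM v w a : act (v * w) a = act v (act w a).
Proof.
move: v; apply: T_ext => [|||i v IH]; [by lin|by lin| |].
  by rewrite -> mul1r, act1.
apply: etrans (congr1 (fun z => act z a) (esym (mulrA _ _ _))) _.
rewrite -> !ac; exact: (congr1 (derE _) IH).
Qed.

(** A letter is primitive and acts by a derivation, so the Leibniz rule propagates to words: the
    exterior algebra is a module algebra over T. *)
Lemma act_wedge v a b :
  act v (wedge a b) = sw2 (fun v1 v2 => wedge (act v1 a) (act v2 b)) v.
Proof.
move: v; apply: T_ext => [|||i v IH]; [by lin|by lin| |].
  by rewrite -> sw2_1, !act1 by bilin.
rewrite -> ac, sw2_cons by bilin.
apply: etrans (congr1 (derE _) IH) _.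
apply: etrans (sw2_lin _ _ (lin_derE _)) _.
apply: eq_sw2 => v1 v2; rewrite -> (derEM (br_r _)).
by rewrite -> !ac.
Qed.

Lemma act_one v : act v one = epsT v *: one.
Proof.
move: v; apply: T_ext => [|||i v IH]; [by lin|by lin| |].
  by rewrite -> act1, epsT1; rewrite scale1r.
rewrite -> ac, epsT_cons; rewrite scale0r.
apply: etrans (congr1 (derE _) IH) _.
apply: etrans (linZ (lin_derE _) _ _) _.
apply: etrans (congr1 (fun z => _ *: z) (derE1 _)) _; exact: scaler0.
Qed.

Lemma epsE_act v a : epsE (act v a) = epsT v * epsE a.
Proof.
move: v; apply: (T_ext (M := R^o)) => [|||i v IH].
- by lin.
- by move=> k u v; rewrite (@lin_epsT R n k u v) mulrDl; congr (_ + _); exact: esym (mulrA _ _ _).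
- by rewrite -> act1, epsT1; rewrite mul1r.
rewrite -> ac; apply: etrans (epsE_derE _ (br_r _)) _.
by apply: esym; apply: etrans (congr1 (fun z => z * _) (epsT_cons _ _)) _; rewrite mul0r.
Qed.

Lemma mapE_act (f : g -> g) v a : lin f ->
  (forall x y, f (br x y) = br (f x) (f y)) ->
  mapE f (act v a) = act (mapT f v) (mapE f a).
Proof.
move=> hf fbr; move: v; apply: T_ext => [|||i v IH]; [by lin|by lin| |].
  by rewrite -> mapT1, !act1.
rewrite -> ac, (mapT_cons hf), ac.
apply: etrans (mapE_derE (f' := br (f (e_ R i))) _ hf (br_r _) (br_r _) _) _.
  by move=> x; apply: fbr.
exact: (congr1 (derE _) IH).
Qed.

End Action.

End ExteriorBialgebra.

(** * Word length and exterior degree under the operations *)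

Section Filtrations.
Variables (R : realType) (n : nat).
Local Notation g := 'rV[R]_n.
Local Notation T := (tensor_alg R n).
Local Notation E := (exterior_alg R n).
Local Notation one := (oneE R n).
Local Notation vE := (@Defs.inE R n).

Definition filtT (r : nat) (v : T) : Prop :=
  supp_in (fun w : fmonom 'I_n => (fdeg w <= r)%N) v.

Definition degE (k : nat) (a : E) : Prop :=
  supp_in (fun A : {set 'I_n} => #|A| = k) a.

Lemma filtT_bvec w : filtT (fdeg w) (bvec w).
Proof. exact: supp_in_bvec. Qed.

Lemma filtT1 : filtT 0 1.
Proof. by rewrite -T1E; apply: supp_in_bvec. Qed.

Lemma filtT_mul r s v w : filtT r v -> filtT s w -> filtT (r + s)%N (v * w).
Proof.
move=> hv hw.
have -> : v * w = lext (fun a => lext (fun b => bvec (mmul a b)) w) v.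
  move: v {hv}; apply: lin_ext => [||a]; [by lin|by apply: lin_lext|].
  rewrite -> lext_bvec; move: w {hw}; apply: lin_ext => [||b]; [by lin|by apply: lin_lext|].
  rewrite -> lext_bvec; exact: malgM_bvec.
apply: (supp_in_lext _ hv) => a ha; apply: (supp_in_lext _ hw) => b hb.
apply: supp_in_bvec; apply: leq_trans (leq_add ha hb).
by rewrite fdegM.
Qed.

Lemma filtT_inT x : filtT 1 (inT x).
Proof.
apply: supp_in_sum => i _; apply: supp_inZ; apply: supp_in_bvec.
by rewrite fdegU.
Qed.

Lemma filtT_mapT (f : g -> g) r v : lin f -> filtT r v -> filtT r (mapT f v).
Proof.
move=> hf hv; rewrite [v]malg_expand (lin_bigsum _ _ _ (lin_mapT f)) big_seq.
apply: supp_in_sum => w /hv hw; rewrite (linZ (lin_mapT f)); apply: supp_inZ.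
case: w hw => s; elim: s r {hv} => [|i s IH] r hr.
  rewrite T1E; rewrite -> mapT1; rewrite -T1E; exact: supp_in_bvec.
rewrite bvec_cons; rewrite -> (mapT_cons hf).
case: r hr => [h0|r hr]; first by exfalso; move: h0; rewrite fdegE.
rewrite -add1n.
exact: filtT_mul (@filtT_inT _) (IH _ _).
Qed.

Lemma filtT_antipode r v : filtT r v -> filtT r (antipodeT v).
Proof.
apply: supp_in_lext => w hw; apply: supp_inZ; apply: supp_in_bvec.
by move: hw; rewrite !fdegE size_rev.
Qed.

Lemma supp_in_tlift (K L N : choiceType) (P : K * L -> Prop) (Q : N -> Prop)
    (F : malg K R -> malg L R -> malg N R) t :
  (forall k l, P (k, l) -> supp_in Q (F (bvec k) (bvec l))) ->
  supp_in P t -> supp_in Q (tlift F t).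
Proof. by move=> hF; apply: supp_in_lext => -[k l]; apply: hF. Qed.

Lemma DeltaT_supp w :
  supp_in (fun ab : fmonom 'I_n * fmonom 'I_n => (fdeg ab.1 + fdeg ab.2 = fdeg w)%N)
    (DeltaT (bvec w : T)).
Proof.
case: w => s; elim: s => [|i s IH].
  rewrite T1E; rewrite -> DeltaT1; rewrite -T1E; rewrite -> tens_bvec.
  exact: supp_in_bvec.
have hE : bilin (fun a b : T => a ⊗ b) by bilin.
have e : DeltaT (bvec (FMonom (i :: s)) : T) =
    tlift (fun a b : T => (inT (e_ R i) * a) ⊗ b + a ⊗ (inT (e_ R i) * b))
      (DeltaT (bvec (FMonom s))).
  rewrite bvec_cons; apply: etrans (esym (tlift_id _)) _.
  exact: (@sw2_cons R n _ (fun a b : T => a ⊗ b) (e_ R i) (bvec (FMonom s)) hE).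
rewrite e {e}.
apply: supp_in_tlift IH => a b; rewrite !fdegE /= => hab.
rewrite inT_e; rewrite -> !malgM_bvec, !tens_bvec.
apply: supp_inD; apply: supp_in_bvec; rewrite /= fdegM fdegU !fdegE.
  by rewrite -hab.
by rewrite -hab addnCA.
Qed.

Lemma degE_one : degE 0 one.
Proof. exact: homog_one. Qed.

Lemma degE_bvec (A : {set 'I_n}) : degE #|A| (bvec A).
Proof. exact: homE_bvec. Qed.

Lemma degE_wedge i j a b : degE i a -> degE j b -> degE (i + j)%N (wedge a b).
Proof. exact: homog_wedge. Qed.

Lemma degE_vE x : degE 1 (vE x).
Proof. exact: homog_vE. Qed.

Lemma degE_lin (f : E -> E) : lin f -> (forall A : {set 'I_n}, degE #|A| (f (bvec A))) ->
  forall k a, degE k a -> degE k (f a).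
Proof.
move=> hf fA k a ha; rewrite [a]malg_expand (lin_bigsum _ _ _ hf) big_seq.
apply: supp_in_sum => A /ha <-; rewrite (linZ hf); apply: supp_inZ; exact: fA.
Qed.

Lemma degE_antipode k a : degE k a -> degE k (antipodeE a).
Proof.
move=> ha; rewrite (antipodeE_homog ha); exact: supp_inZ.
Qed.

Lemma card_below (i : 'I_n) (A : {set 'I_n}) : below i A -> #|(i |: A)%SET| = (1 + #|A|)%N.
Proof. by move=> iA; rewrite cardsU1 below_notin. Qed.

Lemma degE_mapE (f : g -> g) k a : lin f -> degE k a -> degE k (mapE f a).
Proof.
move=> hf; apply: degE_lin (lin_mapE f) _ _ _ => A.
move: A; apply: set_min_ind => [|i A iA IH].
  rewrite cards0 -/(oneE R n); rewrite -> mapE1; exact: degE_one.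
rewrite (card_below iA).
have -> : mapE f (bvec (i |: A)%SET) = wedge (vE (f (e_ R i))) (mapE f (bvec A)).
  exact: etrans (congr1 (mapE f) (bvec_below R iA)) (mapE_cons hf _ _).
exact: degE_wedge (@degE_vE _) IH.
Qed.

Lemma degE_derE (f : g -> g) k a : lin f -> degE k a -> degE k (derE f a).
Proof.
move=> hf; apply: degE_lin (lin_derE f) _ _ _ => A.
move: A; apply: set_min_ind => [|i A iA IH].
  rewrite cards0 -/(oneE R n); rewrite -> derE1; exact: supp_in0.
rewrite (card_below iA).
have -> : derE f (bvec (i |: A)%SET) =
    wedge (vE (f (e_ R i))) (bvec A) + wedge (vE (e_ R i)) (derE f (bvec A)).
  exact: etrans (congr1 (derE f) (bvec_below R iA)) (derE_cons hf _ _).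
apply: supp_inD; first exact: degE_wedge (@degE_vE _) (@degE_bvec _).
exact: degE_wedge (@degE_vE _) IH.
Qed.

Lemma degE_act (br : g -> g -> g) v k a : (forall y, lin (fun x => br x y)) ->
  (forall x, lin (br x)) -> degE k a -> degE k (actE br v a).
Proof.
move=> brl brr ha; rewrite [v]malg_expand (lin_bigsum _ _ _ (lin_actl br a)).
apply: supp_in_sum => -[s] _; rewrite (linZ (lin_actl br a)); apply: supp_inZ.
elim: s => [|i s IH]; first by rewrite T1E; rewrite -> act1; exact: ha.
rewrite bvec_cons; rewrite -> (act_cons brl brr).
exact: degE_derE.
Qed.

Lemma DeltaE_supp (A : {set 'I_n}) :
  supp_in (fun BC : {set 'I_n} * {set 'I_n} => (#|BC.1| + #|BC.2| = #|A|)%N)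
    (DeltaE (bvec A : E)).
Proof.
move: A; apply: set_min_ind => [|i A iA IH].
  rewrite -/(oneE R n); rewrite -> DeltaE1; rewrite /oneE; rewrite -> tens_bvec.
  by apply: supp_in_bvec; rewrite !cards0.
have hE : bilin (fun a b : E => a ⊗ b) by bilin.
have e : DeltaE (bvec (i |: A)%SET : E) =
    tlift (fun b c : E => wedge (vE (e_ R i)) b ⊗ c + antipodeE b ⊗ wedge (vE (e_ R i)) c)
      (DeltaE (bvec A)).
  apply: etrans (congr1 (@DeltaE R n) (bvec_below R iA)) _.
  apply: etrans (esym (tlift_id _)) _.
  exact: (@swE_cons R n _ (fun a b : E => a ⊗ b) (e_ R i) (bvec A) hE).
rewrite e {e} (card_below iA).
apply: supp_in_tlift IH => B C /= hBC.
apply: supp_inD.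
  apply: sub_supp_in (supp_in_tens (degE_wedge (@degE_vE _) (@degE_bvec B)) (@degE_bvec C)).
  by move=> [B' C'] /= [-> ->]; rewrite -hBC addnA.
apply: sub_supp_in (supp_in_tens (degE_antipode (@degE_bvec B)) (degE_wedge (@degE_vE _) (@degE_bvec C))).
by move=> [B' C'] /= [-> ->]; rewrite -hBC addnCA.
Qed.

End Filtrations.

(** * Point currents *)

Section PointCurrents.
Variables (R : realType) (n : nat) (G : lieGroup R n).
Local Notation T := (tensor_alg R n).
Local Notation E := (exterior_alg R n).
Local Notation H := (currents R G).

Lemma lin_at_pt (p : G) : lin (at_pt p : malg (fibre_idx n) R -> H).
Proof. exact: lin_lext. Qed.

Definition cur (p : G) (v : T) (a : E) : H := at_pt p (v ⊗ a).

Lemma lin_curv p a : lin (fun v => cur p v a).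
Proof. exact: (lin_comp (lin_at_pt p) (lin_tensl a)). Qed.

Lemma lin_cura p v : lin (cur p v).
Proof. exact: (lin_comp (lin_at_pt p) (lin_tensr v)). Qed.

Lemma eq_cur p p' v v' a a' :
  p = p' -> v = v' -> a = a' -> cur p v a = cur p' v' a'.
Proof. by move=> -> -> ->. Qed.

Lemma cur_bvec p w A : cur p (bvec w) (bvec A) = bvec (p, (w, A)).
Proof. by rewrite /cur; rewrite -> tens_bvec; rewrite /at_pt; rewrite -> lext_bvec. Qed.

Lemma cur_extE (M : lmodType R) (F : G -> T -> E -> M) p v a : bilin (F p) ->
  cur_ext F (cur p v a) = F p v a.
Proof.
move=> [F1 F2].
have hl : lin (cur_ext F : H -> M) by apply: lin_lext.
move: v; apply: lin_ext => [||w].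
- exact: (lin_comp hl (lin_curv p a)).
- exact: F2.
move: a; apply: lin_ext => [||A].
- exact: (lin_comp hl (lin_cura p _)).
- exact: F1.
by rewrite cur_bvec /cur_ext; rewrite -> lext_bvec.
Qed.

Lemma lin_cur_ext (M : lmodType R) (F : G -> T -> E -> M) : lin (cur_ext F : H -> M).
Proof. exact: lin_lext. Qed.

Lemma lin_cur_extl (U M : lmodType R) (F : U -> G -> T -> E -> M) (y : H) :
  (forall p v a, lin (fun u => F u p v a)) -> lin (fun u => cur_ext (F u) y).
Proof. by move=> hF; apply: lin_lextl => k; apply: hF. Qed.

Lemma cur_all_ext (M : lmodType R) (f h : H -> M) : lin f -> lin h ->
  (forall p v a, f (cur p v a) = h (cur p v a)) -> forall x, f x = h x.
Proof.
move=> hf hh fh; apply: lin_ext => // -[p [w A]].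
by have := fh p (bvec w) (bvec A); rewrite !cur_bvec.
Qed.

End PointCurrents.
#[global] Opaque cur at_pt cur_ext.

Ltac lin_head ::=
  first [ lin_op | lazymatch goal with
  | |- lin (cur _ _) => exact: lin_cura
  | |- lin (fun y => cur _ y _) => exact: lin_curv
  | |- lin (at_pt _) => exact: lin_at_pt
  | |- lin (cur_ext ?F) => exact: (lin_cur_ext F)
  | |- lin (fun x => cur_ext (@?F x) ?v) => apply: lin_cur_extl => ? ? ?; lin
  end ].

(** * The Hopf algebra of point currents *)

Section HopfCurrents.
Variables (R : realType) (n : nat) (G : lieGroup R n) (c : chart R n G).
Local Notation g := 'rV[R]_n.
Local Notation T := (tensor_alg R n).
Local Notation E := (exterior_alg R n).
Local Notation H := (currents R G).
Local Notation HH := (malg (cur_idx G * cur_idx G)%type R).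
Local Notation one := (oneE R n).
Local Notation vE := (@Defs.inE R n).
Local Notation br := (lie_bracket c).
Local Notation Ad := (Ad c).
Local Notation act := (actE br).
Implicit Types (p q r : G) (v w : T) (a b : E).

(** These facts are established in charts further on; assuming them here separates the algebra from
    the calculus. *)
Hypothesis br_l : forall y, lin (fun x => br x y).
Hypothesis br_r : forall x, lin (br x).
Hypothesis AdM : forall p q x, Ad (p * q)%g x = Ad p (Ad q x).
Hypothesis Ad1 : forall x, Ad 1%g x = x.
Hypothesis Ad_br : forall p x y, Ad p (br x y) = br (Ad p x) (Ad p y).

Lemma lin_Ad p : lin (Ad p).
Proof. by move=> k x y; rewrite /Defs.Ad linearP. Qed.

Lemma AdVK p x : Ad p (Ad p^-1%g x) = x.
Proof. by rewrite -AdM mulgV Ad1. Qed.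

Lemma cur_mulE p v a q w b : cur_mul c (cur p v a) (cur q w b) =
  sw2 (fun v1 v2 => cur (p * q)%g (mapT (Ad q^-1%g) v1 * w)
                        (wedge a (mapE (Ad p) (act v2 b)))) v.
Proof.
have lA p := lin_Ad p; have l1 := lin_actl br; have l2 := lin_actr br.
rewrite /cur_mul; rewrite -> cur_extE by bilin; rewrite -> cur_extE by bilin.
by [].
Qed.

Lemma lin_cur_mull y : lin (fun x => cur_mul c x y).
Proof. exact: lin_cur_ext. Qed.

Lemma lin_cur_mulr x : lin (cur_mul c x).
Proof. by apply: lin_cur_extl => p v a; apply: lin_cur_ext. Qed.

Lemma cur_DeltaE p v a : cur_Delta (cur p v a) =
  sw2 (fun v1 v2 => swE (fun a1 a2 => cur p v1 a1 ⊗ cur p v2 a2) a) v.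
Proof. by rewrite /cur_Delta; rewrite -> cur_extE by bilin. Qed.

Lemma lin_cur_Delta : lin (@cur_Delta R n G).
Proof. exact: lin_cur_ext. Qed.

Lemma cur_epsE p v a : cur_eps (cur p v a) = epsT v * epsE a.
Proof.
rewrite /cur_eps; apply: (cur_extE (M := R^o)); split => u k x y /=.
  rewrite (@lin_epsE R n k x y) mulrDr; congr (_ + _); exact: mulrCA.
by rewrite (@lin_epsT R n k x y) mulrDl; congr (_ + _); exact: esym (mulrA _ _ _).
Qed.

Lemma lin_cur_eps : lin (@cur_eps R n G : H -> R^o).
Proof. exact: lin_cur_ext. Qed.

Lemma cur_antipodeE p v a : cur_antipode c (cur p v a) =
  sw2 (fun v1 v2 => cur p^-1%g (mapT (Ad p) (antipodeT v1))
    (act (antipodeT v2) (mapE (Ad p^-1%g) (antipodeE a)))) v.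
Proof.
have l1 := lin_actl br; have l2 := lin_actr br.
by rewrite /cur_antipode; rewrite -> cur_extE by bilin.
Qed.

Lemma lin_cur_antipode : lin (cur_antipode c).
Proof. exact: lin_cur_ext. Qed.

Local Notation mul := (cur_mul c).
Local Notation gP p := (@cur R n G p 1 one).
Local Notation gX x := (@cur R n G 1%g (inT x) one).
Local Notation gV x := (@cur R n G 1%g 1 (vE x)).

Lemma mapE_Ad p q a : mapE (Ad p) (mapE (Ad q) a) = mapE (Ad (p * q)%g) a.
Proof.
apply: etrans (mapE_comp _ (lin_Ad p) (lin_Ad q)) _; congr (mapE _ a).
by apply/funext => x; rewrite /= AdM.
Qed.

Lemma mapT_Ad p q v : mapT (Ad p) (mapT (Ad q) v) = mapT (Ad (p * q)%g) v.
Proof.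
apply: etrans (mapT_comp _ (lin_Ad p) (lin_Ad q)) _; congr (mapT _ v).
by apply/funext => x; rewrite /= AdM.
Qed.

Lemma mapE_Ad1 a : mapE (Ad 1%g) a = a.
Proof. by apply: mapE_id; apply: Ad1. Qed.

Lemma mapT_Ad1 v : mapT (Ad 1%g) v = v.
Proof. by apply: mapT_id; apply: Ad1. Qed.

Lemma mapE_act_Ad p v a : mapE (Ad p) (act v a) = act (mapT (Ad p) v) (mapE (Ad p) a).
Proof. apply: (mapE_act br_l br_r); [exact: lin_Ad|exact: Ad_br]. Qed.

Lemma act_inT x a : act (inT x) a = derE (br x) a.
Proof.
apply: etrans (congr1 (fun z => act z a) (esym (mulr1 _))) _.
apply: etrans (act_cons br_l br_r _ _ _) _.
exact: (congr1 (derE _) (act1 _ _)).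
Qed.

Lemma gP_mul p q w b : mul (gP p) (cur q w b) = cur (p * q)%g w (mapE (Ad p) b).
Proof.
have l1 := lin_actl br; have l2 := lin_actr br.
rewrite -> cur_mulE; rewrite -> sw2_1 by bilin.
rewrite -> mapT1, act1, wedge1l, mul1r; reflexivity.
Qed.

Lemma gX_mul x q w b : mul (gX x) (cur q w b) =
  cur q (inT (Ad q^-1%g x) * w) b + cur q w (derE (br x) b).
Proof.
have l1 := lin_actl br; have l2 := lin_actr br.
rewrite -> cur_mulE; rewrite -> sw2_inT by bilin.
apply: congrD; apply: eq_cur.
- exact: mul1g.
- exact: (congr1 (fun z => z * w) (mapT_inT (lin_Ad _) _)).
- exact: (etrans (wedge1l _) (etrans (mapE_Ad1 _) (act1 _ _))).
- exact: mul1g.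
- exact: (etrans (congr1 (fun z => z * w) (mapT1 _)) (mul1r _)).
- exact: (etrans (wedge1l _) (etrans (mapE_Ad1 _) (act_inT _ _))).
Qed.

Lemma gV_mul x q w b : mul (gV x) (cur q w b) = cur q w (wedge (vE x) b).
Proof.
have l1 := lin_actl br; have l2 := lin_actr br.
rewrite -> cur_mulE; rewrite -> sw2_1 by bilin.
apply: eq_cur; first exact: mul1g.
  exact: (etrans (congr1 (fun z => z * w) (mapT1 _)) (mul1r _)).
exact: (congr1 (wedge _) (etrans (mapE_Ad1 _) (act1 _ _))).
Qed.

(** The current (p, v ⊗ a) factors as (e, 1 ⊗ a) * ((p, 1 ⊗ 1) * (e, v ⊗ 1)), an order in which the
    twists by Ad act trivially. The first factor is a product of elements V and the last a product
    of elements X. *)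
Lemma cur_gen_ind (P : H -> Prop) :
  (forall k x y, P x -> P y -> P (k *: x + y)) ->
  (forall x y, P x -> P y -> P (mul x y)) ->
  (forall p, P (gP p)) -> (forall x, P (gX x)) -> (forall x, P (gV x)) ->
  forall x, P x.
Proof.
move=> Plin PM Pp PX PV x.
have P0 : P 0 by have := Plin (-1) _ _ (Pp 1%g) (Pp 1%g); rewrite scaleN1r addNr.
rewrite [x]malg_expand; elim/big_rec: _ => [//|[p [[s] A]] y _ Py].
apply: Plin Py; rewrite -cur_bvec.
have PA : P (cur 1%g 1 (bvec A)).
  move: A; apply: set_min_ind => [|i A iA IH]; first exact: Pp.
  have -> : cur 1%g 1 (bvec (i |: A)%SET) = mul (gV (e_ R i)) (cur 1%g 1 (bvec A)).
    apply: esym; apply: etrans (gV_mul _ _ _ _) _.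
    exact: (congr1 (cur _ _) (esym (bvec_below R iA))).
  exact: (PM _ _ (PV _) IH).
have Ps : P (cur 1%g (bvec (FMonom s)) one).
  elim: s => [|i s IH]; first by rewrite T1E; apply: Pp.
  have -> : cur 1%g (bvec (FMonom (i :: s))) one =
      mul (gX (e_ R i)) (cur 1%g (bvec (FMonom s)) one).
    rewrite bvec_cons; apply: esym; apply: etrans (gX_mul _ _ _ _) _.
    apply: etrans (congr1 (fun z => _ + cur _ _ z) (derE1 _)) _.
    apply: etrans (congr1 (fun z => _ + z) (lin0 (lin_cura _ _))) _.
    apply: etrans (addr0 _) _; apply: eq_cur; [reflexivity| |reflexivity].
    exact: (congr1 (fun z => inT z * _) (etrans (congr1 (fun p => Ad p _) (invg1 _)) (Ad1 _))).
  exact: (PM _ _ (PX _) IH).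
have -> : cur p (bvec (FMonom s)) (bvec A) =
    mul (cur 1%g 1 (bvec A)) (mul (gP p) (cur 1%g (bvec (FMonom s)) one)).
  apply: esym; apply: etrans (congr1 (mul _) (gP_mul _ _ _ _)) _.
  have l1 := lin_actl br; have l2 := lin_actr br.
  rewrite -> cur_mulE; rewrite -> sw2_1 by bilin.
  apply: eq_cur; first exact: (etrans (mul1g _) (mulg1 _)).
    exact: (etrans (congr1 (fun z => z * _) (mapT1 _)) (mul1r _)).
  apply: etrans (congr1 (wedge _) _) (wedge1r _).
  exact: (etrans (mapE_Ad1 _) (etrans (act1 _ _) (mapE1 _))).
exact: (PM _ _ PA (PM _ _ (Pp _) Ps)).
Qed.

Lemma cur_one_mul x : mul (gP 1%g) x = x.
Proof.
move: x; apply: cur_all_ext => [||p v a]; [exact: lin_cur_mulr|exact: lin_id|].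
apply: etrans (gP_mul _ _ _ _) _.
by apply: eq_cur; [exact: mul1g|reflexivity|exact: mapE_Ad1].
Qed.

Lemma cur_mul_one x : mul x (gP 1%g) = x.
Proof.
move: x; apply: cur_all_ext => [||p v a]; [exact: lin_cur_mull|exact: lin_id|].
rewrite -> cur_mulE; apply: etrans _ (sw2_counitr v (lin_curv p a)).
apply: eq_sw2 => v1 v2; apply: etrans _ (linZ (lin_cura p v1) _ _).
apply: eq_cur; first exact: mulg1.
  apply: etrans (mulr1 _) _.
  exact: (etrans (congr1 (fun r => mapT (Ad r) v1) (invg1 _)) (mapT_Ad1 _)).
apply: etrans (congr1 (fun z => wedge a (mapE (Ad p) z)) (act_one br_l br_r _)) _.
apply: etrans (congr1 (fun z => wedge a z) (linZ (lin_mapE _) _ _)) _.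
apply: etrans (congr1 (fun z => wedge a (_ *: z)) (mapE1 _)) _.
apply: etrans (wedgeZr _ _ _) _.
exact: (congr1 (fun z => _ *: z) (wedge1r _)).
Qed.

Lemma cur_mulA : associative mul.
Proof.
move=> x; move: x; apply: cur_gen_ind => [k x x' Px Px'|x x' Px Px'|p|x|x] y z.
- rewrite (lin_cur_mull (mul y z) k x x') (lin_cur_mull y k x x').
  by rewrite (lin_cur_mull z k (mul x y) (mul x' y)) Px Px'.
- apply: etrans (esym (Px _ _)) _.
  apply: etrans (congr1 (mul x) (Px' _ _)) _.
  apply: etrans (Px _ _) _.
  exact: (congr1 (fun t => mul t z) (Px _ _)).
- have l y1 : lin (fun z1 => mul (gP p) (mul y1 z1)).
    exact: (lin_comp (lin_cur_mulr _) (lin_cur_mulr _)).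
  have l' z1 : lin (fun y1 => mul (gP p) (mul y1 z1)).
    exact: (lin_comp (lin_cur_mulr _) (lin_cur_mull _)).
  move: y; apply: cur_all_ext => [||q w b]; [exact: l'| |].
    exact: (lin_comp (lin_cur_mull z) (lin_cur_mulr _)).
  move: z; apply: cur_all_ext => [||r u d]; [exact: l|exact: lin_cur_mulr|].
  rewrite -> gP_mul, !cur_mulE.
  apply: etrans (sw2_lin _ _ (lin_cur_mulr _)) _; apply: eq_sw2 => w1 w2.
  apply: etrans (gP_mul _ _ _ _) _; apply: eq_cur; [exact: mulgA|reflexivity|].
  apply: etrans (mapEM (lin_Ad p) _ _) _.
  exact: (congr1 (wedge _) (mapE_Ad _ _ _)).
- have l y1 : lin (fun z1 => mul (gX x) (mul y1 z1)).
    exact: (lin_comp (lin_cur_mulr _) (lin_cur_mulr _)).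
  have l' z1 : lin (fun y1 => mul (gX x) (mul y1 z1)).
    exact: (lin_comp (lin_cur_mulr _) (lin_cur_mull _)).
  move: y; apply: cur_all_ext => [||q w b]; [exact: l'| |].
    exact: (lin_comp (lin_cur_mull z) (lin_cur_mulr _)).
  move: z; apply: cur_all_ext => [||r u d]; [exact: l|exact: lin_cur_mulr|].
  rewrite -> gX_mul.
  apply: etrans (congr1 (mul _) (cur_mulE _ _ _ _ _ _)) _.
  apply: esym; apply: etrans (linD (lin_cur_mull _) _ _) _.
  apply: etrans (congrD (cur_mulE _ _ _ _ _ _) (cur_mulE _ _ _ _ _ _)) _.
  have l1 := lin_actl br; have l2 := lin_actr br.
  rewrite -> sw2_cons by bilin; apply: etrans (esym (sw2D _ _ _)) _.
  apply: esym; apply: etrans (sw2_lin _ _ (lin_cur_mulr _)) _; apply: eq_sw2 => w1 w2.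
  apply: etrans (gX_mul _ _ _ _) _.
  (* By the Leibniz rule together with [x, Ad_q d] = Ad_q [Ad_q^-1 x, d]; this is where invariance
     of the bracket under Ad enters associativity. *)
  have -> : derE (br x) (wedge b (mapE (Ad q) (act w2 d))) =
      wedge b (mapE (Ad q) (act (inT (Ad q^-1%g x) * w2) d)) +
      wedge (derE (br x) b) (mapE (Ad q) (act w2 d)).
    apply: etrans (derEM (br_r x) _ _) _; apply: etrans (addrC _ _) _.
    apply: congrD; last reflexivity; apply: (congr1 (wedge b)); apply: esym.
    apply: etrans (congr1 (mapE _) (act_cons br_l br_r _ _ _)) _.
    apply: etrans (mapE_derE (f' := br x) _ (lin_Ad q) (br_r _) (br_r _) _) _.
      by move=> y; rewrite Ad_br AdVK.
    reflexivity.
  apply: etrans (congr1 (fun z => _ + z) (linD (lin_cura _ _) _ _)) _.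
  apply: etrans (addrA _ _ _) _; apply: congrD; last reflexivity.
  apply: congrD; last reflexivity; apply: eq_cur; [reflexivity| |reflexivity].
  apply: etrans (mulrA _ _ _) _; apply: (congr1 (fun z => z * u)).
  apply: esym; apply: etrans (mapT_cons (lin_Ad _) _ _) _.
  apply: (congr1 (fun z => inT z * _)); apply: etrans (esym (AdM _ _ _)) _.
  exact: (congr1 (fun s => Ad s x) (esym (invgM _ _))).
- have l y1 : lin (fun z1 => mul (gV x) (mul y1 z1)).
    exact: (lin_comp (lin_cur_mulr _) (lin_cur_mulr _)).
  have l' z1 : lin (fun y1 => mul (gV x) (mul y1 z1)).
    exact: (lin_comp (lin_cur_mulr _) (lin_cur_mull _)).
  move: y; apply: cur_all_ext => [||q w b]; [exact: l'| |].
    exact: (lin_comp (lin_cur_mull z) (lin_cur_mulr _)).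
  move: z; apply: cur_all_ext => [||r u d]; [exact: l|exact: lin_cur_mulr|].
  rewrite -> gV_mul, !cur_mulE.
  apply: etrans (sw2_lin _ _ (lin_cur_mulr _)) _; apply: eq_sw2 => w1 w2.
  apply: etrans (gV_mul _ _ _ _) _; apply: eq_cur; [reflexivity|reflexivity|].
  exact: wedgeA.
Qed.

(** * Degree and filtration of a product *)

Definition cur_supp (k r : nat) (x : H) : Prop :=
  supp_in (fun b : cur_idx G => #|b.2.2| = k /\ (fdeg b.2.1 <= r)%N) x.

Lemma supp_cur k (r : nat) p v a : filtT r v -> degE k a -> cur_supp k r (cur p v a).
Proof.
move=> hv ha; have -> : cur p v a =
    lext (fun u : fmonom 'I_n => lext (fun A : {set 'I_n} => bvec (p, (u, A)) : H) a) v.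
  move: v {hv}; apply: lin_ext => [||w]; [exact: lin_curv|exact: lin_lext|].
  rewrite -> lext_bvec.
  move: a {ha}; apply: lin_ext => [||A]; [exact: lin_cura|exact: lin_lext|].
  by rewrite -> lext_bvec; exact: cur_bvec.
apply: (supp_in_lext _ hv) => w hw; apply: (supp_in_lext _ ha) => A hA.
exact: supp_in_bvec.
Qed.

Lemma supp_sw2 (N : choiceType) (Q : N -> Prop) (F : T -> T -> malg N R) (w : fmonom 'I_n) :
  (forall w1 w2 : fmonom 'I_n, (fdeg w1 + fdeg w2 = fdeg w)%N -> supp_in Q (F (bvec w1) (bvec w2))) ->
  supp_in Q (sw2 F (bvec w)).
Proof.
move=> hF; have -> : sw2 F (bvec w) = tlift F (DeltaT (bvec w)) by exact: erefl.
by apply: (supp_in_tlift _ (@DeltaT_supp R n w)) => w1 w2 /= e; apply: hF.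
Qed.

Lemma supp_swE (N : choiceType) (Q : N -> Prop) (F : E -> E -> malg N R)
    (A : {set 'I_n}) :
  (forall A1 A2 : {set 'I_n}, (#|A1| + #|A2| = #|A|)%N ->
     supp_in Q (F (bvec A1) (bvec A2))) ->
  supp_in Q (swE F (bvec A)).
Proof.
move=> hF; have -> : swE F (bvec A) = tlift F (DeltaE (bvec A)) by exact: erefl.
by apply: (supp_in_tlift _ (@DeltaE_supp R n A)) => w1 w2 /= e; apply: hF.
Qed.

Lemma supp_in_lin1 (K N : choiceType) (P : K -> Prop) (Q : N -> Prop)
    (f : malg K R -> malg N R) : lin f ->
  (forall k, P k -> supp_in Q (f (bvec k))) -> forall x, supp_in P x -> supp_in Q (f x).
Proof.
move=> hf fP x hx; rewrite [x]malg_expand (lin_bigsum _ _ _ hf) big_seq.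
by apply: supp_in_sum => k /hx hk; rewrite (linZ hf); apply: supp_inZ; apply: fP.
Qed.

Lemma cur_mul_bvec_supp p (w : fmonom 'I_n) (A : {set 'I_n}) q
    (u : fmonom 'I_n) (B : {set 'I_n}) :
  cur_supp (#|A| + #|B|) (fdeg w + fdeg u)
    (mul (cur p (bvec w) (bvec A)) (cur q (bvec u) (bvec B))).
Proof.
rewrite -> cur_mulE; apply: supp_sw2 => w1 w2 hw; apply: supp_cur.
  have h := filtT_mul (filtT_mapT (lin_Ad q^-1%g) (@filtT_bvec R n w1))
    (@filtT_bvec R n u).
  apply: sub_supp_in h.
  (* The second Sweedler factor acts on forms and leaves the tensor component, so only the length of
     [w1], at most that of [w], is counted. *)
  move=> z hz; apply: leq_trans hz _; rewrite leq_add2r -hw; exact: leq_addr.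
apply: degE_wedge; first exact: degE_bvec.
apply: degE_mapE; first exact: lin_Ad.
by apply: degE_act => //; apply: degE_bvec.
Qed.

Lemma cur_mul_supp i j s t x y :
  cur_supp i s x -> cur_supp j t y -> cur_supp (i + j) (s + t) (mul x y).
Proof.
move=> hx hy; move: x hx.
apply: (supp_in_lin1 (lin_cur_mull y)) => -[p [w A]] /= [<- hw].
move: y hy; apply: (supp_in_lin1 (lin_cur_mulr _)) => -[q [u B]] /= [<- hu].
rewrite -!cur_bvec; apply: sub_supp_in (@cur_mul_bvec_supp p w A q u B).
move=> b [-> hb]; split=> //; apply: leq_trans hb _; exact: leq_add.
Qed.

Lemma cur_mul_homog i j x y : homog (@cur_deg R n G) i x ->
  homog (@cur_deg R n G) j y -> homog (@cur_deg R n G) (i + j) (mul x y).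
Proof.
move=> hx hy; refine (supp_in_lin1 (P := fun z : cur_idx G => cur_deg z = i)
  (Q := fun z : cur_idx G => cur_deg z = (i + j)%N) (lin_cur_mull y) _ hx) => -[p [w A]] /= <-.
refine (supp_in_lin1 (P := fun z : cur_idx G => cur_deg z = j)
  (Q := fun z : cur_idx G => cur_deg z = (_ + j)%N) (lin_cur_mulr _) _ hy) => -[q [u B]] /= <-.
rewrite -!cur_bvec; apply: sub_supp_in (@cur_mul_bvec_supp p w A q u B).
by move=> b [].
Qed.

(** * Multiplicativity of the coproduct *)

Local Notation cdeg := (@cur_deg R n G).
Local Notation gsg := (@gsign R (cur_idx G) cdeg).
Local Notation kz := (koszul_mul cdeg mul).

Lemma lin_gsign : lin gsg.
Proof. exact: lin_lext. Qed.

Lemma gsign_cur p v a : gsg (cur p v a) = cur p v (antipodeE a).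
Proof.
move: v; apply: lin_ext => [||w].
- exact: (lin_comp lin_gsign (lin_curv _ _)).
- exact: lin_curv.
move: a; apply: lin_ext => [||A].
- exact: (lin_comp lin_gsign (lin_cura _ _)).
- exact: (lin_comp (lin_cura _ _) (@lin_antipodeE R n)).
rewrite (antipodeE_homog (@homE_bvec R n A)) cur_bvec.
apply: etrans _ (esym (linZ (lin_cura _ _) _ _)); rewrite cur_bvec.
by rewrite /gsign; rewrite -> lext_bvec.
Qed.

Lemma gsignK x : gsg (gsg x) = x.
Proof.
move: x; apply: cur_all_ext => [||p v a].
- exact: (lin_comp lin_gsign lin_gsign).
- exact: lin_id.
by rewrite -> !gsign_cur, antipodeEK.
Qed.

Let mul_bilin : bilin mul.
Proof. by split=> y; [exact: lin_cur_mulr|exact: lin_cur_mull]. Qed.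

Let lkr t : lin (kz t). Proof. exact: lin_koszulr. Qed.

Lemma homog_cur k (r : nat) p v a : filtT r v -> degE k a -> homog cdeg k (cur p v a).
Proof. by move=> hv ha z /(supp_cur hv ha) []. Qed.

Lemma homog_gP p : homog cdeg 0 (gP p).
Proof. exact: (homog_cur (@filtT1 R n) (@degE_one R n)). Qed.

Lemma homog_gX x : homog cdeg 0 (gX x).
Proof. exact: (homog_cur (@filtT_inT R n x) (@degE_one R n)). Qed.

Lemma homog_gV x : homog cdeg 1 (gV x).
Proof. exact: (homog_cur (@filtT1 R n) (@degE_vE R n x)). Qed.

Lemma kz_deg0 s t y1 y2 : homog cdeg 0 t ->
  kz (s ⊗ t) (y1 ⊗ y2) = mul s y1 ⊗ mul t y2.
Proof.
move=> ht; move: y1; apply: lin_ext => [||z].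
- exact: (lin_comp (lkr _) (lin_tensl _)).
- exact: (lin_comp (lin_tensl _) (lin_cur_mulr _)).
apply: etrans (koszul_tens mul_bilin _ _ ht (@homog_bvec R (cur_idx G) cdeg z)) _.
by rewrite mul0n scale1r.
Qed.

Lemma kz_deg1 s t y1 y2 : homog cdeg 1 t ->
  kz (s ⊗ t) (y1 ⊗ y2) = mul s (gsg y1) ⊗ mul t y2.
Proof.
move=> ht; move: y1; apply: lin_ext => [||z].
- exact: (lin_comp (lkr _) (lin_tensl _)).
- exact: (lin_comp (lin_tensl _) (lin_comp (lin_cur_mulr _) lin_gsign)).
apply: etrans (koszul_tens mul_bilin _ _ ht (@homog_bvec R (cur_idx G) cdeg z)) _.
rewrite mul1n; apply: esym.
have -> : gsg (bvec z) = (-1) ^+ cdeg z *: bvec z.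
  by rewrite /gsign; rewrite -> lext_bvec.
apply: etrans (congr1 (fun u => u ⊗ _) (linZ (lin_cur_mulr _) _ _)) _.
exact: tensZl.
Qed.

(** [DX] and [DV] are the coproducts of X and V. Multiplying by them on the left acts as a
    derivation for X, and with a Koszul sign on the first factor for V. *)
Definition DX x : HH := gX x ⊗ gP 1%g + gP 1%g ⊗ gX x.
Definition DV x : HH := gV x ⊗ gP 1%g + gP 1%g ⊗ gV x.

Lemma kz_DX x y1 y2 :
  kz (DX x) (y1 ⊗ y2) = mul (gX x) y1 ⊗ y2 + y1 ⊗ mul (gX x) y2.
Proof.
apply: etrans (koszulDl _ _ _ _ _) _; apply: congrD.
  apply: etrans (kz_deg0 _ _ _ (@homog_gP _)) _.
  exact: (congr1 (fun u => _ ⊗ u) (cur_one_mul _)).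
apply: etrans (kz_deg0 _ _ _ (@homog_gX _)) _.
exact: (congr1 (fun u => u ⊗ _) (cur_one_mul _)).
Qed.

Lemma kz_DV x y1 y2 :
  kz (DV x) (y1 ⊗ y2) = mul (gV x) y1 ⊗ y2 + gsg y1 ⊗ mul (gV x) y2.
Proof.
apply: etrans (koszulDl _ _ _ _ _) _; apply: congrD.
  apply: etrans (kz_deg0 _ _ _ (@homog_gP _)) _.
  exact: (congr1 (fun u => _ ⊗ u) (cur_one_mul _)).
apply: etrans (kz_deg1 _ _ _ (@homog_gV _)) _.
exact: (congr1 (fun u => u ⊗ _) (cur_one_mul _)).
Qed.

Lemma Delta_gP p : cur_Delta (gP p) = gP p ⊗ gP p.
Proof.
rewrite -> cur_DeltaE; rewrite -> sw2_1 by bilin.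
by apply: swE1; bilin.
Qed.

Lemma Delta_gX x : cur_Delta (gX x) = DX x.
Proof.
rewrite -> cur_DeltaE; rewrite -> sw2_inT by bilin.
by apply: congrD; apply: swE1; bilin.
Qed.

Lemma swE_vE (M : lmodType R) (F : E -> E -> M) x : bilin F ->
  swE F (vE x) = F (vE x) one + F one (vE x).
Proof.
move=> hF; have [F1 F2] := hF.
apply: etrans (congr1 (swE F) (esym (wedge1r _))) _.
apply: etrans (swE_cons _ _ hF) _.
rewrite -> swE1 by bilin.
apply: congrD; first exact: (congr1 (fun z => F z _) (wedge1r _)).
exact: (congr2 F (antipodeE1 _ _) (wedge1r _)).
Qed.

Lemma Delta_gV x : cur_Delta (gV x) = DV x.
Proof.
rewrite -> cur_DeltaE; rewrite -> sw2_1 by bilin.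
by apply: swE_vE; bilin.
Qed.

(** On generators the identity says that Ad_p respects the coproduct of forms ([swE_mapE]), that the
    derivation [x, -] is also a coderivation ([swE_derE]), and that V obeys the recursion of the
    coproduct ([swE_cons]). *)
Lemma cur_DeltaM x y : cur_Delta (mul x y) = kz (cur_Delta x) (cur_Delta y).
Proof.
have lD : lin (@cur_Delta R n G) by exact: lin_cur_Delta.
have kzA := koszulA mul_bilin cur_mulA cur_mul_homog.
have lkl t : lin (fun s => kz s t) by apply: lin_koszull.
move: x y; apply: cur_gen_ind => [k x x' Px Px'|x x' Px Px'|p|x|x] y.
- rewrite (lin_cur_mull y k x x') (lD k (mul x y) (mul x' y)) Px Px' (lD k x x').
  exact: esym (lkl _ _ _ _).
- apply: etrans (congr1 (@cur_Delta R n G) (esym (cur_mulA _ _ _))) _.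
  apply: etrans (Px _) _; apply: etrans (congr1 (kz _) (Px' _)) _.
  apply: etrans (kzA _ _ _) _; exact: (congr1 (fun z => kz z _) (esym (Px _))).
- move: y; apply: cur_all_ext => [||q w b].
  + exact: (lin_comp lD (lin_cur_mulr _)).
  + exact: (lin_comp (lkr _) lD).
  rewrite -> gP_mul, Delta_gP, !cur_DeltaE.
  apply: esym; apply: etrans (sw2_lin _ _ (lkr _)) _; apply: eq_sw2 => w1 w2.
  apply: etrans (swE_lin _ _ (lkr _)) _.
  apply: esym; rewrite -> (swE_mapE _ (lin_Ad p)) by bilin.
  apply: eq_swE => b1 b2; apply: esym.
  apply: etrans (kz_deg0 _ _ _ (@homog_gP _)) _.
  exact: (congr2 (fun s t => s ⊗ t) (gP_mul _ _ _ _) (gP_mul _ _ _ _)).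
- move: y; apply: cur_all_ext => [||q w b].
  + exact: (lin_comp lD (lin_cur_mulr _)).
  + exact: (lin_comp (lkr _) lD).
  apply: etrans (congr1 (@cur_Delta R n G) (gX_mul _ _ _ _)) _.
  apply: etrans (linD lD _ _) _; rewrite -> Delta_gX, !cur_DeltaE.
  rewrite -> sw2_cons by bilin; apply: etrans (esym (sw2D _ _ _)) _.
  apply: esym; apply: etrans (sw2_lin _ _ (lkr _)) _; apply: eq_sw2 => w1 w2.
  apply: etrans (swE_lin _ _ (lkr _)) _; apply: esym.
  apply: etrans (congrD (esym (swED _ _ _)) (swE_derE _ (br_r _) _)) _; first by bilin.
  apply: etrans (esym (swED _ _ _)) _.
  apply: eq_swE => b1 b2; apply: esym.
  apply: etrans (kz_DX _ _ _) _.
  apply: etrans (congr2 (fun s t => s ⊗ _ + _ ⊗ t) (gX_mul _ _ _ _) (gX_mul _ _ _ _)) _.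
  apply: etrans (congrD (tensDl _ _ _) (tensDr _ _ _)) _; exact: addrACA.
- move: y; apply: cur_all_ext => [||q w b].
  + exact: (lin_comp lD (lin_cur_mulr _)).
  + exact: (lin_comp (lkr _) lD).
  apply: etrans (congr1 (@cur_Delta R n G) (gV_mul _ _ _ _)) _.
  rewrite -> Delta_gV, !cur_DeltaE.
  apply: esym; apply: etrans (sw2_lin _ _ (lkr _)) _; apply: eq_sw2 => w1 w2.
  apply: etrans (swE_lin _ _ (lkr _)) _; apply: esym.
  apply: etrans (swE_cons _ _ _) _; first by bilin.
  apply: eq_swE => b1 b2; apply: esym.
  apply: etrans (kz_DV _ _ _) _.
  apply: etrans (congr2 (fun s t => s ⊗ _ + _ ⊗ t) (gV_mul _ _ _ _) (gV_mul _ _ _ _)) _.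
  exact: (congr1 (fun z => _ + z ⊗ _) (gsign_cur _ _ _)).
Qed.

(** * Coassociativity and counit *)

Lemma sw2_swE_exch (M : lmodType R) (F : E -> E -> T -> T -> M) v a :
  swE (fun a1 a2 => sw2 (F a1 a2) v) a =
  sw2 (fun v1 v2 => swE (fun a1 a2 => F a1 a2 v1 v2) a) v.
Proof.
have -> : swE (fun a1 a2 => sw2 (F a1 a2) v) a =
  tlift (fun a1 a2 => tlift (F a1 a2) (DeltaT v)) (DeltaE a) by exact: erefl.
have -> : sw2 (fun v1 v2 => swE (fun a1 a2 => F a1 a2 v1 v2) a) v =
  tlift (fun v1 v2 => tlift (fun a1 a2 => F a1 a2 v1 v2) (DeltaE a)) (DeltaT v)
  by exact: erefl.
move: (DeltaT v); apply: lin_ext => [||[w1 w2]]; [by lin|by lin|].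
apply: etrans _ (esym (tlift_bvec _ _ _)); apply: eq_tlift' => a1 a2.
exact: tlift_bvec.
Qed.

Let lD : lin (@cur_Delta R n G). Proof. exact: lin_cur_Delta. Qed.

Lemma tlift_Delta (M : lmodType R) (F : H -> H -> M) p v a : bilin F ->
  tlift F (cur_Delta (cur p v a)) =
  sw2 (fun v1 v2 => swE (fun a1 a2 => F (cur p v1 a1) (cur p v2 a2)) a) v.
Proof.
move=> hF; rewrite -> cur_DeltaE.
apply: etrans (sw2_lin _ _ (lin_tlift F)) _; apply: eq_sw2 => v1 v2.
apply: etrans (swE_lin _ _ (lin_tlift F)) _; apply: eq_swE => a1 a2.
exact: (tlift_tens hF).
Qed.

Lemma cur_coassoc x :
  tassoc (tlift (fun x1 x2 : H => cur_Delta x1 ⊗ x2) (cur_Delta x)) =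
  tlift (fun x1 x2 : H => x1 ⊗ cur_Delta x2) (cur_Delta x).
Proof.
move: x; apply: cur_all_ext => [||p v a].
- exact: (lin_comp (@lin_tassoc R _ _ _) (lin_comp (lin_tlift _) lD)).
- exact: (lin_comp (lin_tlift _) lD).
have b1 : bilin (fun x1 x2 : H => cur_Delta x1 ⊗ x2).
  split=> y; [exact: lin_tensr|exact: (lin_comp (lin_tensl _) lD)].
have b2 : bilin (fun x1 x2 : H => x1 ⊗ cur_Delta x2).
  split=> y; [exact: (lin_comp (lin_tensr _) lD)|exact: lin_tensl].
rewrite (tlift_Delta _ _ _ b1) (tlift_Delta _ _ _ b2).
pose Q v1 a1 v2 a2 v3 a3 : malg (cur_idx G * (cur_idx G * cur_idx G))%type R :=
  cur p v1 a1 ⊗ (cur p v2 a2 ⊗ cur p v3 a3).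
(* The sums over tensors are gathered outside those over forms, so that coassociativity of the two
   factors can be applied separately. *)
transitivity (sw2 (fun v1 v2 => sw2 (fun v11 v12 => swE (fun a1 a2 =>
    swE (fun a11 a12 => Q v11 a11 v12 a12 v2 a2) a1) a) v1) v).
  apply: etrans (sw2_lin _ _ (@lin_tassoc R _ _ _)) _; apply: eq_sw2 => v1 v2.
  apply: etrans (swE_lin _ _ (@lin_tassoc R _ _ _)) _.
  apply: etrans _ (sw2_swE_exch _ _ _); apply: eq_swE => a1 a2.
  rewrite -> cur_DeltaE.
  apply: etrans (congr1 (@tassoc _ _ _ _) (sw2_lin _ _ (lin_tensl _))) _.
  apply: etrans (sw2_lin _ _ (@lin_tassoc R _ _ _)) _; apply: eq_sw2 => v11 v12.
  apply: etrans (congr1 (@tassoc _ _ _ _) (swE_lin _ _ (lin_tensl _))) _.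
  apply: etrans (swE_lin _ _ (@lin_tassoc R _ _ _)) _; apply: eq_swE => a11 a12.
  rewrite /Q; move: (cur p v11 a11) (cur p v12 a12) (cur p v2 a2) => h1 h2 h3.
  move: h1; apply: lin_ext => [||k1]; [by lin|by lin|].
  move: h2; apply: lin_ext => [||k2]; [by lin|by lin|].
  move: h3; apply: lin_ext => [||k3]; [by lin|by lin|].
  rewrite -> !tens_bvec; rewrite /tassoc; exact: lext_bvec.
transitivity (sw2 (fun v1 v2 => sw2 (fun v11 v12 => swE (fun a1 a2 =>
    swE (fun a11 a12 => Q v1 a1 v11 a11 v12 a12) a2) a) v2) v).
  apply: etrans (sw2_coassoc (F := fun v11 v12 v2 => swE (fun a1 a2 =>
    swE (fun a11 a12 => Q v11 a11 v12 a12 v2 a2) a1) a) _ _) _.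
    by rewrite /Q; split=> *; lin.
  apply: eq_sw2 => v1 v2; apply: eq_sw2 => v11 v12.
  apply: (swE_coassoc (F := fun a11 a12 a2 => Q v1 a11 v11 a12 v12 a2)).
  by rewrite /Q; split=> *; lin.
apply: eq_sw2 => v1 v2; apply: etrans (esym (sw2_swE_exch _ _ _)) _.
apply: eq_swE => a1 a2; apply: esym; rewrite -> cur_DeltaE.
apply: etrans (sw2_lin _ _ (lin_tensr _)) _; apply: eq_sw2 => v11 v12.
exact: (swE_lin _ _ (lin_tensr _)).
Qed.

Let leps : lin (@cur_eps R n G : H -> R^o). Proof. exact: lin_cur_eps. Qed.

Lemma cur_counitl x : tlift (fun x1 x2 : H => cur_eps x1 *: x2) (cur_Delta x) = x.
Proof.
move: x; apply: cur_all_ext => [||p v a].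
- exact: (lin_comp (lin_tlift _) lD).
- exact: lin_id.
have b1 : bilin (fun x1 x2 : H => cur_eps x1 *: x2).
  split=> y; [exact: (lin_scale _ (@lin_id _ _))|exact: (lin_scalel _ leps)].
rewrite (tlift_Delta _ _ _ b1).
apply: etrans _ (sw2_counitl v (lin_curv p a)); apply: eq_sw2 => v1 v2.
apply: etrans _ (congr1 (fun z => _ *: z) (swE_counitl a (lin_cura p v2))).
apply: etrans _ (esym (swE_lin _ _ (lin_scale _ (@lin_id _ _)))).
apply: eq_swE => a1 a2; rewrite cur_epsE; exact: esym (scalerA _ _ _).
Qed.

Lemma cur_counitr x : tlift (fun x1 x2 : H => cur_eps x2 *: x1) (cur_Delta x) = x.
Proof.
move: x; apply: cur_all_ext => [||p v a].
- exact: (lin_comp (lin_tlift _) lD).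
- exact: lin_id.
have b1 : bilin (fun x1 x2 : H => cur_eps x2 *: x1).
  split=> y; [exact: (lin_scalel _ leps)|exact: (lin_scale _ (@lin_id _ _))].
rewrite (tlift_Delta _ _ _ b1).
apply: etrans _ (sw2_counitr v (lin_curv p a)); apply: eq_sw2 => v1 v2.
apply: etrans _ (congr1 (fun z => _ *: z) (swE_counitr a (lin_cura p v1))).
apply: etrans _ (esym (swE_lin _ _ (lin_scale _ (@lin_id _ _)))).
apply: eq_swE => a1 a2; rewrite cur_epsE; exact: esym (scalerA _ _ _).
Qed.

Lemma cur_epsM x y : cur_eps (mul x y) = cur_eps x * cur_eps y.
Proof.
move: x; apply: (cur_all_ext (M := R^o)) => [||p v a].
- exact: (lin_comp leps (lin_cur_mull y)).
- by move=> k s t; rewrite (leps k s t) mulrDl; congr (_ + _); exact: esym (mulrA _ _ _).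
move: y; apply: (cur_all_ext (M := R^o)) => [||q w b].
- exact: (lin_comp leps (lin_cur_mulr _)).
- by move=> k s t; rewrite (leps k s t) mulrDr; congr (_ + _); exact: mulrCA.
rewrite -> cur_mulE; apply: etrans (sw2_lin _ _ leps) _.
rewrite -> !cur_epsE.
have hl : lin (fun u : T => epsT u * (epsT w * (epsE a * epsE b)) : R^o).
  by move=> k s t; rewrite (@lin_epsT R n k s t) mulrDl; congr (_ + _); exact: esym (mulrA _ _ _).
apply: etrans (etrans (eq_sw2 _ _) (sw2_counitr v hl)) _ => [v1 v2|].
  rewrite cur_epsE; rewrite -> epsTM, epsE_wedge, (epsE_mapE _ (lin_Ad _)), (epsE_act br_l br_r).
  rewrite -> (epsT_map (lin_Ad _)).
  rewrite [RHS]/GRing.scale /=; move: (epsT v1) (epsT v2) (epsT w) (epsE a) (epsE b).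
  move=> e1 e2 e3 e4 e5; rewrite -!mulrA; apply: etrans _ (mulrCA _ _ _).
  by rewrite (mulrCA e4) (mulrCA e3) .
move: (epsT v) (epsT w) (epsE a) (epsE b) => e1 e2 e3 e4.
by rewrite -!mulrA (mulrCA e2).
Qed.

(** * The antipode axioms *)

Lemma sw2_exch (M : lmodType R) (F : T -> T -> T -> T -> M) v w :
  sw2 (fun v1 v2 => sw2 (F v1 v2) w) v =
  sw2 (fun w1 w2 => sw2 (fun v1 v2 => F v1 v2 w1 w2) v) w.
Proof.
have -> : sw2 (fun v1 v2 => sw2 (F v1 v2) w) v =
  tlift (fun v1 v2 => tlift (F v1 v2) (DeltaT w)) (DeltaT v) by exact: erefl.
have -> : sw2 (fun w1 w2 => sw2 (fun v1 v2 => F v1 v2 w1 w2) v) w =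
  tlift (fun w1 w2 => tlift (fun v1 v2 => F v1 v2 w1 w2) (DeltaT v)) (DeltaT w)
  by exact: erefl.
move: (DeltaT w); apply: lin_ext => [||[w1 w2]]; [by lin|by lin|].
apply: etrans _ (esym (tlift_bvec _ _ _)); apply: eq_tlift' => v1 v2.
exact: tlift_bvec.
Qed.

(** Both sides sum over the fourfold coproduct of v and differ by exchanging its two middle factors,
    which cocommutativity permits. The exchange pairs [m1] with [s] and [m2] with [t], ready for the
    antipode axiom of T. *)
Lemma sw2_mid (M : lmodType R) (F : T -> T -> T -> T -> M) v :
  (forall u2 u3 u4, lin (fun u => F u u2 u3 u4)) ->
  (forall u1 u3 u4, lin (fun u => F u1 u u3 u4)) ->
  (forall u1 u2 u4, lin (fun u => F u1 u2 u u4)) ->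
  (forall u1 u2 u3, lin (F u1 u2 u3)) ->
  sw2 (fun x y => sw2 (fun s t => sw2 (fun m1 m2 => F m1 m2 s t) x) y) v =
  sw2 (fun x y => sw2 (fun m1 s => sw2 (fun m2 t => F m1 m2 s t) y) x) v.
Proof.
move=> F1 F2 F3 F4.
transitivity (sw2 (fun x y => sw2 (fun m1 m2 => sw2 (fun s t => F m1 m2 s t) y) x) v).
  by apply: eq_sw2 => x y; apply: sw2_exch.
apply: etrans (sw2_coassoc (F := fun m1 m2 y => sw2 (fun s t => F m1 m2 s t) y) _ _) _.
  by split=> *; lin.
apply: esym; apply: etrans (sw2_coassoc (F := fun m1 s y => sw2 (fun m2 t => F m1 m2 s t) y) _ _) _.
  by split=> *; lin.
apply: eq_sw2 => m1 z.
apply: etrans (esym (sw2_coassoc (F := fun s m2 t => F m1 m2 s t) _ _)) _.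
  by split=> *; lin.
apply: etrans _ (sw2_coassoc (F := fun m2 s t => F m1 m2 s t) _ _); last by split=> *; lin.
by apply: eq_sw2 => y t; apply: sw2C; bilin.
Qed.

Lemma epsT_antipode v : epsT (antipodeT v) = epsT v.
Proof.
move: v; apply: (T_ext (M := R^o)) => [|||i v _]; [by lin|by lin| |].
  by rewrite -> antipodeT1.
rewrite -> antipodeT_cons, epsT_cons.
apply: etrans (linN (@lin_epsT R n) _) _.
apply: etrans (congr1 (fun z : R => - z) (epsTM _ _)) _.
have e0 : epsT (inT (e_ R i)) = 0.
  by apply: etrans (congr1 (@epsT R n) (esym (mulr1 _))) (epsT_cons _ _).
by rewrite e0 mulr0 oppr0.
Qed.

Lemma cur_antipode_r x :
  tlift (fun x1 x2 : H => mul x1 (cur_antipode c x2)) (cur_Delta x) =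
  cur_eps x *: gP 1%g.
Proof.
have lS : lin (cur_antipode c) by exact: lin_cur_antipode.
have l1 := lin_actl br; have l2 := lin_actr br.
move: x; apply: cur_all_ext => [||p v a].
- exact: (lin_comp (lin_tlift _) lD).
- exact: (lin_scalel _ leps).
rewrite tlift_Delta; last first.
  by split=> y; [exact: (lin_comp (lin_cur_mulr _) lS)|exact: lin_cur_mull].
apply: etrans (esym (sw2_swE_exch _ _ _)) _.
transitivity (swE (fun a1 a2 => epsT v *: cur 1%g 1 (wedge a1 (antipodeE a2)) : H) a); last first.
  have hl : lin (fun b : E => epsT v *: cur 1%g 1 b : H) by lin.
  apply: etrans (esym (swE_lin _ _ hl)) _.
  apply: etrans (congr1 (fun z => _ *: cur _ _ z) (antipodeE_r a)) _.
  apply: etrans (congr1 (fun z => _ *: z) (linZ (lin_cura _ _) _ _)) _.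
  rewrite -> cur_epsE; exact: scalerA.
apply: eq_swE => a1 a2.
(* In (p, v1 ⊗ a1) * S(p, v2 ⊗ a2) the product splits v1 into [m1], [m2] and the antipode splits v2
   into [s], [t]. *)
pose F m1 m2 s t : H := cur 1%g (mapT (Ad p) (m1 * antipodeT s))
  (wedge a1 (mapE (Ad p) (act (m2 * antipodeT t) (mapE (Ad p^-1%g) (antipodeE a2))))).
transitivity (sw2 (fun x y => sw2 (fun s t => sw2 (fun m1 m2 => F m1 m2 s t) x) y) v).
  apply: eq_sw2 => v1 v2; rewrite -> cur_antipodeE.
  apply: etrans (sw2_lin _ _ (lin_cur_mulr _)) _; apply: eq_sw2 => s t.
  apply: etrans (cur_mulE _ _ _ _ _ _) _; apply: eq_sw2 => m1 m2.
  apply: eq_cur; first exact: mulgV.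
    apply: etrans _ (esym (mapTM (lin_Ad p) _ _)).
    exact: (congr1 (fun r => mapT (Ad r) m1 * _) (invgK _)).
  apply: (congr1 (fun z => wedge a1 (mapE (Ad p) z))).
  exact: esym (actM br_l br_r _ _ _).
apply: etrans (sw2_mid _ _ _ _ _) _; rewrite /F.
- by move=> *; lin.
- by move=> *; lin.
- by move=> *; lin.
- by move=> *; lin.
pose C : H := cur 1%g 1 (wedge a1 (antipodeE a2)).
have hl : lin (fun y : T => epsT y *: C) by lin.
apply: etrans _ (sw2_counitl v hl); apply: eq_sw2 => x y.
transitivity (@cur R n G 1%g (mapT (Ad p) (epsT x *: 1))
  (wedge a1 (mapE (Ad p) (act (epsT y *: 1) (mapE (Ad p^-1%g) (antipodeE a2)))))).
  pose Cx u u' : H := cur 1%g (mapT (Ad p) u)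
    (wedge a1 (mapE (Ad p) (act u' (mapE (Ad p^-1%g) (antipodeE a2))))).
  apply: etrans _ (congr2 Cx (antipodeT_r x) (antipodeT_r y)).
  have h1 u' : lin (fun u => Cx u u') by rewrite /Cx; lin.
  have h2 u : lin (Cx u) by rewrite /Cx; lin.
  apply: etrans _ (esym (sw2_lin _ _ (h1 _))); apply: eq_sw2 => m1 s.
  exact: esym (sw2_lin _ _ (h2 _)).
have -> : mapT (Ad p) (epsT x *: 1) = epsT x *: 1.
  exact: (etrans (linZ (lin_mapT _) _ _) (congr1 (fun z => _ *: z) (mapT1 _))).
have -> : wedge a1 (mapE (Ad p) (act (epsT y *: 1) (mapE (Ad p^-1%g) (antipodeE a2)))) =
    epsT y *: wedge a1 (antipodeE a2).
  apply: etrans _ (wedgeZr _ _ _); apply: (congr1 (wedge a1)).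
  apply: etrans (congr1 (mapE (Ad p)) (linZ (l1 _) _ _)) _.
  apply: etrans (linZ (lin_mapE _) _ _) _; apply: (congr1 (fun z => _ *: z)).
  apply: etrans (congr1 (mapE (Ad p)) (act1 _ _)) _.
  apply: etrans (mapE_Ad _ _ _) _.
  exact: (etrans (congr1 (fun r => mapE (Ad r) _) (mulgV _)) (mapE_Ad1 _)).
apply: etrans (linZ (lin_curv _ _) _ _) _; apply: (congr1 (fun z => _ *: z)).
exact: (linZ (lin_cura _ _)).
Qed.

Lemma cur_antipode_l x :
  tlift (fun x1 x2 : H => mul (cur_antipode c x1) x2) (cur_Delta x) =
  cur_eps x *: gP 1%g.
Proof.
have lS : lin (cur_antipode c) by exact: lin_cur_antipode.
have l1 := lin_actl br; have l2 := lin_actr br.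
move: x; apply: cur_all_ext => [||p v a].
- exact: (lin_comp (lin_tlift _) lD).
- exact: (lin_scalel _ leps).
rewrite tlift_Delta; last first.
  by split=> y; [exact: lin_cur_mulr|exact: (lin_comp (lin_cur_mull _) lS)].
apply: etrans (esym (sw2_swE_exch _ _ _)) _.
(* [L] is what remains once the two forms are merged into the single b = S(a1) ∧ a2, to which the
   antipode axiom of the exterior algebra applies. *)
pose L b : H := sw2 (fun v1 v2 => sw2 (fun s t => cur 1%g (antipodeT s * v2)
  (act (antipodeT t) (mapE (Ad p^-1%g) b))) v1) v.
have hL : lin L by rewrite /L; lin.
transitivity (swE (fun a1 a2 => L (wedge (antipodeE a1) a2)) a); last first.
  apply: etrans (esym (swE_lin _ _ hL)) _.
  apply: etrans (congr1 L (antipodeE_l a)) _.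
  apply: etrans (linZ hL _ _) _; rewrite -> cur_epsE; rewrite mulrC.
  apply: etrans _ (scalerA _ _ _); apply: (congr1 (fun z => _ *: z)); rewrite /L.
  have hl : lin (fun u : T => cur 1%g u one : H) by lin.
  apply: etrans _ (linZ hl _ _); apply: etrans _ (congr1 (fun u => @cur R n G 1%g u one) (antipodeT_l v)).
  apply: etrans _ (esym (sw2_lin _ _ hl)); apply: eq_sw2 => v1 v2.
  have hl2 : lin (fun u : T => cur 1%g (antipodeT u * v2) one : H) by lin.
  apply: etrans _ (sw2_counitr v1 hl2); apply: eq_sw2 => s t.
  apply: etrans _ (linZ (lin_cura _ _) _ _); apply: (congr1 (cur _ _)).
  apply: etrans (congr1 (act _) (mapE1 _)) _.
  apply: etrans (act_one br_l br_r _) _.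
  exact: (congr1 (fun z => z *: one) (epsT_antipode t)).
apply: eq_swE => a1 a2; apply: eq_sw2 => v1 v2; rewrite -> cur_antipodeE.
apply: etrans (sw2_lin _ _ (lin_cur_mull _)) _.
pose X := mapE (Ad p^-1%g) (antipodeE a1); pose Y := mapE (Ad p^-1%g) a2.
(* The product splits the tensor part of S(p, v1 ⊗ a1) into [s1] and [s2]. By coassociativity [s2]
   and [t] are then the halves of one factor, and their actions on Y and X combine into one action
   on X ∧ Y. *)
pose K s1 s2 t : H := cur 1%g (antipodeT s1 * v2)
  (wedge (act (antipodeT t) X) (act (antipodeT s2) Y)).
transitivity (sw2 (fun s t => sw2 (fun s1 s2 => K s1 s2 t) s) v1).
  apply: eq_sw2 => s t; apply: etrans (cur_mulE _ _ _ _ _ _) _.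
  rewrite -> (sw2_mapT (lin_Ad p)) by bilin; rewrite -> sw2_antipode by bilin.
  apply: eq_sw2 => s1 s2.
  have e u : mapT (Ad p^-1%g) (mapT (Ad p) u) = u.
    apply: etrans (mapT_Ad _ _ _) _.
    exact: (etrans (congr1 (fun r => mapT (Ad r) _) (mulVg _)) (mapT_Ad1 _)).
  apply: eq_cur; first exact: mulVg.
    exact: (congr1 (fun z => z * v2) (e _)).
  apply: (congr1 (wedge _)); apply: etrans (mapE_act_Ad _ _ _) _.
  exact: (congr1 (fun z => act z _) (e _)).
apply: etrans (sw2_coassoc (F := K) _ _) _; first by rewrite /K; split=> *; lin.
apply: eq_sw2 => s t.
transitivity (@cur R n G 1%g (antipodeT s * v2) (act (antipodeT t) (wedge X Y)) : H); last first.
  apply: (congr1 (fun z => cur _ _ (act _ z))).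
  exact: esym (mapEM (lin_Ad _) _ _).
rewrite -> (act_wedge br_l br_r); rewrite -> sw2_antipode by bilin.
rewrite -> sw2C by (rewrite /K; bilin).
exact: esym (sw2_lin _ _ (lin_cura _ _)).
Qed.

(** * Compatibility with the filtration and the grading *)

Local Notation F := (@cur_filtration R n G).

Lemma cur_filtration_exh k : \bigcup_r F k r = homog cdeg k.
Proof.
apply/seteqP; split=> x; first by move=> [r _ hx] b /hx [].
move=> hx; exists (\max_(b <- msupp x) fdeg b.2.1)%N => // b hb.
split; first exact: hx.
by rewrite (big_rem b) //= leq_maxl.
Qed.

Lemma cur_Delta_supp k (r : nat) x : cur_supp k r x ->
  supp_in (fun bd : cur_idx G * cur_idx G =>
    (#|bd.1.2.2| + #|bd.2.2.2| = k)%N /\ (fdeg bd.1.2.1 + fdeg bd.2.2.1 <= r)%N)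
    (cur_Delta x).
Proof.
move=> hx; refine (supp_in_lin1 lD _ hx) => -[p [w A]] /= [<- hw].
rewrite -cur_bvec; rewrite -> cur_DeltaE.
apply: supp_sw2 => w1 w2 ew; apply: supp_swE => A1 A2 eA.
rewrite !cur_bvec; rewrite -> tens_bvec; apply: supp_in_bvec => /=.
by rewrite ew eA.
Qed.

Lemma cur_Delta_filtration k (r : nat) x : F k r x -> tensor_filtration F k r (cur_Delta x).
Proof.
move=> /cur_Delta_supp hx.
exists [seq (mcoeff bd (cur_Delta x) *: bvec bd.1, bvec bd.2) | bd <- msupp (cur_Delta x)].
  move=> xy /mapP [[b d] hbd ->] /=; have [/= e1 e2] := hx _ hbd.
  (* The lengths only add up to at most r, while the indices must add up to r: the second factor
     takes all the slack. *)
  exists #|b.2.2|, #|d.2.2|, (fdeg b.2.1), (r - fdeg b.2.1)%N.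
  have hb : (fdeg b.2.1 <= r)%N by apply: leq_trans e2; apply: leq_addr.
  split=> //; first by rewrite subnKC.
    by apply: supp_inZ; apply: supp_in_bvec.
  apply: supp_in_bvec; split=> //.
  by rewrite -(leq_add2l (fdeg b.2.1)) subnKC.
rewrite big_map [LHS]malg_expand; apply: eq_bigr => -[b d] _ /=.
by apply: esym; rewrite -> tensZl, tens_bvec.
Qed.

Lemma cur_antipode_filtration k (r : nat) x : F k r x -> F k r (cur_antipode c x).
Proof.
move=> hx; refine (supp_in_lin1 (P := fun b : cur_idx G => #|b.2.2| = k /\ (fdeg b.2.1 <= r)%N)
  (Q := fun b : cur_idx G => #|b.2.2| = k /\ (fdeg b.2.1 <= r)%N) lin_cur_antipode _ hx).
move=> [p [w A]] /= [<- hw]; rewrite -cur_bvec; rewrite -> cur_antipodeE.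
apply: supp_sw2 => w1 w2 ew; apply: supp_cur.
  have h := filtT_mapT (lin_Ad p) (filtT_antipode (@filtT_bvec R n w1)).
  apply: sub_supp_in h => z hz; apply: leq_trans hz (leq_trans _ hw).
  by rewrite -ew leq_addr.
apply: degE_act => //; apply: degE_mapE; first exact: lin_Ad.
by apply: degE_antipode; apply: degE_bvec.
Qed.

Lemma cur_eps_deg k x : (0 < k)%N -> homog cdeg k x -> cur_eps x = 0.
Proof.
move=> k0 hx; refine (lin_ext_supp (M := R^o) (P := fun z : cur_idx G => cdeg z = k)
  leps (@lin_zero _ _ _) _ hx) => -[p [w A]] /= hA.
rewrite -cur_bvec; rewrite -> cur_epsE.
have -> : epsE (bvec A : E) = 0 by apply: epsE_supp (@degE_bvec R n A); rewrite -[#|A|]/(cdeg (p, (w, A))) hA.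
exact: mulr0.
Qed.

Lemma cur_hopf : filtered_graded_hopf cdeg F mul (cur_one G) (@cur_Delta R n G)
  (@cur_eps R n G) (cur_antipode c).
Proof.
split.
- by move=> k s; apply: supp_in0.
- by move=> k s a x y; apply: supp_in_lin.
- move=> k s t st x hx b /hx [h1 h2]; split=> //; exact: leq_trans st.
- exact: cur_filtration_exh.
- exact: lin_cur_mull.
- exact: lin_cur_mulr.
- exact: cur_mulA.
- exact: cur_one_mul.
- exact: cur_mul_one.
- exact: lD.
- exact: leps.
- exact: cur_coassoc.
- exact: cur_counitl.
- exact: cur_counitr.
- exact: cur_DeltaM.
- exact: Delta_gP.
- exact: cur_epsM.
- apply: etrans (cur_epsE _ _ _) _; rewrite -> epsT1, epsE1; exact: mulr1.
- exact: lin_cur_antipode.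
- exact: cur_antipode_l.
- exact: cur_antipode_r.
- exact: homog_gP.
- by move=> i j s t x y; apply: cur_mul_supp.
- exact: cur_Delta_filtration.
- exact: cur_eps_deg.
- exact: cur_antipode_filtration.
Qed.

(** * The boundary *)

Section Boundary.
Hypothesis br_xx : forall x, br x x = 0.

Local Notation bd := (cur_bd c).

(** Moving y from position i to the front crosses i vectors. This turns the value of a derivation on
    a product into the shape of the bracket terms of the boundary. *)
Lemma wedges_omit (s : seq g) i y : (i < size s)%N ->
  wedges (set_nth 0 s i y) = (-1) ^+ i *: wedge (vE y) (wedges (omit i s)).
Proof.
elim: s i => [//|z s IH] [|i] hi.
  by rewrite /omit take0 drop1 expr0 scale1r.
rewrite /= -/(wedges _); apply: etrans (congr1 (wedge _) (IH i hi)) _.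
apply: etrans (wedgeZr _ _ _) _; rewrite exprS mulN1r scaleNr.
apply: etrans (congr1 (fun u => _ *: u) (wedge_inE_antiA _ _ _)) _.
exact: scalerN.
Qed.

Lemma sum_gt0 (V : zmodType) m (f : 'I_m.+1 -> V) :
  \sum_(j < m.+1 | (0 < j)%N) f j = \sum_(j < m) f (lift ord0 j).
Proof. by rewrite big_mkcond big_ord_recl /= add0r. Qed.

Lemma sum_gt_lift (V : zmodType) m (i : 'I_m) (f : 'I_m.+1 -> V) :
  \sum_(j < m.+1 | (lift ord0 i < j)%N) f j = \sum_(j < m | (i < j)%N) f (lift ord0 j).
Proof.
rewrite big_mkcond big_ord_recl /= add0r [RHS]big_mkcond; apply: eq_bigr => j _.
by rewrite /bump /= !add1n ltnS.
Qed.

Lemma omit0 (x : g) s : omit 0 (x :: s) = s.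
Proof. by rewrite /omit take0 drop1. Qed.

Lemma scale_signS (U : lmodType R) i (u : U) :
  (-1) ^+ i.+1 *: u = - ((-1) ^+ i *: u).
Proof. by rewrite exprS mulN1r scaleNr. Qed.

Lemma gV_mul_sq x h : mul (gV x) (mul (gV x) h) = 0.
Proof.
move: h; apply: cur_all_ext => [||p v a].
- exact: (lin_comp (lin_cur_mulr _) (lin_cur_mulr _)).
- exact: lin_zero.
rewrite -> !gV_mul; apply: etrans (congr1 (cur _ _) (wedge_inE_sqA _ _)) _.
exact: (lin0 (lin_cura _ _)).
Qed.

(** The commutator of X and V is multiplication by the V of [x, x] = 0. *)
Lemma gX_gV x h : mul (gX x) (mul (gV x) h) = mul (gV x) (mul (gX x) h).
Proof.
move: h; apply: cur_all_ext => [||p v a].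
- exact: (lin_comp (lin_cur_mulr _) (lin_cur_mulr _)).
- exact: (lin_comp (lin_cur_mulr _) (lin_cur_mulr _)).
apply: etrans (congr1 (mul _) (gV_mul _ _ _ _)) _.
apply: etrans (gX_mul _ _ _ _) _; apply: esym.
apply: etrans (congr1 (mul _) (gX_mul _ _ _ _)) _.
apply: etrans (linD (lin_cur_mulr _) _ _) _.
apply: congrD; first exact: gV_mul.
apply: etrans (gV_mul _ _ _ _) _; apply: (congr1 (cur _ _)); apply: esym.
apply: etrans (derE_cons (br_r x) _ _) _; rewrite br_xx.
apply: etrans (congr1 (fun z => wedge z _ + _) (lin0 (@lin_inE R n))) _.
apply: etrans (congr1 (fun z => z + _) (wedge0l _)) _; exact: add0r.
Qed.

Lemma bd_formula_nil p v : bd_formula c p v [::] = 0.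
Proof.
apply: etrans (congr1 (at_pt p) (congrD (big_ord0 _ _ _ _) (big_ord0 _ _ _ _))) _.
apply: etrans (congr1 (at_pt p) (addr0 _)) _; exact: (lin0 (lin_at_pt p)).
Qed.

Let bd_formulaE p v s : bd_formula c p v s =
    \sum_(i < size s) (-1) ^+ i *:
      (cur p (inT (Ad p^-1%g (nth 0 s i)) * v) (wedges (omit i s)) : H)
  + \sum_(i < size s) \sum_(j < size s | (i < j)%N) (-1) ^+ (i + j + 1)%N *:
      (cur p v (wedge (vE (br (nth 0 s i) (nth 0 s j))) (wedges (omit i (omit j s)))) : H).
Proof.
have la := lin_at_pt (p : G).
rewrite /bd_formula (linD la) !(lin_bigsum _ _ _ la); congr (_ + _).
  by apply: eq_bigr => i _; apply: (linZ la).
apply: eq_bigr => i _; rewrite (lin_bigsum _ _ _ la).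
by apply: eq_bigr => j _; apply: (linZ la).
Qed.

(** Split the terms by the role of x: omitting x gives the tensor part of X, bracketing x with a
    later vector gives its derivation part, and the terms that keep x form -V applied to the
    boundary of the tail. *)
Lemma bd_formula_cons p v x s : bd_formula c p v (x :: s) =
  mul (gX x) (cur p v (wedges s)) - mul (gV x) (bd_formula c p v s).
Proof.
have lV := lin_cur_mulr (gV x).
rewrite !bd_formulaE; apply: esym.
apply: etrans (congr1 (fun z => z - _) (gX_mul _ _ _ _)) _.
apply: etrans (congr1 (fun z => _ - z) (linD lV _ _)) _.
apply: etrans (congr1 (fun z => _ + z) (opprD _ _)) _.
apply: etrans (addrACA _ _ _ _) _; apply: congrD; apply: esym.
  apply: etrans (big_ord_recl _ _) _; apply: congrD.
    apply: etrans (scale1r _) _.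
    exact: (congr1 (fun z => cur p _ (wedges z)) (omit0 x s)).
  apply: esym; apply: etrans (congr1 (fun z => - z) (lin_bigsum _ _ _ lV)) _.
  apply: etrans (esym (sumrN _ _ _)) _; apply: eq_bigr => i _.
  apply: etrans (congr1 (fun z => - z) (linZ lV _ _)) _.
  apply: etrans (congr1 (fun z => - (_ *: z)) (gV_mul _ _ _ _)) _.
  exact: esym (scale_signS _ _).
apply: etrans (big_ord_recl _ _) _; apply: congrD.
  apply: etrans (sum_gt0 _) _; apply: esym.
  apply: etrans (congr1 (cur p v) (derE_wedges (br_r x) s)) _.
  apply: etrans (lin_bigsum _ _ _ (lin_cura p v)) _; apply: eq_bigr => i _.
  apply: etrans (congr1 (cur p v) (wedges_omit _ (ltn_ord i))) _.
  apply: etrans (linZ (lin_cura _ _) _ _) _; apply: esym.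
  apply: etrans (congr1 (fun z => _ *: cur p v (wedge _ (wedges z))) (omit0 x _)) _.
  apply: (congr1 (fun k => k *: _)).
  (* Position j of the tail is index j + 1 of the list, so the sign is (-1)^(0 + (j + 1) + 1) =
     (-1)^j, as produced by [wedges_omit]. *)
  by rewrite /= /bump /= add1n add0n addn1 !exprS !mulN1r opprK.
apply: esym; apply: etrans (congr1 (fun z => - z) (lin_bigsum _ _ _ lV)) _.
apply: etrans (esym (sumrN _ _ _)) _; apply: eq_bigr => i _; apply: esym.
apply: etrans (sum_gt_lift _ _) _; apply: esym.
apply: etrans (congr1 (fun z => - z) (lin_bigsum _ _ _ lV)) _.
apply: etrans (esym (sumrN _ _ _)) _; apply: eq_bigr => j _.
apply: etrans (congr1 (fun z => - z) (linZ lV _ _)) _.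
apply: etrans (congr1 (fun z => - (_ *: z)) (gV_mul _ _ _ _)) _.
apply: etrans (congr1 (fun z => - (_ *: cur p v z)) (wedge_inE_antiA _ _ _)) _.
apply: etrans (congr1 (fun z => - (_ *: z)) (linN (lin_cura _ _) _)) _.
apply: etrans (congr1 (fun z => - z) (scalerN _ _)) _; apply: etrans (opprK _) _.
apply: (congr1 (fun k => k *: _)).
(* Shifting both indices leaves the sign unchanged, and the minus of -V has been spent on exchanging
   x with the bracket. *)
have -> : (lift ord0 i + lift ord0 j + 1 = (i + j + 1).+2)%N.
  by rewrite /= /bump /= !addn1 !add1n addSn addnS.
by rewrite exprS mulN1r exprS mulN1r opprK.
Qed.

Lemma lin_cur_bd : lin bd.
Proof. exact: lin_lext. Qed.

(* On pairs (u, bd u), left multiplication of u by x acts as cpair x, which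
   squares to zero; hence bd is determined by the universal property. *)
Let cpair (x : g) (m : H * H) : H * H :=
  (mul (gV x) m.1, mul (gX x) m.1 - mul (gV x) m.2).

Let cpair_linr x : lin (cpair x).
Proof.
move=> k m m'; congr (_, _); rewrite /=; first exact: lin_cur_mulr.
have h : lin (fun m : (H * H)%type => mul (gX x) m.1 - mul (gV x) m.2).
  apply: lin_add; first exact: (lin_comp (lin_cur_mulr _) (g := fst)).
  by apply: lin_opp; apply: (lin_comp (lin_cur_mulr _) (g := snd)).
exact: h.
Qed.

Let lgV h : lin (fun x => mul (gV x) h).
Proof. exact: (lin_comp (lin_cur_mull h) (lin_comp (lin_cura _ _) (@lin_inE R n))). Qed.

Let lgX h : lin (fun x => mul (gX x) h).
Proof. exact: (lin_comp (lin_cur_mull h) (lin_comp (lin_curv _ _) (@lin_inT R n))). Qed.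

Let cpair_linl m : lin (fun x => cpair x m).
Proof.
move=> k x y; congr (_, _); rewrite /=; first exact: lgV.
have h : lin (fun x => mul (gX x) m.1 - mul (gV x) m.2).
  by apply: lin_add; [exact: lgX|apply: lin_opp; exact: lgV].
exact: h.
Qed.

Let cpair_sq x m : cpair x (cpair x m) = 0.
Proof.
rewrite /cpair /=; congr (_, _); first exact: gV_mul_sq.
apply: etrans (congr1 (fun z => _ - z) (linB (lin_cur_mulr _) _ _)) _.
apply: etrans (congr1 (fun z => _ - (_ - z)) (gV_mul_sq _ _)) _.
apply: etrans (congr1 (fun z => _ - z) (subr0 _)) _.
apply: etrans (congr1 (fun z => z - _) (gX_gV _ _)) _; exact: subrr.
Qed.

Let foldr_cpair p v s :
  foldr cpair (cur p v one, 0) s = (cur p v (wedges s), bd_formula c p v s).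
Proof.
elim: s => [|x s IH] /=; first by rewrite bd_formula_nil.
rewrite IH /cpair /= bd_formula_cons; congr (_, _); exact: gV_mul.
Qed.

Lemma wedges_frame (A : {set 'I_n}) : wedges (frame R A) = bvec A.
Proof.
move: A; apply: set_min_ind => [|i A iA IH]; first by rewrite /frame finset.enum_set0.
apply: etrans _ (esym (bvec_below R iA)); rewrite /frame (enum_setU1_below iA).
exact: (congr1 (wedge _) IH).
Qed.

Let ext_cpair p (w : fmonom 'I_n) a :
  ext_map (M := (H * H)%type) cpair (cur p (bvec w) one, 0) a =
  (cur p (bvec w) a, bd (cur p (bvec w) a)).
Proof.
have hl := @lin_ext_map R n (H * H)%type cpair (cur p (bvec w) one, 0).
have hr : lin (fun a => (cur p (bvec w) a, bd (cur p (bvec w) a)) : (H * H)%type).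
  move=> k x y; congr (_, _); first exact: lin_cura.
  exact: (lin_comp lin_cur_bd (lin_cura p (bvec w))).
move: a; apply: lin_ext => [||A]; [exact: hl|exact: hr|].
rewrite /ext_map; rewrite -> lext_bvec; rewrite foldr_cpair wedges_frame.
by congr (_, _); rewrite cur_bvec /cur_bd; rewrite -> lext_bvec.
Qed.

Lemma cur_bd_gV x h : bd (mul (gV x) h) = mul (gX x) h - mul (gV x) (bd h).
Proof.
have lb := lin_cur_bd.
have lr : lin (fun h => mul (gX x) h - mul (gV x) (bd h)).
  apply: lin_add; first exact: lin_cur_mulr.
  by apply: lin_opp; exact: (lin_comp (lin_cur_mulr _) lb).
move: h; apply: cur_all_ext => [||p v a].
- exact: (lin_comp lb (lin_cur_mulr _)).
- exact: lr.
move: v; apply: lin_ext => [||w].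
- exact: (lin_comp lb (lin_comp (lin_cur_mulr _) (lin_curv _ _))).
- exact: (lin_comp lr (lin_curv _ _)).
have := ext_map_wedge (cur p (bvec w) one, 0) cpair_linl cpair_linr cpair_sq x a.
rewrite !ext_cpair => /(congr1 snd) /= e.
exact: etrans (congr1 bd (gV_mul _ _ _ _)) e.
Qed.

Lemma cur_bd_one p v : bd (cur p v one) = 0.
Proof.
move: v; apply: lin_ext => [||w].
- exact: (lin_comp lin_cur_bd (lin_curv _ _)).
- exact: lin_zero.
have := ext_cpair p w one; rewrite ext_map1 => /(congr1 snd) /= e; exact: esym e.
Qed.

(** [cur_bd] is defined on increasing products of basis vectors, but its recursion along V holds for
    every x, hence the formula for every list. *)
Lemma cur_bd_wedges p v s : bd (at_pt p (v ⊗ wedges s)) = bd_formula c p v s.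
Proof.
rewrite -/(cur p v (wedges s)); elim: s => [|x s IH].
  by rewrite bd_formula_nil; exact: cur_bd_one.
rewrite bd_formula_cons -IH; apply: etrans _ (cur_bd_gV _ _).
exact: (congr1 bd (esym (gV_mul _ _ _ _))).
Qed.

(** The successor on the left makes the statement cover degree 0, where the support is empty. In the
    recursion X adds at most one letter and V none. *)
Lemma cur_bd_supp p (w : fmonom 'I_n) (A : {set 'I_n}) :
  supp_in (fun b : cur_idx G => #|b.2.2|.+1 = #|A| /\ (fdeg b.2.1 <= (fdeg w).+1)%N)
    (bd (cur p (bvec w) (bvec A))).
Proof.
move: A; apply: set_min_ind => [|i A iA IH].
  rewrite -/(oneE R n) cur_bd_one; exact: supp_in0.
have -> : cur p (bvec w) (bvec (i |: A)%SET) =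
    mul (gV (e_ R i)) (cur p (bvec w) (bvec A)).
  apply: esym; apply: etrans (gV_mul _ _ _ _) _.
  exact: (congr1 (cur _ _) (esym (bvec_below R iA))).
rewrite cur_bd_gV (card_below iA); apply: supp_inD.
  have h := cur_mul_supp (supp_cur (p := 1%g) (@filtT_inT R n (e_ R i)) (@degE_one R n))
    (supp_cur (p := p) (@filtT_bvec R n w) (@degE_bvec R n A)).
  by apply: sub_supp_in h => b [-> hb]; split.
rewrite -scaleN1r; apply: supp_inZ.
refine (supp_in_lin1 (lin_cur_mulr _) _ IH) => -[q [u B]] /= [hB hu].
rewrite -cur_bvec; rewrite -> gV_mul.
have h := supp_cur (p := q) (@filtT_bvec R n u)
  (degE_wedge (@degE_vE R n (e_ R i)) (@degE_bvec R n B)).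
apply: sub_supp_in h => b [-> hb]; split; last exact: leq_trans hu.
by rewrite add1n hB add1n.
Qed.

Lemma cur_bd_filtration k (r : nat) x : F k.+1 r x -> F k r.+1 (bd x).
Proof.
move=> hx; refine (supp_in_lin1 (P := fun b : cur_idx G => #|b.2.2| = k.+1 /\ (fdeg b.2.1 <= r)%N)
  (Q := fun b : cur_idx G => #|b.2.2| = k /\ (fdeg b.2.1 <= r.+1)%N) lin_cur_bd _ hx).
move=> [p [w A]] /= [hA hw]; rewrite -cur_bvec.
apply: sub_supp_in (@cur_bd_supp p w A) => b; rewrite hA => -[[hb] hb']; split=> //.
exact: leq_trans hb' _.
Qed.

Lemma cur_bd_deg0 (r : nat) x : F 0%N r x -> bd x = 0.
Proof.
move=> hx; refine (lin_ext_supp (P := fun b : cur_idx G => #|b.2.2| = 0%N /\ (fdeg b.2.1 <= r)%N)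
  lin_cur_bd (@lin_zero _ _ _) _ hx) => -[p [w A]] /= [/eqP]; rewrite cards_eq0 => /eqP -> _.
rewrite -cur_bvec; exact: cur_bd_one.
Qed.

Lemma gsign_gV x y : gsg (mul (gV x) y) = - mul (gV x) (gsg y).
Proof.
move: y; apply: cur_all_ext => [||p v a].
- exact: (lin_comp lin_gsign (lin_cur_mulr _)).
- exact: (lin_opp (lin_comp (lin_cur_mulr _) lin_gsign)).
rewrite -> gV_mul, !gsign_cur, gV_mul, antipodeE_cons.
exact: (linN (lin_cura _ _)).
Qed.

Lemma gsign_gX x y : gsg (mul (gX x) y) = mul (gX x) (gsg y).
Proof.
move: y; apply: cur_all_ext => [||p v a].
- exact: (lin_comp lin_gsign (lin_cur_mulr _)).
- exact: (lin_comp (lin_cur_mulr _) lin_gsign).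
apply: etrans (congr1 gsg (gX_mul _ _ _ _)) _.
apply: etrans (linD lin_gsign _ _) _.
apply: etrans (congrD (gsign_cur _ _ _) (gsign_cur _ _ _)) _; apply: esym.
apply: etrans (congr1 (mul _) (gsign_cur _ _ _)) _; apply: etrans (gX_mul _ _ _ _) _.
exact: (congr1 (fun z => _ + cur _ _ z) (derE_antipodeE _ (br_r _))).
Qed.

(** The boundary is odd; this makes the mixed terms match in [coder_DV]. *)
Lemma gsign_bd y : gsg (bd y) = - bd (gsg y).
Proof.
have l1 := lin_comp lin_gsign lin_cur_bd.
have l2 := lin_opp (lin_comp lin_cur_bd lin_gsign).
move: y; apply: cur_all_ext => [||p v a]; [exact: l1|exact: l2|].
move: a; apply: E_ext => [|||i a IH].
- exact: (lin_comp l1 (lin_cura _ _)).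
- exact: (lin_comp l2 (lin_cura _ _)).
- apply: etrans (congr1 gsg (cur_bd_one _ _)) _; apply: etrans (lin0 lin_gsign) _.
  apply: esym; apply: etrans (congr1 (fun z => - bd z) (gsign_cur _ _ _)) _.
  apply: etrans (congr1 (fun z => - bd (cur p v z)) (antipodeE1 _ _)) _.
  apply: etrans (congr1 (fun z => - z) (cur_bd_one _ _)) _; exact: oppr0.
set y := cur p v a in IH *; have <- := gV_mul (e_ R i) p v a; rewrite -/y.
move: y IH => y IH; set x := e_ R i.
apply: etrans (congr1 gsg (cur_bd_gV _ _)) _; apply: etrans (linB lin_gsign _ _) _.
apply: etrans (congr1 (fun z => _ - z) (gsign_gV _ _)) _.
apply: etrans (congr1 (fun z => _ - - mul _ z) IH) _.
apply: etrans (congr1 (fun z => z - - _) (gsign_gX _ _)) _.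
apply: etrans (congr1 (fun z => _ - - z) (linN (lin_cur_mulr _) _)) _.
apply: etrans (congr1 (fun z => _ + z) (opprK _)) _; apply: esym.
apply: etrans (congr1 (fun z => - bd z) (gsign_gV _ _)) _.
apply: etrans (congr1 (fun z => - z) (linN lin_cur_bd _)) _; apply: etrans (opprK _) _.
exact: cur_bd_gV.
Qed.

(** The operator that the Koszul rule associates with the boundary on the tensor square. *)
Let coder (t : HH) : HH := tlift (fun x1 x2 : H => bd x1 ⊗ x2 + gsg x1 ⊗ bd x2) t.

Let coder_bilin : bilin (fun x1 x2 : H => bd x1 ⊗ x2 + gsg x1 ⊗ bd x2).
Proof.
have lb := lin_cur_bd; have lg := lin_gsign; split=> y; apply: lin_add.
- exact: lin_tensr.
- exact: (lin_comp (lin_tensr _) lb).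
- exact: (lin_comp (lin_tensl _) lb).
- exact: (lin_comp (lin_tensl _) lg).
Qed.

Let lin_coder : lin coder. Proof. exact: lin_tlift. Qed.

Let coderE x1 x2 : coder (x1 ⊗ x2) = bd x1 ⊗ x2 + gsg x1 ⊗ bd x2.
Proof. exact: (tlift_tens coder_bilin). Qed.

Lemma coder_shuffle (V : zmodType) (a b d e f h : V) :
  (a - b) + - d + (e + (f - h)) = (a + f) - ((b - e) + (d + h)).
Proof. by rewrite !opprD opprK (AC (3*(1*2)) ((1*5)*((2*4)*(3*6)))). Qed.

(** The recursion of the boundary, one level up, with the coproducts of X and V in their place. As
    the coproduct is multiplicative, [cur_Delta (bd x)] and [coder (cur_Delta x)] then obey the same
    recursion. *)
Let coder_DV x t : coder (kz (DV x) t) = kz (DX x) t - kz (DV x) (coder t).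
Proof.
move: t; apply: lin_ext2 => [||k l].
- exact: (lin_comp lin_coder (lkr _)).
- apply: lin_add; first exact: lkr.
  by apply: lin_opp; exact: (lin_comp (lkr _) lin_coder).
move: (bvec k) (bvec l) => y1 y2.
apply: etrans (congr1 coder (kz_DV _ _ _)) _.
apply: etrans (linD lin_coder _ _) _.
apply: etrans (congrD (coderE _ _) (coderE _ _)) _.
apply: esym; apply: etrans (congr2 (fun s t => s - kz _ t) (kz_DX _ _ _) (coderE _ _)) _.
apply: etrans (congr1 (fun z => _ - z) (linD (lkr _) _ _)) _.
apply: etrans (congr2 (fun s t => _ - (s + t)) (kz_DV _ _ _) (kz_DV _ _ _)) _.
rewrite -> !gsignK, !cur_bd_gV, gsign_gV, gsign_bd.
rewrite -> !tensDl, !tensDr, !tensNl, tensNr.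
exact: esym (coder_shuffle _ _ _ _ _ _).
Qed.

Lemma cur_bd_coder x : cur_Delta (bd x) = coder (cur_Delta x).
Proof.
have l1 := lin_comp lD lin_cur_bd.
have l2 := lin_comp lin_coder lD.
move: x; apply: cur_all_ext => [||p v a]; [exact: l1|exact: l2|].
move: a; apply: E_ext => [|||i a IH].
- exact: (lin_comp l1 (lin_cura _ _)).
- exact: (lin_comp l2 (lin_cura _ _)).
- apply: etrans (congr1 (@cur_Delta R n G) (cur_bd_one _ _)) _.
  apply: etrans (lin0 lD) _; apply: esym.
  apply: etrans (tlift_Delta _ _ _ coder_bilin) _.
  have e v1 v2 : swE (fun a1 a2 => bd (cur p v1 a1) ⊗ cur p v2 a2 +
      gsg (cur p v1 a1) ⊗ bd (cur p v2 a2)) one = 0 :> HH.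
    rewrite -> swE1; last first.
      by have [h1 h2] := coder_bilin; split=> y;
        [exact: (lin_comp (h1 _) (lin_cura _ _))|
         exact: (lin_comp (h2 _) (lin_cura _ _))].
    apply: etrans (congr2 (fun s t => s ⊗ _ + _ ⊗ t) (cur_bd_one _ _) (cur_bd_one _ _)) _.
    apply: etrans (congrD (lin0 (lin_tensl _)) (lin0 (lin_tensr _))) _; exact: addr0.
  exact: sw2_eq0 e.
set y := cur p v a in IH *; have <- := gV_mul (e_ R i) p v a; rewrite -/y.
move: y IH => y IH; set x := e_ R i.
apply: etrans (congr1 (@cur_Delta R n G) (cur_bd_gV _ _)) _.
apply: etrans (linB lD _ _) _.
apply: etrans (congr2 (fun s t => s - t) (cur_DeltaM _ _) (cur_DeltaM _ _)) _.
apply: etrans (congr2 (fun s t => kz s _ - kz t _) (Delta_gX _) (Delta_gV _)) _.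
apply: etrans (congr1 (fun z => _ - kz _ z) IH) _.
apply: etrans (esym (coder_DV _ _)) _; apply: (congr1 coder).
apply: esym; apply: etrans (cur_DeltaM _ _) _; exact: (congr1 (fun s => kz s _) (Delta_gV _)).
Qed.

Lemma cur_bd_bd x y : bd (bd (cur 1%g 1 (wedge (vE x) (wedge (vE y) one)))) =
  cur 1%g (inT y * inT x + inT (br x y) - inT x * inT y) one.
Proof.
have X1 z u : mul (gX z) (cur 1%g u one) = cur 1%g (inT z * u) one.
  apply: etrans (gX_mul _ _ _ _) _.
  apply: etrans (congr1 (fun t => _ + cur _ _ t) (derE1 _)) _.
  apply: etrans (congr1 (fun t => _ + t) (lin0 (lin_cura _ _))) _.
  apply: etrans (addr0 _) _; apply: eq_cur; [reflexivity| |reflexivity].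
  exact: (congr1 (fun t => inT t * _) (etrans (congr1 (fun p => Ad p _) (invg1 _)) (Ad1 _))).
have bdV z u : bd (cur 1%g u (wedge (vE z) one)) = cur 1%g (inT z * u) one.
  apply: etrans (congr1 bd (esym (gV_mul _ _ _ _))) _.
  apply: etrans (cur_bd_gV _ _) _.
  apply: etrans (congr2 (fun s t => s - mul _ t) (X1 _ _) (cur_bd_one _ _)) _.
  apply: etrans (congr1 (fun t => _ - t) (lin0 (lin_cur_mulr _))) _; exact: subr0.
apply: etrans (congr1 (fun t => bd (bd t)) (esym (gV_mul _ _ _ _))) _.
apply: etrans (congr1 bd (cur_bd_gV _ _)) _.
apply: etrans (congr1 (fun t => bd (_ - mul _ t)) (bdV _ _)) _.
apply: etrans (congr1 (fun t => bd (_ - t)) (gV_mul _ _ _ _)) _.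
apply: etrans (congr1 (fun t => bd (t - _)) (gX_mul _ _ _ _)) _.
apply: etrans (linB lin_cur_bd _ _) _; apply: etrans (congr1 (fun t => t - _) (linD lin_cur_bd _ _)) _.
have e : derE (br x) (wedge (vE y) one) = wedge (vE (br x y)) one.
  apply: etrans (derE_cons (br_r _) _ _) _.
  apply: etrans (congr1 (fun t => _ + wedge _ t) (derE1 _)) _.
  apply: etrans (congr1 (fun t => _ + t) (wedge0r _)) _; exact: addr0.
rewrite e.
apply: etrans (congr2 (fun s t => s - t) (congrD (bdV _ _) (bdV _ _)) (bdV _ _)) _.
have lc := lin_curv (1%g : G) one.
apply: etrans (congr1 (fun t => t - _) (esym (linD lc _ _))) _.
apply: etrans (esym (linB lc _ _)) _; apply: (congr1 (fun t => cur 1%g t _)).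
apply: congrD; last first.
  exact: (congr1 (fun t => - (_ * t)) (mulr1 _)).
apply: congrD; last exact: mulr1.
apply: etrans (congr1 (fun t => inT y * t) (mulr1 _)) _.
exact: (congr1 (fun t => _ * inT t) (etrans (congr1 (fun p => Ad p _) (invg1 _)) (Ad1 _))).
Qed.

Lemma cur_bd_bd_neq0 (i j : 'I_n) : i != j ->
  bd (bd (cur 1%g 1 (wedge (vE (e_ R i)) (wedge (vE (e_ R j)) one)))) <> 0.
Proof.
move=> ij; rewrite cur_bd_bd.
(* A linear left inverse of v ↦ (e, v ⊗ 1), which brings the question back to the tensor algebra. *)
pose f := cur_ext (M := T) (fun (_ : G) v a => epsE a *: v).
have fE v : f (cur 1%g v one) = v.
  rewrite /f; rewrite -> cur_extE by bilin; rewrite -> epsE1; exact: scale1r.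
have f0 : f 0 = 0 by exact: (lin0 (lin_cur_ext _)).
move=> /(congr1 f) h; have {h} := etrans (esym (fE _)) (etrans h f0).
exact: inT_comm_neq0.
Qed.

End Boundary.

End HopfCurrents.

(** * Differential calculus *)

Section Calculus.
Variable R : realType.

(** The remainder as an explicit bound, in the form used by the mean value estimate of
    [second_difference]. *)
Lemma differentiable_eps (V W : normedModType R) (f : V -> W) a :
  differentiable f a -> forall eps, 0 < eps ->
  \forall h \near (0 : V), `|f (h + a) - f a - 'd f a h| <= eps * `|h|.
Proof.
move=> /diff_locally /eqaddoP fo eps eps0.
have := fo _ eps0; apply: filterS => h; rewrite /= -![(_ - _ : _ -> _) _]/(_ - _) /=.
by rewrite -[(_ + _ : _ -> _) h]/(_ + _) /cst opprD addrA.
Qed.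

Lemma eps_differentiable (V W : normedModType R) (f : V -> W) a (df : {linear V -> W}) :
  continuous df ->
  (forall eps, 0 < eps ->
    \forall h \near (0 : V), `|f (h + a) - f a - df h| <= eps * `|h|) ->
  differentiable f a /\ ('d f a = df :> (V -> W)).
Proof.
move=> dfc fo.
have e : f \o shift a = cst (f a) + df +o_ 0 id.
  apply/eqaddoP => eps eps0; have := fo _ eps0; apply: filterS => h.
  rewrite /= -![(_ - _ : _ -> _) _]/(_ - _) /=.
  by rewrite -[(_ + _ : _ -> _) h]/(_ + _) /cst opprD addrA.
have e2 := diff_unique dfc e; split=> //.
by apply/diff_locallyP; rewrite e2.
Qed.

Lemma near_eq_diff (V W : normedModType R) (f g : V -> W) a :
  (\near a, f a = g a) -> differentiable f a ->
  differentiable g a /\ ('d g a = 'd f a :> (V -> W)).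
Proof.
move=> fg df; apply: eps_differentiable; first exact: diff_continuous.
move=> eps eps0; have := differentiable_eps df eps0.
have fg0 : \forall h \near (0 : V), f (h + a) = g (h + a).
  have : (fun h : V => h + a) @ (0 : V) --> a.
    by rewrite -[X in _ --> X]add0r; apply: cvgD; [exact: cvg_id|exact: cvg_cst].
  by move=> /(_ _ fg).
by move: fg0; apply: filterS2 => h <-; rewrite (nbhs_singleton fg).
Qed.

Lemma differentiable_nbhs_eq (V W : normedModType R) (f g : V -> W) a :
  (\near a, f a = g a) -> differentiable f a -> differentiable g a.
Proof. by move=> fg /(near_eq_diff fg) []. Qed.

Lemma diff_nbhs_eq (V W : normedModType R) (f g : V -> W) a :
  (\near a, f a = g a) -> differentiable f a -> 'd g a = 'd f a :> (V -> W).
Proof. by move=> fg /(near_eq_diff fg) []. Qed.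

Lemma scaler_is_bilinear (W : normedModType R) :
  bilinear_for (GRing.Scale.Law.clone _ _ *:%R _) (GRing.Scale.Law.clone _ _ *:%R _)
    (@GRing.scale R W : R -> W -> W).
Proof.
split=> [u'|u] a x y /=.
- by rewrite scalerDl scalerA.
- by rewrite scalerDr !scalerA mulrC.
Qed.
HB.instance Definition _ (W : normedModType R) :=
  bilinear_isBilinear.Build R R W W _ _ (@GRing.scale R W) (@scaler_is_bilinear W).

Lemma diff_scale (V W : normedModType R) (k : V -> R) (f : V -> W) a :
  differentiable k a -> differentiable f a ->
  differentiable (fun z => k z *: f z) a /\
  forall x, 'd (fun z => k z *: f z) a x = k a *: 'd f a x + 'd k a x *: f a.
Proof.
move=> dk df.
have hc : continuous (fun p : R * W => p.1 *: p.2) by exact: scale_continuous.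
pose s : R * W -> W := fun p => p.1 *: p.2.
have ds p : differentiable s p := @differentiable_bilin _ _ _ _ (@GRing.scale R W) p hc.
have dp := differentiable_pair dk df.
have -> : (fun z => k z *: f z) = s \o (fun z => (k z, f z)) by [].
split; first exact: differentiable_comp.
move=> x; rewrite diff_comp //= diff_pair //=.
by rewrite (@diff_bilin _ _ _ _ (@GRing.scale R W) (k a, f a) hc).
Qed.

Lemma diff_bigsum n (V W : normedModType R) (f : 'I_n -> V -> W) a :
  (forall i, differentiable (f i) a) ->
  differentiable (fun z => \sum_i f i z) a /\
  forall x, 'd (fun z => \sum_i f i z) a x = \sum_i 'd (f i) a x.
Proof.
elim: n f => [|n IH] f df.
  have -> : (fun z => \sum_(i < 0) f i z) = cst 0 by apply/funext => z; rewrite big_ord0.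
  by split=> [|x]; rewrite ?big_ord0 ?diff_cst.
have -> : (fun z => \sum_i f i z) =
    (fun z => \sum_(i < n) f (widen_ord (leqnSn n) i) z) + f ord_max.
  by apply/funext => z; rewrite big_ord_recr.
have [h1 h2] := IH (fun i => f (widen_ord (leqnSn n) i)) (fun i => df _).
split=> [|x]; first exact: differentiableD.
by rewrite diffD // big_ord_recr /= -h2.
Qed.

Lemma diff_coord n (V : normedModType R) (u : V -> 'rV[R]_n) a i :
  differentiable u a ->
  differentiable (fun z => u z 0 i) a /\
  forall x, 'd (fun z => u z 0 i) a x = 'd u a x 0 i.
Proof.
move=> du.
have dc : differentiable (fun w : 'rV[R]_n => w 0 i) (u a) by exact: differentiable_coord.
split; first exact: (@differentiable_comp _ _ _ _ u (fun w : 'rV[R]_n => w 0 i)).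
move=> x; rewrite (@diff_comp _ _ _ _ u (fun w : 'rV[R]_n => w 0 i)) //=.
have cl : linear (fun w : 'rV[R]_n => w 0 i : R) by move=> k y z; rewrite !mxE.
pose cM := GRing.isLinear.Build _ _ _ _ _ cl.
pose cf : {linear 'rV[R]_n -> R} := HB.pack (fun w : 'rV[R]_n => w 0 i : R) cM.
by rewrite -[fun _ => _]/(cf : _ -> _) diff_lin //; exact: coord_continuous.
Qed.

(** The product rule for a linear map depending on the point. In finite dimension it is enough that
    each A(z) v, with v fixed, is differentiable: expand u(z) in coordinates. *)
Lemma diff_apply n (V W : normedModType R) (A : V -> 'rV[R]_n -> W)
    (u : V -> 'rV[R]_n) a :
  (forall z, lin (A z)) -> (forall v, differentiable (A ^~ v) a) ->
  differentiable u a ->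
  differentiable (fun z => A z (u z)) a /\
  forall x, 'd (fun z => A z (u z)) a x = A a ('d u a x) + 'd (A ^~ (u a)) a x.
Proof.
move=> lA dA du.
have AE z v : A z v = \sum_i v 0 i *: A z (delta_mx 0 i).
  rewrite {1}[v]row_sum_delta (lin_bigsum _ _ _ (lA z)).
  by apply: eq_bigr => i _; rewrite (linZ (lA z)).
have du' i := (diff_coord i du).1; have du'E i := (diff_coord i du).2.
have h i := diff_scale (du' i) (dA (delta_mx 0 i)).
have [s1 s2] := diff_bigsum (fun i => (h i).1).
have e : (fun z => A z (u z)) = (fun z => \sum_i u z 0 i *: A z (delta_mx 0 i)).
  by apply/funext => z; exact: AE.
rewrite e; split=> // x; rewrite s2.
have dk i : differentiable (fun z => u a 0 i *: A z (delta_mx 0 i)) a.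
  exact: (differentiableZ (u a 0 i) (dA (delta_mx 0 i))).
have [t1 t2] := diff_bigsum dk.
have -> : A^~ (u a) = (fun z => \sum_i u a 0 i *: A z (delta_mx 0 i)).
  by apply/funext => z; exact: AE.
rewrite t2 [A a _]AE -big_split; apply: eq_bigr => i _ /=.
rewrite (h i).2 addrC du'E; congr (_ + _).
exact: esym (congr1 (fun f => f x) (diffZ (u a 0 i) (dA (delta_mx 0 i)))).
Qed.

(** Twice differentiability at a point, tested along fixed vectors as in [Ck]. *)
Definition diff2 (V W : normedModType R) (f : V -> W) a :=
  (\near a, differentiable f a) /\ forall v, differentiable (fun z => 'd f z v) a.

Lemma diff2_nbhs_eq (V W : normedModType R) (f g : V -> W) a :
  (\near a, f a = g a) -> diff2 f a -> diff2 g a.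
Proof.
move=> /near_join fg [df d2f]; split.
  by move: fg df; apply: filterS2 => z; exact: differentiable_nbhs_eq.
move=> v; apply: differentiable_nbhs_eq (d2f v).
by move: fg df; apply: filterS2 => z fgz dfz; rewrite (diff_nbhs_eq fgz).
Qed.

(** Near a the derivative is dg(f z)(df z v), a linear map depending on z applied to a vector
    depending on z, so [diff_apply] differentiates it again. *)
Lemma diff2_comp n (V W : normedModType R) (f : V -> 'rV[R]_n) (g : 'rV[R]_n -> W) a :
  diff2 f a -> diff2 g (f a) -> diff2 (g \o f) a.
Proof.
move=> [df d2f] [dg d2g].
have dfa := nbhs_singleton df.
have dgf : \near a, differentiable g (f a).
  by have := differentiable_continuous dfa => /(_ _ dg).
split; first by move: df dgf; apply: filterS2 => z; exact: differentiable_comp.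
move=> v; apply: (@differentiable_nbhs_eq _ _ (fun z => 'd g (f z) ('d f z v))).
  by move: df dgf; apply: filterS2 => z dfz dgz; rewrite (diff_comp dfz dgz).
apply: (diff_apply (A := fun z => 'd g (f z)) _ _ (d2f v)).1.
  by move=> z k x y; rewrite linearP.
by move=> w; exact: differentiable_comp (d2g w).
Qed.

Lemma diff2_pairl (V1 V2 W : normedModType R) (f : V1 * V2 -> W) (a : V1) (b : V2) :
  diff2 f (a, b) -> diff2 (fun y => f (a, y)) b.
Proof.
move=> [df d2f].
pose i2 := fun y : V2 => (a, y).
have dp y : is_diff y i2 (fun y => (0, y)) by apply: is_diff_pair.
have di y : differentiable i2 y by exact: (@ex_diff _ _ _ _ _ _ _ (dp y)).
have pc : (fun y : V2 => (a, y)) @ b --> (a, b) by apply: cvg_pair; [exact: cvg_cst|exact: cvg_id].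
have df' : \near b, differentiable f (a, b) by exact: pc _ df.
split.
  by move: df'; apply: filterS => y dy; exact: differentiable_comp (di y) dy.
move=> v; apply: (@differentiable_nbhs_eq _ _ ((fun z => 'd f z (0, v)) \o i2)).
  move: df'; apply: filterS => y dy /=.
  have -> : (fun y : V2 => f (a, y)) = f \o i2 by [].
  by rewrite (diff_comp (di y) dy) /= (@diff_val _ _ _ _ _ _ _ (dp y)).
exact: differentiable_comp (di b) (d2f _).
Qed.

Lemma diff2_pairr (V1 V2 W : normedModType R) (f : V1 * V2 -> W) (a : V1) (b : V2) :
  diff2 f (a, b) -> diff2 (fun x => f (x, b)) a.
Proof.
move=> [df d2f].
pose i2 := fun y : V1 => (y, b).
have dp y : is_diff y i2 (fun y => (y, 0)) by apply: is_diff_pair.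
have di y : differentiable i2 y by exact: (@ex_diff _ _ _ _ _ _ _ (dp y)).
have pc : (fun y : V1 => (y, b)) @ a --> (a, b) by apply: cvg_pair; [exact: cvg_id|exact: cvg_cst].
have df' : \near a, differentiable f (a, b) by exact: pc _ df.
split.
  by move: df'; apply: filterS => y dy; exact: differentiable_comp (di y) dy.
move=> v; apply: (@differentiable_nbhs_eq _ _ ((fun z => 'd f z (v, 0)) \o i2)).
  move: df'; apply: filterS => y dy /=.
  have -> : (fun y : V1 => f (y, b)) = f \o i2 by [].
  by rewrite (diff_comp (di y) dy) /= (@diff_val _ _ _ _ _ _ _ (dp y)).
exact: differentiable_comp (di a) (d2f _).
Qed.

End Calculus.

(** * Symmetry of second derivatives *)

Section Young.
Variable R : realType.

Lemma is_derive_line (V : normedModType R) (f : V -> R) (x b : V) (s : R) :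
  differentiable f (s *: x + b) ->
  is_derive s 1 (fun s => f (s *: x + b)) ('d f (s *: x + b) x).
Proof.
move=> df; pose l := fun s : R => s *: x + b.
have dl : is_diff s l (fun h => h *: x + 0).
  by apply: is_diffD; exact: is_diff_scalel.
have ex : differentiable l s by exact: (@ex_diff _ _ _ _ _ _ _ dl).
have dfl : differentiable (f \o l) s by exact: differentiable_comp.
apply: DeriveDef; first exact/derivable1_diffP.
rewrite deriveE // -/(f \o l) diff_comp //= (@diff_val _ _ _ _ _ _ _ dl).
by rewrite addr0 scale1r.
Qed.

(** The mean value theorem for g(s) = f(s x + t y + a) - f(s x + a) on [0, t] turns the second
    difference into t times a difference of values of F = df(-) x, and F is then expanded to first
    order at a. *)
Lemma second_difference (V : normedModType R) (f : V -> R) a x y eps :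
  diff2 f a -> 0 < eps ->
  \forall t \near (0 : R)^'+,
    `|f (t *: x + t *: y + a) - f (t *: x + a) - f (t *: y + a) + f a
      - t ^+ 2 * 'd (fun z => 'd f z x) a y|
    <= t ^+ 2 * (eps * (`|x| + `|y|) + eps * (`|x| + `|y|)).
Proof.
move=> [df d2f] eps0; set F := fun z => 'd f z x; set L := 'd F a.
have hd : \forall h \near (0 : V), differentiable f (h + a).
  have : (fun h : V => h + a) @ (0 : V) --> a.
    by rewrite -[X in _ --> X]add0r; apply: cvgD; [exact: cvg_id|exact: cvg_cst].
  by move=> /(_ _ df).
have [d /= d0 hP] := (@nbhs_ballP _ _ _ _).1
  (filterI hd (differentiable_eps (d2f x) eps0)).
have {}hP h : `|h| < d -> differentiable f (h + a) /\
    `|F (h + a) - F a - L h| <= eps * `|h|.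
  by move=> hd'; apply: hP; rewrite -ball_normE /= sub0r normrN.
pose N := `|x| + `|y|; have N0 : 0 <= N by rewrite addr_ge0.
near=> t.
have t0 : 0 < t by near: t; exact: nbhs_right_gt.
have tN : t * N < d.
  (* The whole parallelogram must fit in the ball of radius d; N + 1 is positive even when x = y =
     0. *)
  have : t < d / (N + 1) by near: t; apply: nbhs_right_lt; rewrite divr_gt0 // ltr_wpDl.
  rewrite ltr_pdivlMr ?ltr_wpDl // => /(le_lt_trans _); apply.
  by rewrite ler_pM2l // lerDl.
have bound s u : 0 <= s <= t -> 0 <= u <= t -> `|s *: x + u *: y| <= t * N.
  move=> /andP[s0 st] /andP[u0 ut]; apply: le_trans (ler_normD _ _) _.
  by rewrite !normrZ !ger0_norm // mulrDr lerD // ler_wpM2r.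
have lt0 : (0 : R) <= 0 <= t by apply/andP; split; [exact: lexx|exact: ltW].
have ltt : 0 <= t <= t by apply/andP; split; [exact: ltW|exact: lexx].
pose g (s : R) := f (s *: x + (t *: y + a)) - f (s *: x + a).
have dg s : 0 <= s <= t ->
    is_derive s 1 g (F (s *: x + (t *: y + a)) - F (s *: x + a)).
  move=> hs; apply: is_deriveB; apply: is_derive_line.
    by rewrite addrA; apply: (hP _ (le_lt_trans (bound _ _ hs ltt) tN)).1.
  apply: (hP _ _).1; rewrite -[_ *: x]addr0 -(scale0r y).
  exact: le_lt_trans (bound _ _ hs lt0) tN.
have [s|s|s hs] := @MVT R g (fun s => F (s *: x + (t *: y + a)) - F (s *: x + a)) 0 t t0.
- rewrite in_itv /= => /andP[s0 st]; apply: dg; by rewrite !ltW.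
- apply: continuous_in_subspaceT s => s; rewrite inE /= in_itv /= => hs.
  have [dgs _] := dg s hs; exact: differentiable_continuous ((derivable1_diffP _ _).1 dgs).
rewrite subr0 /g scale0r !add0r => gt.
have -> : f (t *: x + t *: y + a) - f (t *: x + a) - f (t *: y + a) + f a =
    (F (s *: x + (t *: y + a)) - F (s *: x + a)) * t by rewrite -gt addrA; ring.
have st : 0 <= s <= t by move: hs; rewrite in_itv /= => /andP[/ltW-> /ltW->].
have [_ h1] := hP _ (le_lt_trans (bound s t st ltt) tN).
have [_ h2] := hP _ (le_lt_trans (bound s 0 st lt0) tN).
rewrite scale0r addr0 in h2; rewrite -(addrA (s *: x) (t *: y) a) in h1.
have b1 := bound s t st ltt; have b2 := bound s 0 st lt0.
rewrite scale0r addr0 in b2.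
have e1 := le_trans h1 (ler_wpM2l (ltW eps0) b1).
have e2 := le_trans h2 (ler_wpM2l (ltW eps0) b2).
(* Since L(s x + t y) - L(s x) = t L(y), the error is t times a difference of two first-order
   remainders, each at most eps t N. *)
have -> : (F (s *: x + (t *: y + a)) - F (s *: x + a)) * t - t ^+ 2 * L y =
  t * ((F (s *: x + (t *: y + a)) - F a - L (s *: x + t *: y)) -
       (F (s *: x + a) - F a - L (s *: x))).
  rewrite linearD [L (t *: y)]linearZ /= -[t *: L y]/(t * L y); ring.
rewrite normrM gtr0_norm // expr2 -mulrA ler_pM2l //.
apply: le_trans (ler_normB _ _) _; rewrite mulrDr; apply: lerD.
  by rewrite [t * (eps * _)]mulrCA.
by rewrite [t * (eps * _)]mulrCA.
Unshelve. all: by end_near. Qed.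

(* Young's form of Schwarz's theorem: no continuity of second derivatives. *)
Lemma diff2_sym_real (V : normedModType R) (f : V -> R) a x y :
  diff2 f a -> 'd (fun z => 'd f z x) a y = 'd (fun z => 'd f z y) a x.
Proof.
move=> df; apply/eqP; rewrite -subr_eq0 -normr_eq0; apply/eqP.
set A := 'd _ a y; set B := 'd _ a x; pose N := `|x| + `|y|.
apply/eqP; rewrite eq_le normr_ge0 andbT; apply/ler_addgt0Pl => e e0; rewrite addr0.
have N0 : 0 < N + 1 by rewrite ltr_wpDl // addr_ge0.
(* The second difference is symmetric in x and y; its two estimates err by 2 t^2 eps N each, and 4
   eps N <= e. *)
pose eps := e / (4 * (N + 1)); have eps0 : 0 < eps by rewrite divr_gt0 // mulr_gt0.
near (0 : R)^'+ => t.
have t0 : 0 < t by near: t; exact: nbhs_right_gt.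
have h1 : `|f (t *: x + t *: y + a) - f (t *: x + a) - f (t *: y + a) + f a
      - t ^+ 2 * A| <= t ^+ 2 * (eps * (`|x| + `|y|) + eps * (`|x| + `|y|)).
  by near: t; exact: second_difference.
have h2 : `|f (t *: y + t *: x + a) - f (t *: y + a) - f (t *: x + a) + f a
      - t ^+ 2 * B| <= t ^+ 2 * (eps * (`|y| + `|x|) + eps * (`|y| + `|x|)).
  by near: t; exact: second_difference.
rewrite [t *: y + _]addrC [_ - f (t *: y + a) - _]addrAC (addrC (`|y|)) -/N in h2.
rewrite -/N in h1.
have t2 : 0 < t ^+ 2 by rewrite exprn_gt0.
have h3 : t ^+ 2 * `|A - B| <= t ^+ 2 * e.
  rewrite -{1}(gtr0_norm t2) -normrM.
  set D := _ + f a in h1 h2.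
  have -> : t ^+ 2 * (A - B) = (D - t ^+ 2 * B) - (D - t ^+ 2 * A) by ring.
  apply: le_trans (ler_normB _ _) _; apply: le_trans (lerD h2 h1) _.
  rewrite -mulrDr ler_pM2l //.
  have -> : eps * N + eps * N + (eps * N + eps * N) = e * (N / (N + 1)).
    by rewrite /eps; field; rewrite gt_eqF.
  by rewrite ger_pMr // ler_pdivrMr // mul1r lerDl.
by rewrite ler_pM2l in h3.
Unshelve. all: by end_near. Qed.

Lemma diff2_sym n (V : normedModType R) (f : V -> 'rV[R]_n) a x y :
  diff2 f a -> 'd (fun z => 'd f z x) a y = 'd (fun z => 'd f z y) a x.
Proof.
move=> [df d2f]; apply/rowP => i.
have e v : \near a, 'd f a v 0 i = 'd (fun z => f z 0 i) a v.
  by move: df; apply: filterS => z dz; rewrite (diff_coord i dz).2.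
have df2 : diff2 (fun z => f z 0 i) a.
  split; first by move: df; apply: filterS => z dz; exact: (diff_coord i dz).1.
  by move=> v; apply: differentiable_nbhs_eq (e v) (diff_coord i (d2f v)).1.
have {}e v w : 'd (fun z => 'd f z v) a w 0 i = 'd (fun z => 'd (fun z => f z 0 i) z v) a w.
  apply: etrans (esym ((diff_coord i (d2f v)).2 w)) _.
  exact: esym (congr1 (fun g : V -> R => g w) (diff_nbhs_eq (e v) (diff_coord i (d2f v)).1)).
by rewrite !e; exact: diff2_sym_real.
Qed.

End Young.

(** * The adjoint action *)

Section Charts.
Variables (R : realType) (n : nat) (G : lieGroup R n).
Implicit Types (p q : G) (d : chart R n G).

Local Notation img d := (cmap d @` cdom d).

Lemma chart_imgK d x : img d x -> cmap d (cinv d x) = x.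
Proof. by move=> [p dp <-]; rewrite cmapK. Qed.

Lemma chart_img_dom d x : img d x -> cdom d (cinv d x).
Proof. by move=> [p dp <-]; rewrite cmapK. Qed.

Lemma nbhs_chart_img d x : img d x -> \forall y \near x, img d y.
Proof. by move=> dx; apply: open_nbhs_nbhs; split=> //; exact: cimg_open. Qed.

Lemma nbhs_chart_dom d p : cdom d p -> \forall q \near p, cdom d q.
Proof. by move=> dx; apply: open_nbhs_nbhs; split=> //; exact: cdom_open. Qed.

Lemma mul_cvg (T : topologicalType) (t : T) (f g : T -> G) p q :
  f @ t --> p -> g @ t --> q -> (f s * g s)%g @[s --> t] --> (p * q)%g.
Proof.
move=> fp gq; apply: (@continuous_cvg _ _ _ (nbhs t) _ (fun s => (f s, g s)) (fun pq => (pq.1 * pq.2)%g) (p, q)).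
  exact: lie_mul_continuous.
exact: cvg_pair.
Qed.

Lemma mul_cvg_cst (T : topologicalType) (t : T) (f : T -> G) p q :
  f @ t --> q -> (p * f s)%g @[s --> t] --> (p * q)%g.
Proof. by apply: mul_cvg; apply: (@cvg_cst G _ _ (nbhs t)). Qed.

Definition chart_mul (c1 c2 c3 : chart R n G) (xy : 'rV[R]_n * 'rV[R]_n) : 'rV[R]_n :=
  cmap c3 (cinv c1 xy.1 * cinv c2 xy.2)%g.

(** The set on which the product is smooth in these charts contains a neighbourhood of (x, y), so
    differentiability on it is differentiability near the point. *)
Lemma diff2_chart_mul c1 c2 c3 x y : lie_atlas c1 -> lie_atlas c2 -> lie_atlas c3 ->
  img c1 x -> img c2 y -> cdom c3 (cinv c1 x * cinv c2 y)%g ->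
  diff2 (chart_mul c1 c2 c3) (x, y).
Proof.
move=> h1 h2 h3 x1 y2 xy3.
have [dm _] := lie_mul_smooth h1 h2 h3 1; have [_ d2m] := lie_mul_smooth h1 h2 h3 2.
split; last first.
  by move=> v; have [d _] := d2m v; apply: d; split.
have f1 : (fun xy : 'rV[R]_n * 'rV[R]_n => xy.1) @ (x, y) --> x by exact: cvg_fst.
have f2 : (fun xy : 'rV[R]_n * 'rV[R]_n => xy.2) @ (x, y) --> y by exact: cvg_snd.
have n1 : \forall w \near (x, y), img c1 w.1 by exact: f1 _ (nbhs_chart_img x1).
have n2 : \forall w \near (x, y), img c2 w.2 by exact: f2 _ (nbhs_chart_img y2).
have g1 : (fun xy : 'rV[R]_n * 'rV[R]_n => cinv c1 xy.1) @ (x, y) --> cinv c1 x.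
  by apply: (@continuous_cvg _ _ _ _ _ _ (cinv c1)); [exact: cinv_cont|exact: f1].
have g2 : (fun xy : 'rV[R]_n * 'rV[R]_n => cinv c2 xy.2) @ (x, y) --> cinv c2 y.
  by apply: (@continuous_cvg _ _ _ _ _ _ (cinv c2)); [exact: cinv_cont|exact: f2].
have n3 : \forall w \near (x, y), cdom c3 (cinv c1 w.1 * cinv c2 w.2)%g.
  exact: mul_cvg g1 g2 _ (nbhs_chart_dom xy3).
by move: n1 n2 n3; apply: filterS3 => w w1 w2 w3; apply: dm; split.
Qed.

End Charts.

Section AdjointAction.
Variables (R : realType) (n : nat) (G : lieGroup R n) (c : chart R n G).
Hypotheses (hc : lie_atlas c) (c1 : cdom c 1%g).
Implicit Types p q : G.

Local Notation img d := (cmap d @` cdom d).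
Local Notation e := (cmap c 1%g).
Local Notation br := (lie_bracket c).
Local Notation Ad := (Ad c).

Let ie : img c e. Proof. by exists 1%g. Qed.
Let cinv1 : cinv c e = 1%g. Proof. exact: cmapK. Qed.

Definition conj_chart p (y : 'rV[R]_n) : 'rV[R]_n := cmap c (p * cinv c y * p^-1)%g.

Lemma conj_chart_e p : conj_chart p e = e.
Proof. by rewrite /conj_chart cinv1 mulg1 mulgV. Qed.

Let cinv_cvg x : img c x -> cinv c y @[y --> x] --> cinv c x.
Proof. by move=> ix; exact: cinv_cont. Qed.

Lemma near_conj p : \forall y \near e, cdom c (p * cinv c y * p^-1)%g.
Proof.
have h : (p * cinv c y * p^-1)%g @[y --> e] --> (p * cinv c e * p^-1)%g.
  apply: mul_cvg; last by apply: (@cvg_cst G _ _ (nbhs e)).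
  exact: mul_cvg_cst (cinv_cvg ie).
rewrite cinv1 mulg1 mulgV in h; exact: h _ (nbhs_chart_dom c1).
Qed.

(** Neither p nor p^-1 need lie in [c], so conjugation is factored through a chart [d] around p:
    left multiplication by p goes from [c] to [d], and right multiplication by p^-1 from [d] back to
    [c]. *)
Lemma diff2_conj_chart p : diff2 (conj_chart p) e.
Proof.
have [d hd dp] := lie_cover p; have [d' hd' dp'] := lie_cover p^-1%g.
have ip : img d (cmap d p) by exists p.
have ip' : img d' (cmap d' p^-1%g) by exists p^-1%g.
have D1 : diff2 (chart_mul d c d) (cmap d p, e).
  by apply: diff2_chart_mul => //; rewrite cinv1 mulg1 cmapK.
have D2 : diff2 (chart_mul d d' c) (cmap d p, cmap d' p^-1%g).
  by apply: diff2_chart_mul => //; rewrite !cmapK // mulgV.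
have E1 := diff2_pairl D1; have E2 := diff2_pairr D2.
have hx : chart_mul d c d (cmap d p, e) = cmap d p.
  by rewrite /chart_mul /= cinv1 mulg1 cmapK.
rewrite -hx in E2.
apply: diff2_nbhs_eq (diff2_comp E1 E2).
have h : (p * cinv c y)%g @[y --> e] --> (p * cinv c e)%g.
  exact: mul_cvg_cst (cinv_cvg ie).
rewrite cinv1 mulg1 in h.
have nd : \forall y \near e, cdom d (p * cinv c y)%g by exact: h _ (nbhs_chart_dom dp).
move: nd; apply: filterS => y dy.
by rewrite /chart_mul /conj_chart /= (cmapK dp) (cmapK dy) (cmapK dp').
Qed.

Let phi_diff p : differentiable (conj_chart p) e.
Proof. exact: nbhs_singleton (diff2_conj_chart p).1. Qed.

Lemma AdE p : Ad p = 'd (conj_chart p) e :> (_ -> _). Proof. by []. Qed.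

Lemma Ad_one x : Ad 1%g x = x.
Proof.
rewrite AdE (@diff_nbhs_eq _ _ _ id); first by rewrite diff_val.
  have := nbhs_chart_img ie; apply: filterS => y iy.
  by rewrite /conj_chart mul1g invg1 mulg1 chart_imgK.
exact: ex_diff.
Qed.

Lemma Ad_mul p q x : Ad (p * q)%g x = Ad p (Ad q x).
Proof.
have dp : differentiable (conj_chart p) (conj_chart q e) by rewrite conj_chart_e.
have E : \forall y \near e, (conj_chart p \o conj_chart q) y = conj_chart (p * q)%g y.
  move: (near_conj q); apply: filterS => y qy.
  by rewrite /conj_chart /= (cmapK qy) invgM !mulgA.
have h := etrans (diff_nbhs_eq E (differentiable_comp (phi_diff q) dp))
  (diff_comp (phi_diff q) dp).
apply: etrans (congr1 (fun f : 'rV[R]_n -> 'rV[R]_n => f x) h) _.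
have h2 : forall z, z = e -> 'd (conj_chart p) z (Ad q x) = Ad p (Ad q x) by move=> z ->.
exact: h2 (conj_chart_e q).
Qed.

Local Notation m := (chart_mul c c c).
Local Notation L := (left_invariant c).

Let m_diff2 z : img c z -> diff2 m (z, e).
Proof. by move=> iz; apply: diff2_chart_mul => //; rewrite cinv1 mulg1; exact: chart_img_dom. Qed.

(** In this form z enters only through the base point of the derivative of m along a fixed vector,
    which is differentiable in the base point. *)
Lemma left_invariantE z x : img c z -> L x z = 'd m (z, e) (0, x).
Proof.
move=> iz; have dm := nbhs_singleton (m_diff2 iz).1.
have di : is_diff e (fun y : 'rV[R]_n => (z, y)) (fun y => (0, y)) by apply: is_diff_pair.
rewrite /left_invariant.
have -> : (fun y => cmap c (cinv c z * cinv c y)%g) = m \o (fun y => (z, y)) by [].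
rewrite (diff_comp (@ex_diff _ _ _ _ _ _ _ di) dm) /=.
by rewrite (@diff_val _ _ _ _ _ _ _ di).
Qed.

Lemma left_invariant_e x : L x e = x.
Proof.
rewrite /left_invariant (@diff_nbhs_eq _ _ _ id); first by rewrite diff_val.
  have := nbhs_chart_img ie; apply: filterS => y iy.
  by rewrite cinv1 mul1g chart_imgK.
exact: ex_diff.
Qed.

Lemma differentiable_left_invariant x : differentiable (L x) e.
Proof.
apply: (@differentiable_nbhs_eq _ _ _ ((fun w => 'd m w (0, x)) \o (fun z => (z, e)))).
  by have := nbhs_chart_img ie; apply: filterS => z iz; rewrite (left_invariantE _ iz).
have di : is_diff e (fun z : 'rV[R]_n => (z, e)) (fun y => (y, 0)) by apply: is_diff_pair.
exact: differentiable_comp (@ex_diff _ _ _ _ _ _ _ di) ((m_diff2 ie).2 _).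
Qed.

Lemma lie_bracketxx x : br x x = 0.
Proof. exact: subrr. Qed.

Let dL_lin y : lin (fun x => 'd (L x) e y).
Proof.
move=> k x x'.
have LP z : L (k *: x + x') z = k *: L x z + L x' z by exact: linearP.
have {LP}-> : L (k *: x + x') = k *: L x + L x' by apply/funext => z; exact: LP.
have dx := differentiable_left_invariant x.
have dx' := differentiable_left_invariant x'.
move: (L x) (L x') dx dx' => f f' df df'.
apply: etrans (congr1 (fun h : 'rV[R]_n -> 'rV[R]_n => h y) (diffD (differentiableZ k df) df')) _.
exact: (congr1 (fun h : 'rV[R]_n -> 'rV[R]_n => h y + _) (diffZ k df)).
Qed.

Let dLP y k x x' : 'd (L y) e (k *: x + x') = k *: 'd (L y) e x + 'd (L y) e x'.
Proof. exact: linearP. Qed.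

Let subr_lincomb (k : R) (a b a' b' : 'rV[R]_n) :
  (k *: a + b) - (k *: a' + b') = k *: (a - a') + (b - b').
Proof. by rewrite scalerBr opprD addrACA. Qed.

Lemma lin_lie_bracketl y : lin (fun x => br x y).
Proof.
move=> k x x'.
exact: etrans (congr2 (fun s t => s - t) (dLP y k x x') (dL_lin y k x x')) (subr_lincomb _ _ _ _ _).
Qed.

Lemma lin_lie_bracketr x : lin (br x).
Proof.
move=> k y y'.
exact: etrans (congr2 (fun s t => s - t) (dL_lin x k y y') (dLP x k y y')) (subr_lincomb _ _ _ _ _).
Qed.

(** Conjugation carries the left-invariant field of x to that of Ad_p x: differentiate c_p(z y) =
    c_p(z) c_p(y) in y at the unit. The point z stays near e so that all the products remain in the
    chart. *)
Lemma conj_chart_left_invariant p x :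
  \forall z \near e, 'd (conj_chart p) z (L x z) = L (Ad p x) (conj_chart p z).
Proof.
have n1 := nbhs_chart_img ie; have n2 := near_conj p.
move: n1 n2 (diff2_conj_chart p).1; apply: filterS3 => z iz cz dz.
have iz' : img c (conj_chart p z) by exists (p * cinv c z * p^-1)%g.
have dmz (w : 'rV[R]_n) : img c w -> differentiable (fun y => m (w, y)) e.
  by move=> iw; exact: nbhs_singleton (diff2_pairl (m_diff2 iw)).1.
have mz : m (z, e) = z by rewrite /chart_mul /= cinv1 mulg1 chart_imgK.
have zc : cdom c (cinv c z) := chart_img_dom iz.
have h : (cinv c z * cinv c y)%g @[y --> e] --> (cinv c z * cinv c e)%g.
  exact: mul_cvg_cst (cinv_cvg ie).
rewrite cinv1 mulg1 in h.
have nz : \forall y \near e, cdom c (cinv c z * cinv c y)%g by exact: h _ (nbhs_chart_dom zc).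
have eq : \forall y \near e, (conj_chart p \o (fun y => m (z, y))) y =
    ((fun y => m (conj_chart p z, y)) \o conj_chart p) y.
  move: nz (near_conj p); apply: filterS2 => y zy py.
  rewrite /conj_chart /chart_mul /= (cmapK zy) (cmapK cz) (cmapK py).
  by congr (cmap c _); rewrite !mulgA mulgVK.
have dmz' : differentiable (fun y => m (conj_chart p z, y)) (conj_chart p e).
  by rewrite conj_chart_e; exact: dmz.
have dz' : differentiable (conj_chart p) (m (z, e)) by rewrite mz.
have LE : 'd (fun y => m (z, y)) e x = L x z by [].
have h1 w u : w = z -> u = L x z -> 'd (conj_chart p) w u = 'd (conj_chart p) z (L x z).
  by move=> -> ->.
have h2 w : w = e -> 'd (fun y => m (conj_chart p z, y)) w (Ad p x) = L (Ad p x) (conj_chart p z).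
  by move=> ->.
have E := etrans (esym (diff_comp (phi_diff p) dmz'))
  (etrans (diff_nbhs_eq eq (differentiable_comp (dmz _ iz) dz')) (diff_comp (dmz _ iz) dz')).
have E' := congr1 (fun f : 'rV[R]_n -> 'rV[R]_n => f x) E.
rewrite /= in E'.
have a2 := h2 _ (conj_chart_e p).
have h3 := etrans (esym E') a2.
refine (etrans (esym (h1 _ _ mz _)) h3).
exact: LE.
Qed.

Let d2conj p (u v : 'rV[R]_n) := 'd (fun z => 'd (conj_chart p) z u) e v.

(* The derivative along v, at the unit, of conj_chart_left_invariant; the extra
   term is symmetric in u and v and disappears from the bracket. *)
Let Ad_dL p u v : Ad p ('d (L u) e v) + d2conj p u v = 'd (L (Ad p u)) e (Ad p v).
Proof.
have [_ d2] := diff2_conj_chart p.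
have lA z : lin ('d (conj_chart p) z) by move=> k a b; exact: linearP.
have [da dE] := diff_apply lA d2 (differentiable_left_invariant u).
have dL : differentiable (L (Ad p u)) (conj_chart p e).
  by rewrite conj_chart_e; exact: differentiable_left_invariant.
have E := etrans (esym (diff_comp (phi_diff p) dL))
  (diff_nbhs_eq (conj_chart_left_invariant p u) da).
pose D w := 'd (L (Ad p u)) w (Ad p v).
have h2 : D (conj_chart p e) = D e by exact: (congr1 D (conj_chart_e p)).
have E' := congr1 (fun f : 'rV[R]_n -> 'rV[R]_n => f v) E.
rewrite /= in E'.
have h1 : d2conj p (L u e) v = d2conj p u v by exact: (congr1 (fun w => d2conj p w v) (left_invariant_e u)).
have h3 := etrans (esym (dE v)) (etrans (esym E') h2).
apply: etrans _ h3; apply: congrD.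
  reflexivity.
apply: etrans (esym h1) _.
rewrite /d2conj.
reflexivity.
Qed.

Lemma Ad_lie_bracket p x y : Ad p (br x y) = br (Ad p x) (Ad p y).
Proof.
have AdB a b : Ad p (a - b) = Ad p a - Ad p b by exact: linearB.
have d2C : d2conj p x y = d2conj p y x := diff2_sym x y (diff2_conj_chart p).
apply: etrans (AdB _ _) _.
apply: etrans _ (congr2 (fun s t => s - t) (Ad_dL p y x) (Ad_dL p x y)).
by rewrite d2C; move: (d2conj _ _ _) => t; rewrite opprD addrACA subrr addr0.
Qed.

End AdjointAction.

(** * Vector groups *)

Section VectorGroup.
Variables (R : realType) (n : nat).

Lemma Ck_cst (V W : normedModType R) k (D : set V) (w : W) : Ck k D (cst w).
Proof.
elim: k w => [|k IH] w /=; first by move=> x _; exact: cst_continuous.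
split=> [x _|v]; first exact: differentiable_cst.
suff -> : (fun x => 'd (cst w) x v) = cst 0 by exact: IH.
by apply/funext => x; rewrite diff_cst.
Qed.

(** The derivative is f at every point, so the directional derivatives are constant. *)
Lemma smooth_linear (V W : normedModType R) (D : set V) (f : V -> W) :
  lin f -> continuous f -> smooth_on D f.
Proof.
move=> lf cf k; pose fL : {linear V -> W} := HB.pack f (GRing.isLinear.Build _ _ _ _ _ lf).
have df x : differentiable f x by exact: (@linear_differentiable _ _ _ fL).
have dE x : 'd f x = f :> (V -> W) by exact: (@diff_lin _ _ _ fL).
case: k => [|k] /=; first by move=> x _; exact: cf.
split=> [x _|v]; first exact: df.
suff -> : (fun x => 'd f x v) = cst (f v) by exact: Ck_cst.
by apply/funext => x; rewrite dE.
Qed.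

(** An alias of the row vectors that can carry addition as its group law. *)
Definition vector_group : Type := 'rV[R]_n.
HB.instance Definition _ := Topological.copy vector_group 'rV[R]_n.
HB.instance Definition _ := isGroup.Build vector_group
  (@addrA 'rV[R]_n) (@add0r _) (@addr0 _) (@addNr _) (@addrN _).

Lemma image_id_setT : (id : vector_group -> 'rV[R]_n) @` setT = setT.
Proof. by apply/seteqP; split=> x // _; exists x. Qed.

Definition vector_chart : chart R n vector_group.
Proof.
apply: (@Chart R n vector_group setT id id).
- exact: openT.
- by rewrite image_id_setT; exact: openT.
- by [].
- by move=> p _; exact: cvg_id.
- by move=> p _; exact: cvg_id.
Defined.

Definition vector_lieGroup : lieGroup R n.
Proof.
apply: (@LieGroup R n vector_group [set vector_chart]).
- exact: (@norm_hausdorff R 'rV[R]_n).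
- by move=> p; exists vector_chart.
- move=> c d -> ->; apply: smooth_linear => [k x y //|x]; exact: (@cvg_id _ (nbhs x)).
- exact: (@add_continuous 'rV[R]_n).
- exact: (@opp_continuous 'rV[R]_n).
- move=> c1 c2 c3 -> -> ->; apply: smooth_linear => [k x y|].
    by rewrite /= scalerDr addrACA.
  exact: (@add_continuous 'rV[R]_n).
- move=> c1 c2 -> ->; apply: smooth_linear => [k x y|].
    have h : - (k *: x + y) = k *: - x - y by rewrite opprD scalerN.
    exact: h.
  exact: (@opp_continuous 'rV[R]_n).
Defined.

End VectorGroup.

Theorem theorem2 (R : realType) :
  (forall (n : nat) (G : lieGroup R n) (c : chart R n G),
     lie_atlas c -> cdom c 1%g ->
     (* Γ^finite(G × (T ⊗ E)) is a filtered and graded Hopf algebra *)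
     filtered_graded_hopf (@cur_deg R n G) (@cur_filtration R n G)
       (cur_mul c) (cur_one G) (@cur_Delta R n G) (@cur_eps R n G)
       (cur_antipode c)
     (* the formula (B) for arbitrary alpha_0, ..., alpha_k in the Lie algebra *)
  /\ (forall (p : G) (v : tensor_alg R n) (s : seq 'rV[R]_n),
        cur_bd c (at_pt p (v ⊗ wedges s)) = bd_formula c p v s)
     (* the boundary lowers degrees by 1 and filtrations grow by at most 1 *)
  /\ linear (cur_bd c)
  /\ (forall k r x, @cur_filtration R n G k.+1 r x ->
        @cur_filtration R n G k r.+1 (cur_bd c x))
  /\ (forall r x, @cur_filtration R n G 0%N r x -> cur_bd c x = 0)
     (* the boundary is a graded coderivation *)
  /\ (forall x : currents R G,
        cur_Delta (cur_bd c x) =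
        tlift (fun x1 x2 : currents R G =>
                 cur_bd c x1 ⊗ x2 + gsign (@cur_deg R n G) x1 ⊗ cur_bd c x2)
          (cur_Delta x)))
  (* in general the boundary is not a differential *)
  /\ (exists (n : nat) (G : lieGroup R n) (c : chart R n G) (x : currents R G),
        [/\ lie_atlas c, cdom c 1%g & cur_bd c (cur_bd c x) <> 0]).
Proof.
split=> [n G c hc c1|].
  have hl := lin_lie_bracketl hc c1; have hr := lin_lie_bracketr hc c1.
  have hM := Ad_mul hc c1; have h1 := Ad_one (c := c) c1.
  have hb := Ad_lie_bracket hc c1; have hx := lie_bracketxx c.
  split; first exact: cur_hopf.
  split; first exact: cur_bd_wedges.
  split; first exact: lin_cur_bd.
  split; first exact: cur_bd_filtration.
  split; first exact: cur_bd_deg0.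
  exact: cur_bd_coder.
pose G := vector_lieGroup R 2; pose c : chart R 2 G := vector_chart R 2.
have hc : lie_atlas c by [].
have c1 : cdom c 1%g by [].
have i01 : (ord0 : 'I_2) != ord_max by [].
have h := cur_bd_bd_neq0 (lin_lie_bracketl hc c1) (lin_lie_bracketr hc c1)
  (Ad_one (c := c) c1) (lie_bracketxx c) i01.
by exists 2, G, c; eexists; split; [exact: hc|exact: c1|exact: h].
Qed.
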